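(* Assume that the following conjecture holds: for every fixed integer $k\ge1$, as $n,p\to\infty$ with $\frac{\log p}{n}\to0$, $$\int_0^{\sqrt{\left(4-\frac{2}{k+2}\right)\log p}}G_{n,p}(x)\,\bar F_n^{k-1}(x)f_n(x)\,dx=o\left(\frac{1}{p^{2k}}\right).$$ Let $Z_1,\dots,Z_p\in\mathbb{R}^n$ be i.i.d. random vectors with a spherical distribution around $0$, with $\Pr(Z_i=0)=0$, and let $V_1\ge V_2\ge\cdots\ge V_{p(p-1)/2}$ be the order statistics, in decreasing order, of the absolute values $|S_{ij}|$, $1\le i<j\le p$, of the pairwise sample correlations of $Z_1,\dots,Z_p$. Then for fixed $d\ge0$ and every $1\le k\le d$, $$nV_k(V_k-V_{k+1})\xrightarrow{d}\mathrm{Exp}(1/k)$$ as $n,p\to\infty$ with $\frac{\log p}{n}\to0$.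
   Context: A random vector $Z\in\mathbb{R}^n$ has a spherical distribution around $0$ if $OZ$ has the same distribution as $Z$ for every orthogonal $n\times n$ matrix $O$. The sample correlation of $Z_i,Z_j$ is the (centered) Pearson correlation $S_{ij}=\frac{(Z_i-\bar Z_i\mathbf 1)^T(Z_j-\bar Z_j\mathbf 1)}{\|Z_i-\bar Z_i\mathbf 1\|_2\,\|Z_j-\bar Z_j\mathbf 1\|_2}$, where $\bar Z_i$ is the average of the coordinates of $Z_i$ and $\mathbf 1$ is the all-ones vector. For $n\ge3$, $f_n$ is the density of $\sqrt n|S_{ij}|$ ($i\neq j$), namely $f_n(x)=\frac{2}{\sqrt{n\pi}}\frac{\Gamma(\frac{n-1}{2})}{\Gamma(\frac{n-2}{2})}\left(1-\frac{x^2}{n}\right)^{(n-4)/2}$ supported on $[0,\sqrt n]$; $\bar F_n(x)=\int_x^{\sqrt n}f_n(u)\,du$; and $G_{n,p}(x)=\Pr\left(\max_{1\le i<j\le p}\sqrt n|S_{ij}|<x\right)$. $\mathrm{Exp}(\mu)$ denotes the exponential distribution with mean $\mu$. Limits are along any sequence $p=p_n$ with $p_n\to\infty$ and $\frac{\log p_n}{n}\to0$ as $n\to\infty$. *)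

(* Defs.v *)
From mathcomp Require Import all_boot all_order all_algebra.
From mathcomp Require Import all_classical all_reals all_analysis.

Set Implicit Arguments.
Unset Strict Implicit.
Unset Printing Implicit Defensive.

Import Order.TTheory GRing.Theory Num.Theory.
Import numFieldNormedType.Exports.

Local Open Scope classical_set_scope.
Local Open Scope ring_scope.

(* R^n as a measurable type: column vectors with their Borel sigma-algebra. *)
Definition vec (R : realType) (n : nat) := g_sigma_algebraType (@open 'cV[R]_n).

Section RandomVectors.
Context {d : measure_display} {T : measurableType d} {R : realType}.
Context (P : probability T R) {n p : nat}.

Definition same_distribution (X Y : T -> vec R n) : Prop :=
  forall B : set (vec R n), measurable B -> P (X @^-1` B) = P (Y @^-1` B).

Definition spherical (X : T -> 'cV[R]_n) : Prop :=
  forall O : 'M[R]_n, O^T *m O = 1%:M ->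
    same_distribution (fun w => O *m X w) X.

(* Taking B i = setT for i outside J gives the product rule over any
   subfamily J, so this is mutual independence. *)
Definition mutually_independent (Z : 'I_p -> {RV P >-> vec R n}) : Prop :=
  forall B : 'I_p -> set (vec R n), (forall i, measurable (B i)) ->
    P [set w | forall i, B i (Z i w)] = (\prod_(i < p) P (Z i @^-1` B i))%E.

Definition iid_spherical (Z : 'I_p -> {RV P >-> vec R n}) : Prop :=
  [/\ mutually_independent Z,
      forall i j, same_distribution (Z i) (Z j),
      forall i, spherical (Z i) &
      forall i, P [set w | Z i w = (0 : 'cV[R]_n)] = 0%E].

End RandomVectors.

Section SampleCorrelation.
Context {R : realType} {n : nat}.

Definition mean (x : 'cV[R]_n) : R := (\sum_(i < n) x i 0) / n%:R.

Definition centered (x : 'cV[R]_n) : 'cV[R]_n := x - const_mx (mean x).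

Definition dot (x y : 'cV[R]_n) : R := \sum_(i < n) x i 0 * y i 0.

(* The norm `|x| of the library on matrices is the sup norm. *)
Definition norm2 (x : 'cV[R]_n) : R := Num.sqrt (dot x x).

Definition sample_corr (x y : 'cV[R]_n) : R :=
  dot (centered x) (centered y) / (norm2 (centered x) * norm2 (centered y)).

Context {p : nat}.

Definition max_abs_corr (z : 'I_p -> 'cV[R]_n) : R :=
  \big[Num.max/0]_(ij : 'I_p * 'I_p | (ij.1 < ij.2)%N)
    `|sample_corr (z ij.1) (z ij.2)|.

Definition abs_corrs (z : 'I_p -> 'cV[R]_n) : seq R :=
  [seq `|sample_corr (z ij.1) (z ij.2)|
     | ij <- enum [pred ij : 'I_p * 'I_p | (ij.1 < ij.2)%N]].

(* The k-th largest value, counted from k = 1; it is meaningful for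
   1 <= k <= p(p-1)/2, and 0 for larger k. *)
Definition order_stat (k : nat) (z : 'I_p -> 'cV[R]_n) : R :=
  nth 0 (sort (fun a b : R => b <= a) (abs_corrs z)) k.-1.

End SampleCorrelation.

Section CorrelationDensity.
Context {R : realType}.

Definition Gamma (a : R) : R :=
  \int[lebesgue_measure]_(t in `]0, +oo[) (t `^ (a - 1) * expR (- t)).

Definition corr_pdf (n : nat) : R -> R :=
  (fun x => 2 / Num.sqrt (n%:R * pi)
            * (Gamma ((n%:R - 1) / 2) / Gamma ((n%:R - 2) / 2))
            * (1 - x ^+ 2 / n%:R) `^ ((n%:R - 4) / 2))
  \_ `[0, Num.sqrt n%:R].

Definition corr_tail (n : nat) (x : R) : R :=
  \int[lebesgue_measure]_(u in `[x, Num.sqrt n%:R]) corr_pdf n u.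

Definition max_corr_cdf (d : measure_display) (T : measurableType d)
    (P : probability T R) (n p : nat) (Z : 'I_p -> {RV P >-> vec R n}) (x : R) : R :=
  fine (P [set w | Num.sqrt n%:R * max_abs_corr (fun i => Z i w) < x]).

End CorrelationDensity.

Definition admissible (R : realType) (p : nat -> nat) : Prop :=
  (p n @[n --> \oo] --> \oo) /\
  (ln (p n)%:R / n%:R @[n --> \oo] --> (0 : R)).

(* The law of the correlations, hence max_corr_cdf, is the same for all i.i.d.
   spherical samples without atom at 0; the conjecture is therefore stated for
   any choice of such samples. No condition is put on the samples for n < 3:
   for n = 0 there is none without atom at 0. *)
Definition max_corr_conjecture (R : realType) : Prop :=
  forall k : nat, (1 <= k)%N ->
  forall p : nat -> nat, admissible R p ->
  forall (d : nat -> measure_display) (T : forall n, measurableType (d n))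
    (P : forall n, probability (T n) R)
    (Z : forall n, 'I_(p n) -> {RV (P n) >-> vec R n}),
  (forall n, (3 <= n)%N -> iid_spherical (Z n)) ->
  (fun n => \int[lebesgue_measure]_(x in
       `[0, Num.sqrt ((4 - 2 / (k%:R + 2)) * ln (p n)%:R)])
     (max_corr_cdf (Z n) x * corr_tail n x ^+ k.-1 * corr_pdf n x) : R)
  =o_\oo (fun n => ((p n)%:R ^+ (2 * k))^-1 : R).

(* X n may live on a probability space that depends on n. *)
Definition cvg_in_distribution (R : realType) (d : nat -> measure_display)
    (T : forall n, measurableType (d n)) (P : forall n, probability (T n) R)
    (X : forall n, T n -> R) (mu : set R -> \bar R) : Prop :=
  forall x : R, {for x, continuous (fun y : R => mu `]-oo, y]%classic)} ->
    P n [set w | X n w <= x] @[n --> \oo] --> mu `]-oo, x]%classic.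

(* exponential_prob takes the rate, i.e. the inverse of the mean. *)
Definition Exp (R : realType) (m : R) : set R -> \bar R := exponential_prob m^-1.

(* Main.v *)
(* Let X_e = sqrt n |S_e| for a pair e, and let W_e = exp (v (v - X_e)), where
   the level v = v_n is chosen so that about a of the W_e lie below a. With
   W_(1) <= W_(2) <= ... the ordered W_e and X_(k) = sqrt n V_k,
     n V_k (V_k - V_(k+1)) = (X_(k) / v) ln (W_(k+1) / W_(k)),
   and X_(k) / v tends to 1 in probability. The W_e form in the limit a Poisson
   process of rate 1 on ]0, +oo[, for which P (l W_(k) < W_(k+1)) = l^-k, so
   ln (W_(k+1) / W_(k)) is exponential of rate k.

   Conditionally on all vectors but Z_j, the law of |S_ij| does not depend on
   them. Hence the exceedance at a pair e = (i, j) is independent of the count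
   over the pairs disjoint from e, and only O(p) pairs meet e: the probabilities
   of the counts obey the Stein-Chen recurrence of the Poisson distribution up
   to an error O(1/p).

   For the tail of |S_ij|, let A be a coordinate of a uniform random direction
   in dimension n - 1. Invariance under small rotations gives an integration by
   parts formula, by which H(x) = E[A; A > x] satisfies
   H' = - (n - 2) x / (1 - x^2) H, so that H(x)^2 = H(0)^2 (1 - x^2)^(n - 2). *)

From HB Require Import structures.
Require Import Defs.
From mathcomp Require Import all_boot all_order all_algebra.
From mathcomp Require Import all_classical all_reals all_analysis.
From mathcomp Require Import measurable_realfun.
From mathcomp Require Import ring lra.
Import Order.TTheory GRing.Theory Num.Theory.
Import numFieldNormedType.Exports.
Local Open Scope classical_set_scope.
Local Open Scope ring_scope.

Set Implicit Arguments.
Unset Strict Implicit.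
Unset Printing Implicit Defensive.

(** * Expectations of bounded functions *)

(** Convergence to a Poisson process is never formulated. Ranks translate into counts: the event
    W_(k) < b, c <= W_(k+1) says that both counts, below b and below c >= b, equal k. When the two
    counts agree, every point below c is already below b, so removing one point lowers both by one;
    the recurrence therefore runs on the single sequence P(N_b = N_c = i), and the ratio W_(k+1) /
    W_(k) is recovered from these events by a grid.

    H replaces P(A > x) because the integration by parts closes on it: the squares of the n - 2
    other coordinates add up to 1 - A^2, and -dH is A times the law of A, so no density of A is
    introduced. The price is that H(0) is known only within bounds, and that P(A > x) is only
    sandwiched between multiples of H(x) and of H(x) - H(y), y > x. Both are harmless: v solves an
    implicit equation that absorbs the constant, and all levels v - ln a / v are equivalent to v, so
    that y can be a level at which little mass is left. *)

Section Expectation.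
Context {d : measure_display} {T : measurableType d} {R : realType}.
Variable P : probability T R.
Implicit Types (f g : T -> R) (b : T -> bool) (A B : set T).

(** Indicators, coordinates of directions and counts are all bounded. This class is closed under
    ring operations and contained in the integrable functions, so it serves as the only side
    condition for linearity and monotonicity of [Ex]. *)
Definition bmeas f := measurable_fun [set: T] f /\ exists M, forall x, `|f x| <= M.
Definition Ex f : R := \int[P]_x f x.
Definition Pr A : R := fine (P A).

Lemma bmeas_integrable f : bmeas f -> P.-integrable [set: T] (EFin \o f).
Proof.
case=> mf [M fM]; apply: measurable_bounded_integrable => //.
  by rewrite [ltLHS]probability_setT ltry.
exists M; split; first exact: num_real.
by move=> x Mx y _ /=; apply: le_trans (fM y) (ltW Mx).
Qed.

Lemma bmeas_cst (r : R) : bmeas (fun=> r).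
Proof. by split; [exact: measurable_cst | exists `|r|]. Qed.

Lemma bmeasD f g : bmeas f -> bmeas g -> bmeas (fun x => f x + g x).
Proof.
move=> [mf [M fM]] [mg [N gN]]; split; first exact: measurable_funD.
by exists (M + N) => x; apply: le_trans (ler_normD _ _) _; apply: lerD.
Qed.

Lemma bmeasN f : bmeas f -> bmeas (fun x => - f x).
Proof.
move=> [mf [M fM]]; split; first exact: measurableT_comp.
by exists M => x; rewrite normrN.
Qed.

Lemma bmeasB f g : bmeas f -> bmeas g -> bmeas (fun x => f x - g x).
Proof. by move=> bf bg; apply: bmeasD => //; apply: bmeasN. Qed.

Lemma bmeasM f g : bmeas f -> bmeas g -> bmeas (fun x => f x * g x).
Proof.
move=> [mf [M fM]] [mg [N gN]]; split; first exact: measurable_funM.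
exists (M * N) => x; rewrite normrM; apply: ler_pM => //.
Qed.

Lemma bmeas_sum (I : Type) (r : seq I) (p : pred I) (F : I -> T -> R) :
  (forall i, p i -> bmeas (F i)) -> bmeas (fun x => \sum_(i <- r | p i) F i x).
Proof.
move=> bF; elim: r => [|i r IH].
  have -> : (fun x => \sum_(i <- [::] | p i) F i x) = (fun=> 0).
    by apply/funext => x; rewrite big_nil.
  exact: bmeas_cst.
under [X in bmeas X]eq_fun => x do rewrite big_cons.
by case: (boolP (p i)) => // pi; apply: bmeasD => //; apply: bF.
Qed.

Lemma bmeasX f n : bmeas f -> bmeas (fun x => f x ^+ n).
Proof.
move=> bf; elim: n => [|n IH]; first exact: bmeas_cst.
under [X in bmeas X]eq_fun => x do rewrite exprS.
exact: bmeasM.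
Qed.

Lemma bmeas_norm f : bmeas f -> bmeas (fun x => `|f x|).
Proof.
move=> [mf [M fM]]; split; first exact: measurableT_comp.
by exists M => x; rewrite normr_id.
Qed.

Lemma bmeas_bool b : measurable [set x | b x] -> bmeas (fun x => (b x)%:R).
Proof.
move=> mb; split; last by exists 1 => x; case: (b x); rewrite ?normr1 ?normr0.
have -> : (fun x => (b x)%:R) = \1_[set x | b x] :> (T -> R).
  by apply/funext => x; rewrite indicE mem_setE.
exact: measurable_indic.
Qed.

Lemma ExD f g : bmeas f -> bmeas g -> Ex (fun x => f x + g x) = Ex f + Ex g.
Proof. by move=> bf bg; apply: RintegralD => //; apply: bmeas_integrable. Qed.

Lemma ExB f g : bmeas f -> bmeas g -> Ex (fun x => f x - g x) = Ex f - Ex g.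
Proof. by move=> bf bg; apply: RintegralB => //; apply: bmeas_integrable. Qed.

Lemma ExZ f (r : R) : bmeas f -> Ex (fun x => r * f x) = r * Ex f.
Proof. by move=> bf; apply: RintegralZl => //; apply: bmeas_integrable. Qed.

Lemma Ex_cst (r : R) : Ex (fun=> r) = r.
Proof. by rewrite /Ex Rintegral_cst // [X in fine X]probability_setT mulr1. Qed.

Lemma ExN f : bmeas f -> Ex (fun x => - f x) = - Ex f.
Proof.
move=> bf; rewrite -mulN1r -ExZ //; congr Ex.
by apply/funext => x; rewrite mulN1r.
Qed.

Lemma Ex_sum (I : Type) (r : seq I) (p : pred I) (F : I -> T -> R) :
  (forall i, p i -> bmeas (F i)) ->
  Ex (fun x => \sum_(i <- r | p i) F i x) = \sum_(i <- r | p i) Ex (F i).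
Proof.
move=> bF; elim: r => [|i r IH].
  rewrite big_nil -[RHS]Ex_cst; congr Ex.
  by apply/funext => x; rewrite big_nil.
rewrite big_cons; under [X in Ex X]eq_fun => x do rewrite big_cons.
case: ifPn => // pi; rewrite ExD ?IH //; first exact: bF.
exact: bmeas_sum.
Qed.

Lemma le_Ex f g : bmeas f -> bmeas g -> (forall x, f x <= g x) -> Ex f <= Ex g.
Proof.
by move=> bf bg fg; apply: le_Rintegral => //; apply: bmeas_integrable.
Qed.

Lemma Ex_ge0 f : (forall x, 0 <= f x) -> 0 <= Ex f.
Proof. by move=> f0; apply: Rintegral_ge0. Qed.

Lemma Ex_bool b : measurable [set x | b x] -> Ex (fun x => (b x)%:R) = Pr [set x | b x].
Proof.
move=> mb; rewrite /Ex /Rintegral /Pr -[in RHS](setIT [set x | b x]).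
rewrite -integral_indic //; congr fine; apply: eq_integral => x _.
by rewrite indicE mem_setE.
Qed.

Lemma ae_eq_Ex f g A : bmeas f -> bmeas g -> measurable A -> P A = 0%E ->
  (forall x, ~ A x -> f x = g x) -> Ex f = Ex g.
Proof.
move=> [mf _] [mg _] mA A0 fg; rewrite /Ex /Rintegral; congr fine.
apply: ae_eq_integral => //; try exact/measurable_EFinP.
exists A; split => // x /= /not_implyP[_ fgx].
by apply: contrapT => nA; apply: fgx; rewrite fg.
Qed.

Lemma EFin_Pr A : measurable A -> (Pr A)%:E = P A.
Proof. by move=> mA; rewrite /Pr fineK // fin_num_measure. Qed.

Lemma Pr_ge0 A : 0 <= Pr A.
Proof. exact: fine_ge0. Qed.

Lemma le_Pr A B : measurable A -> measurable B -> A `<=` B -> Pr A <= Pr B.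
Proof.
by move=> mA mB AB; rewrite -lee_fin !EFin_Pr // le_measure ?inE.
Qed.

Lemma Pr_setT : Pr [set: T] = 1.
Proof. by rewrite /Pr probability_setT. Qed.

Lemma Pr_le1 A : measurable A -> Pr A <= 1.
Proof. by move=> mA; rewrite -Pr_setT; apply: le_Pr. Qed.

Lemma Pr_setU_le A B : measurable A -> measurable B -> Pr (A `|` B) <= Pr A + Pr B.
Proof.
move=> mA mB; rewrite -lee_fin EFinD !EFin_Pr //; last exact: measurableU.
exact: measureU2.
Qed.

Lemma Pr_setU A B : measurable A -> measurable B -> [disjoint A & B] ->
  Pr (A `|` B) = Pr A + Pr B.
Proof.
move=> mA mB AB; apply/EFin_inj; rewrite EFinD !EFin_Pr //; last exact: measurableU.
by rewrite measureU //; apply/eqP; rewrite -disj_set2E.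
Qed.

Lemma Pr_setC A : measurable A -> Pr (~` A) = 1 - Pr A.
Proof.
move=> mA; apply/EFin_inj; rewrite EFin_Pr; last exact: measurableC.
by rewrite EFinB EFin_Pr // probability_setC.
Qed.

Lemma Pr_setD A B : measurable A -> measurable B -> B `<=` A ->
  Pr (A `\` B) = Pr A - Pr B.
Proof.
move=> mA mB BA; have mD : measurable (A `\` B) by exact: measurableD.
rewrite -[in Pr A](setDUK BA) Pr_setU //; last first.
  by rewrite disj_set2E setIC setDKI.
by rewrite addrAC subrr add0r.
Qed.

End Expectation.

Section MeasurableBool.
Context {d : measure_display} {T : measurableType d} {R : realType}.
Implicit Types (f g : T -> R) (b : T -> bool).

Lemma measurable_set_bool b : measurable_fun [set: T] b -> measurable [set w | b w].
Proof.
move=> mb; rewrite (_ : [set w | b w] = [set: T] `&` b @^-1` [set true]).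
  exact: mb.
by rewrite setTI.
Qed.

Lemma measurable_set_ltr f g : measurable_fun [set: T] f ->
  measurable_fun [set: T] g -> measurable [set w | f w < g w].
Proof. by move=> mf mg; exact: measurable_set_bool (measurable_fun_ltr mf mg). Qed.

Lemma measurable_set_ler f g : measurable_fun [set: T] f ->
  measurable_fun [set: T] g -> measurable [set w | f w <= g w].
Proof. by move=> mf mg; exact: measurable_set_bool (measurable_fun_ler mf mg). Qed.

Lemma measurable_set_eqr f g : measurable_fun [set: T] f ->
  measurable_fun [set: T] g -> measurable [set w | f w == g w].
Proof. by move=> mf mg; exact: measurable_set_bool (measurable_fun_eqr mf mg). Qed.

Lemma measurable_set_negb b : measurable [set w | b w] -> measurable [set w | ~~ b w].
Proof.
move=> mb; rewrite (_ : [set w | ~~ b w] = ~` [set w | b w]); first exact: measurableC.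
by apply/seteqP; split => w /= /negP.
Qed.

Lemma measurable_set_andb b b' : measurable [set w | b w] ->
  measurable [set w | b' w] -> measurable [set w | b w && b' w].
Proof.
move=> mb mb'; rewrite (_ : [set w | _] = [set w | b w] `&` [set w | b' w]).
  exact: measurableI.
by apply/seteqP; split => w /= => [/andP|[-> ->]].
Qed.

End MeasurableBool.

Lemma measurable_preimageT {d d'} {T : measurableType d} {T' : measurableType d'}
    (Y : T -> T') (B : set T') : measurable_fun [set: T] Y -> measurable B ->
  measurable [set w | B (Y w)].
Proof. by move=> mY mB; rewrite -[X in measurable X]setTI; exact: mY. Qed.

Lemma cvg_sum {R : realType} {I : Type} {T : Type} (F : set_system T)
    {FF : Filter F} (r : seq I) (f : I -> T -> R) (a : I -> R) :
  (forall i, f i x @[x --> F] --> a i) ->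
  \sum_(i <- r) f i x @[x --> F] --> \sum_(i <- r) a i.
Proof.
move=> fa; elim: r => [|i r IH].
  by rewrite big_nil; under eq_fun => x do rewrite big_nil; exact: cvg_cst.
rewrite big_cons; under eq_fun => x do rewrite big_cons.
exact: cvgD.
Qed.

Lemma measurable_funV {d} {T : measurableType d} {R : realType} (f : T -> R) :
  measurable_fun [set: T] f -> measurable_fun [set: T] (fun x => (f x)^-1).
Proof.
move=> mf; apply: (measurableT_comp _ mf).
rewrite -(setvU [set 0 : R]); apply/measurable_funU => //.
  exact: measurableC.
split; last exact: measurable_fun_set1.
apply: open_continuous_measurable_fun => [|x].
  exact/closed_openC/(accessible_closed_set1 (hausdorff_accessible (@Rhausdorff R))).
by rewrite inE /= => /eqP; exact: inv_continuous.
Qed.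

Lemma measurable_fun_sqrt {d} {T : measurableType d} {R : realType} (f : T -> R) :
  measurable_fun [set: T] f -> measurable_fun [set: T] (fun x => Num.sqrt (f x)).
Proof.
move=> mf; apply: (measurableT_comp _ mf).
exact: continuous_measurable_fun (@sqrt_continuous R).
Qed.

(** * Measurability of the sample correlation *)

Section VecMeasurable.
Context {R : realType} {n : nat}.

Lemma continuous_mulmx (O : 'M[R]_n) : continuous (fun x : 'cV[R]_n => O *m x).
Proof.
have H i (x : 'cV[R]_n) : (fun y : 'cV[R]_n => (O *m y) i 0) @ x --> (O *m x) i 0.
  have -> : (fun y : 'cV[R]_n => (O *m y) i 0) = (fun y => \sum_j O i j * y j 0).
    by apply/funext => y; rewrite mxE.
  rewrite mxE; apply: (cvg_sum (F := nbhs x) (FF := nbhs_filter x)) => j; apply: (cvgMl_tmp (F := nbhs x) (FF := nbhs_filter x)); exact: coord_continuous.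
move=> x A [/= Q xQ QA].
suff : nbhs x [set y : 'cV[R]_n | forall i, Q i 0 ((O *m y) i 0)].
  apply: filterS => y Qy; apply: QA => i j; rewrite ord1; exact: Qy.
apply: (filter_forall (f := fun i (y : 'cV[R]_n) => Q i 0 ((O *m y) i 0))
  (F := nbhs (x : 'cV[R]_n))) => i.
exact: H (xQ i 0).
Qed.

Lemma measurable_mulmx (O : 'M[R]_n) :
  measurable_fun [set: vec R n] (fun x : vec R n => O *m x : vec R n).
Proof.
apply: (@measurability _ _ (vec R n) (vec R n) setT _ (@open 'cV[R]_n)) => // _ [U oU <-]; rewrite setTI.
apply: sub_sigma_algebra.
by apply: open_comp => // x _; exact: continuous_mulmx.
Qed.

Lemma measurable_coord (i : 'I_n) :
  measurable_fun [set: vec R n] (fun x : vec R n => (x : 'cV[R]_n) i 0).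
Proof.
apply: (measurability _ (RGenOInfty.measurableE R)) => _ [_ [r ->] <-].
rewrite setTI; apply: sub_sigma_algebra.
by apply: open_comp => [x _|]; [exact: coord_continuous|exact: interval_open].
Qed.

Context {d : measure_display} {T : measurableType d}.
Implicit Types X Y : T -> vec R n.

Lemma measurable_coordT X (i : 'I_n) : measurable_fun [set: T] X ->
  measurable_fun [set: T] (fun w => (X w : 'cV[R]_n) i 0).
Proof. by move=> mX; apply: (measurableT_comp (measurable_coord i) mX). Qed.

Lemma measurable_mulmxT X (O : 'M[R]_n) : measurable_fun [set: T] X ->
  measurable_fun [set: T] (fun w => O *m X w : vec R n).
Proof. by move=> mX; apply: (measurableT_comp (measurable_mulmx O) mX). Qed.

Lemma measurable_mean X : measurable_fun [set: T] X ->
  measurable_fun [set: T] (fun w => mean (X w)).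
Proof.
move=> mX; apply: measurable_funM; last exact: measurable_cst.
by apply: measurable_sum => i; exact: measurable_coordT.
Qed.

Lemma measurable_dot_centered X Y :
  measurable_fun [set: T] X -> measurable_fun [set: T] Y ->
  measurable_fun [set: T] (fun w => dot (centered (X w)) (centered (Y w))).
Proof.
move=> mX mY; apply: measurable_sum => i.
apply: measurable_funM.
- have -> : (fun w => centered (X w) i 0) =
     (fun w => (X w : 'cV[R]_n) i 0 - mean (X w)).
    by apply/funext => w; rewrite !mxE.
  by apply: measurable_funB; [exact: measurable_coordT|exact: measurable_mean].
- have -> : (fun w => centered (Y w) i 0) =
     (fun w => (Y w : 'cV[R]_n) i 0 - mean (Y w)).
    by apply/funext => w; rewrite !mxE.
  by apply: measurable_funB; [exact: measurable_coordT|exact: measurable_mean].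
Qed.

Lemma measurable_sample_corr X Y :
  measurable_fun [set: T] X -> measurable_fun [set: T] Y ->
  measurable_fun [set: T] (fun w => sample_corr (X w) (Y w)).
Proof.
move=> mX mY; apply: measurable_funM; first exact: measurable_dot_centered.
apply: measurable_funV; apply: measurable_funM;
  by apply: measurable_fun_sqrt; exact: measurable_dot_centered.
Qed.

End VecMeasurable.

(** * Reflections and spherical distributions *)

Section DotReflection.
Context {R : realType} {n : nat}.
Implicit Types (x y v : 'cV[R]_n).

Lemma dotC x y : dot x y = dot y x.
Proof. by apply: eq_bigr => i _; rewrite mulrC. Qed.

Lemma dotDl x y v : dot (x + y) v = dot x v + dot y v.
Proof. by rewrite /dot -big_split; apply: eq_bigr => i _; rewrite mxE mulrDl. Qed.

Lemma dotZl (a : R) x v : dot (a *: x) v = a * dot x v.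
Proof. by rewrite /dot mulr_sumr; apply: eq_bigr => i _; rewrite mxE mulrA. Qed.

Lemma dotNl x v : dot (- x) v = - dot x v.
Proof. by rewrite -scaleN1r dotZl mulN1r. Qed.

Lemma dotDr x y v : dot v (x + y) = dot v x + dot v y.
Proof. by rewrite !(dotC v) dotDl. Qed.

Lemma dotZr (a : R) x v : dot v (a *: x) = a * dot v x.
Proof. by rewrite !(dotC v) dotZl. Qed.

Lemma dotNr x v : dot v (- x) = - dot v x.
Proof. by rewrite !(dotC v) dotNl. Qed.

Lemma dot_ge0 x : 0 <= dot x x.
Proof. by apply: sumr_ge0 => i _; rewrite -expr2 sqr_ge0. Qed.

Lemma dot_eq0 x : dot x x = 0 -> x = 0.
Proof.
move=> /eqP; rewrite psumr_eq0 => [/allP x0|i _]; last by rewrite -expr2 sqr_ge0.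
apply/matrixP => i j; rewrite ord1 mxE.
by have := x0 i (mem_index_enum _); rewrite mulf_eq0 orbb => /eqP.
Qed.

Lemma dot_delta i x : dot (delta_mx i 0) x = x i 0.
Proof.
rewrite /dot (bigD1 i) //= big1 => [|j ji]; rewrite !mxE !eqxx ?mul1r ?addr0 //.
by rewrite (negbTE ji) mul0r.
Qed.

Lemma dot_mulmx (O : 'M[R]_n) x y : dot (O *m x) y = dot x (O^T *m y).
Proof.
rewrite /dot.
under eq_bigr => i _ do rewrite mxE mulr_suml.
rewrite exchange_big /=; apply: eq_bigr => j _.
rewrite mxE mulr_sumr; apply: eq_bigr => i _; rewrite mxE; ring.
Qed.

Lemma dot_orth (O : 'M[R]_n) x y : O^T *m O = 1%:M -> dot (O *m x) (O *m y) = dot x y.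
Proof. by move=> oO; rewrite dot_mulmx mulmxA oO mul1mx. Qed.

Definition reflection v : 'M[R]_n := 1%:M - (2 / dot v v) *: (v *m v^T).

Lemma reflectionE v x : reflection v *m x = x - (2 * dot v x / dot v v) *: v.
Proof.
rewrite mulmxBl mul1mx -scalemxAl -mulmxA; congr (_ - _).
have -> : v^T *m x = (dot v x)%:M.
  apply/matrixP => i j; rewrite !ord1 !mxE eqxx mulr1n.
  by apply: eq_bigr => k _; rewrite mxE.
rewrite mul_mx_scalar scalerA; congr (_ *: _); ring.
Qed.

Lemma reflection_coord v x i :
  (reflection v *m x) i 0 = x i 0 - 2 * dot v x / dot v v * v i 0.
Proof. by rewrite reflectionE mxE; congr (_ + _); rewrite mxE [in LHS]mxE. Qed.

Lemma reflection_tr v : (reflection v)^T = reflection v.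
Proof. by rewrite linearB /= linearZ /= trmx_mul trmxK trmx1. Qed.

Lemma reflection_orth v : dot v v != 0 -> (reflection v)^T *m reflection v = 1%:M.
Proof.
move=> v0; rewrite reflection_tr; apply/matrixP => i j.
have := congr1 (fun M : 'cV[R]_n => M i 0)
  (reflectionE v (reflection v *m delta_mx j 0)).
rewrite mulmxA reflectionE dotDr dotNr dotZr -colE !mxE => ->.
by rewrite eqxx andbT; field.
Qed.

End DotReflection.

Section Spherical.
Context {d : measure_display} {T : measurableType d} {R : realType}.
Context (P : probability T R) {n : nat}.
Variable X : {RV P >-> vec R n}.

Lemma spherical_Pr (O : 'M[R]_n) (B : set (vec R n)) : spherical P X ->
  O^T *m O = 1%:M -> measurable B ->
  P [set w | B (O *m X w)] = P [set w | B (X w)].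
Proof. by move=> sX oO mB; exact: sX oO B mB. Qed.

Lemma spherical_Ex (O : 'M[R]_n) (f : vec R n -> R) : spherical P X ->
  O^T *m O = 1%:M -> bmeas f ->
  Ex P (fun w => f (O *m X w)) = Ex P (fun w => f (X w)).
Proof.
move=> sX oO [mf [M fM]].
have mX : measurable_fun [set: T] X by [].
have mOX := measurable_mulmxT O mX.
have mEf : measurable_fun [set: vec R n] (EFin \o f) by exact/measurable_EFinP.
rewrite /Ex /Rintegral; congr fine.
have I (Y : T -> vec R n) : measurable_fun [set: T] Y ->
    P.-integrable (Y @^-1` [set: vec R n]) ((EFin \o f) \o Y).
  move=> mY; rewrite preimage_setT; apply: (@bmeas_integrable _ _ _ P (f \o Y)).
  by split; [exact: measurableT_comp | exists M => x /=].
rewrite -[LHS](@integral_pushforward _ _ _ _ _ _ mOX P setT _ mEf (I _ mOX) measurableT).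
rewrite -[RHS](@integral_pushforward _ _ _ _ _ _ mX P setT _ mEf (I _ mX) measurableT).
apply: eq_measure_integral => A mA _; exact: sX.
Qed.

Lemma eq0_of_natM_le1 (x : R) : 0 <= x -> (forall N, N%:R * x <= 1) -> x = 0.
Proof.
move=> x0 H; apply/eqP; rewrite eq_le x0 andbT leNgt; apply/negP => xp.
have := H (Num.truncn x^-1).+1.
by rewrite -ler_pdivlMr // mul1r leNgt truncnS_gt.
Qed.

(* The reflections along alpha e_i0 + e_i1 send the line of slope 0 in the
   (i0, i1)-plane to infinitely many distinct lines of equal probability. *)
Lemma spherical_coord_neq0 (i0 i1 : 'I_n) : i1 != i0 -> spherical P X ->
  Pr P [set w | ((X w : 'cV[R]_n) i1 0 == 0) && ((X w : 'cV[R]_n) i0 0 != 0)] = 0.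
Proof.
move=> i10 sX.
(* The reflection along v = al e_i0 + e_i1 sends (x0, 0) to a multiple of (1 - al^2, - 2 al); [F al]
   is the line through that point, and [F 0] the original one. *)
pose F (al : R) (x : vec R n) := ((1 - al ^+ 2) * (x : 'cV[R]_n) i1 0 ==
   - 2 * al * (x : 'cV[R]_n) i0 0) && ((x : 'cV[R]_n) i0 0 != 0).
have mF al : measurable [set x : vec R n | F al x].
  apply: measurable_set_andb.
    apply: measurable_set_eqr; apply: measurable_funM;
      solve [exact: measurable_cst | exact: measurable_coord].
  apply/measurable_set_negb/measurable_set_eqr; last exact: measurable_cst.
  exact: measurable_coord.
have mFX al : measurable [set w | F al (X w)].
  exact: (measurable_preimageT (B := [set x | F al x]) _ (mF al)).
(* Values in ]0, 1[ keep the i0-coordinate of the image nonzero and make the slopes - 2 al / (1 -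
   al^2) distinct. *)
pose al m : R := (m.+2)%:R^-1.
have al01 m : 0 < al m < 1 by rewrite invr_gt0 ltr0n /= invf_lt1 ?ltr0n // ltr1n.
have -> : [set w | ((X w : 'cV[R]_n) i1 0 == 0) && ((X w : 'cV[R]_n) i0 0 != 0)]
    = [set w | F 0 (X w)].
  by apply/seteqP; split => w; rewrite /= /F expr0n subr0 mul1r mulr0 mul0r.
apply: eq0_of_natM_le1; first exact: Pr_ge0.
move=> N.
have le0 m : Pr P [set w | F 0 (X w)] <= Pr P [set w | F (al m) (X w)].
  pose v : 'cV[R]_n := al m *: delta_mx i0 0 + delta_mx i1 0.
  have vE x : dot v x = al m * x i0 0 + x i1 0 by rewrite dotDl dotZl !dot_delta.
  have v0 : v i0 0 = al m by rewrite !mxE !eqxx eq_sym (negbTE i10) mulr1 addr0.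
  have v1 : v i1 0 = 1 by rewrite !mxE !eqxx (negbTE i10) mulr0 add0r.
  have vv : dot v v = al m ^+ 2 + 1 by rewrite vE v0 v1 expr2.
  have vn0 : dot v v != 0 by rewrite vv gt_eqF // ltr_wpDl // sqr_ge0.
  have oO := reflection_orth vn0.
  rewrite [leRHS](_ : _ = Pr P [set w | F (al m) (reflection v *m X w)]); last first.
    by rewrite /Pr (spherical_Pr sX oO (mF (al m))).
  apply: le_Pr => //.
    apply: (measurable_preimageT (B := [set x | F (al m) x]) _ (mF (al m))).
    exact: measurable_mulmxT.
  move=> w; rewrite /= /F !reflection_coord v0 v1 vE vv.
  rewrite expr0n subr0 mul1r mulr0 mul0r => /andP[/eqP -> x0]; apply/andP; split.
    apply/eqP; field; rewrite -vv //.
  have /andP[a0 a1] := al01 m.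
  rewrite addr0.
  have -> : (X w : 'cV[R]_n) i0 0 - 2 * (al m * (X w : 'cV[R]_n) i0 0) / (al m ^+ 2 + 1) * al m
    = (X w : 'cV[R]_n) i0 0 * (1 - al m ^+ 2) / (al m ^+ 2 + 1).
    by field; rewrite -vv.
  rewrite mulf_neq0 ?invr_eq0 -?vv // mulf_neq0 // subr_eq0 eq_sym lt_eqF //.
  by rewrite expr_lt1 // ltW.
(* The events [F (al m)] are disjoint, so their indicators sum to at most 1, while each has at least
   the probability of [F 0]. *)
apply: (@le_trans _ _ (Ex P (fun w => \sum_(m < N) (F (al m) (X w))%:R))).
  rewrite Ex_sum => [|m _]; last exact: bmeas_bool.
  rewrite mulr_natl -[X in _ *+ X]card_ord -sumr_const; apply: ler_sum => m _.
  by rewrite Ex_bool //.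
rewrite -[leRHS](Ex_cst P); apply: le_Ex => [||w].
- by apply: bmeas_sum => m _; exact: bmeas_bool.
- exact: bmeas_cst.
have [[m Fm]|nF] := pselect (exists m : 'I_N, F (al m) (X w)); last first.
  rewrite big1 // => m _; case: (boolP (F _ _)) => // Fm.
  by case: nF; exists m.
rewrite (bigD1 m) //= Fm big1 ?addr0 // => m' m'm.
case: (boolP (F _ _)) => // Fm'; case/negP: m'm.
move: Fm Fm' => /andP[/eqP E1 x0] /andP[/eqP E2 _].
have /andP[a0 a1] := al01 m; have /andP[b0 b1] := al01 m'.
move: (al01 m) (al01 m') => _ _.
have : al m * (1 - al m' ^+ 2) = al m' * (1 - al m ^+ 2).
  apply: (mulIf x0); set y1 := _ i1 0 in E1 E2; set y0 := _ i0 0 in E1 E2 *.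
  have H1 : al m * y0 = - (1 - al m ^+ 2) * y1 / 2 by lra.
  have H2 : al m' * y0 = - (1 - al m' ^+ 2) * y1 / 2 by lra.
  have -> : al m * (1 - al m' ^+ 2) * y0 = (al m * y0) * (1 - al m' ^+ 2) by ring.
  have -> : al m' * (1 - al m ^+ 2) * y0 = (al m' * y0) * (1 - al m ^+ 2) by ring.
  by rewrite H1 H2; ring.
move=> H; have : (al m - al m') * (1 + al m * al m') = 0 by lra.
move=> /eqP; rewrite mulf_eq0 => /orP[|]; last by rewrite gt_eqF // addr_gt0 // mulr_gt0.
rewrite subr_eq0 => /eqP/invr_inj/eqP; rewrite eqr_nat !eqSS => /eqP mm'.
by apply/eqP/val_inj.
Qed.

End Spherical.

(** * The direction of a spherical vector *)

Section Clamp.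
Context {R : realType}.
Implicit Types a b x y : R.

(** For a <= b, the primitive of the indicator of [a, b] that vanishes on the left. It is the test
    function of the integration by parts, where its derivative produces the restriction to a <= A <=
    b. *)
Definition clamp a b x : R := Num.max (Num.min x b) a - a.

Ltac clamp_cases := rewrite /clamp;
  repeat match goal with
  | |- context [Order.min ?x ?y] => case: (leP x y) => ?
  | |- context [Order.max ?x ?y] => case: (leP x y) => ?
  end.

Lemma clamp_low a b x : x <= a -> a <= b -> clamp a b x = 0.
Proof. by move=> xa ab; clamp_cases; lra. Qed.

Lemma clamp_mid a b x : a <= x <= b -> clamp a b x = x - a.
Proof. by move=> xab; clamp_cases; lra. Qed.

Lemma clamp_high a b x : a <= b -> b <= x -> clamp a b x = b - a.
Proof. by move=> ab bx; clamp_cases; lra. Qed.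

Lemma clamp_ge0 a b x : 0 <= clamp a b x.
Proof. by clamp_cases; lra. Qed.

Lemma clamp_le a b x : a <= b -> clamp a b x <= b - a.
Proof. by move=> ab; clamp_cases; lra. Qed.

Lemma clamp_lip a b x y : x <= y -> 0 <= clamp a b y - clamp a b x <= y - x.
Proof. by move=> xy; clamp_cases; lra. Qed.

Lemma clamp_dist a b x y : `|clamp a b y - clamp a b x| <= `|y - x|.
Proof.
wlog xy : x y / x <= y => [H|].
  by case: (leP x y) => [|/ltW] xy; [|rewrite distrC (distrC y)]; exact: H.
by have /andP[h0 h1] := clamp_lip a b xy; rewrite !ger0_norm //; lra.
Qed.

(** On the shrunk interval both points c A + s B and c A - s B remain in [a, b], where [clamp] has
    slope 1; elsewhere monotonicity gives the sign. The left margin is 2 e because the factor c and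
    the term s B can each move a point of [0, 1] down by e; only s B moves it up. *)
Lemma clamp_rotation_lb a b c s e A B : 0 <= s <= e -> 1 - e <= c <= 1 ->
  -1 <= A <= 1 -> -1 <= B <= 1 -> 0 <= a ->
  2 * s * (B ^+ 2 * ((a + 2 * e <= A) && (A <= b - e))%:R) <=
  B * (clamp a b (c * A + s * B) - clamp a b (c * A - s * B)).
Proof.
move=> /andP[s0 se] /andP[ce c1] A1 B1 a0.
case: (boolP (_ && _)) => [/andP[aA Ab]|_]; last first.
  rewrite !mulr0; case: (leP 0 B) => [|/ltW] B0.
    rewrite mulr_ge0 //.
    have : c * A - s * B <= c * A + s * B by nra.
    by move=> /(clamp_lip a b); lra.
  rewrite mulr_le0 //.
  have : c * A + s * B <= c * A - s * B by nra.
  by move=> /(clamp_lip a b); lra.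
rewrite mulr1 !clamp_mid; [nra| |]; nra.
Qed.

(** Outside the enlarged interval both rotated points lie on the same flat part of [clamp]; inside
    it the Lipschitz constant 1 is used. *)
Lemma clamp_rotation_ub a b c s e A B : 0 <= s <= e -> 1 - e <= c <= 1 -> 0 <= c ->
  -1 <= A <= 1 -> -1 <= B <= 1 -> e <= a -> a <= b ->
  B * (clamp a b (c * A + s * B) - clamp a b (c * A - s * B)) <=
  2 * s * (B ^+ 2 * ((a - e <= A) && (A <= b + 2 * e))%:R).
Proof.
move=> /andP[s0 se] /andP[ce c1] c0 A1 B1 ea ab.
case: (boolP (_ && _)) => [_|/nandP[]]; rewrite ?mulr1 ?mulr0 -?ltNge; [|move=> h..].
- case: (leP 0 B) => [|/ltW] B0.
    have : c * A - s * B <= c * A + s * B by nra.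
    move=> /(clamp_lip a b)/andP[_ h]; nra.
  have : c * A + s * B <= c * A - s * B by nra.
  move=> /(clamp_lip a b)/andP[_ h]; nra.
- rewrite !clamp_low ?subrr ?mulr0 //.
    by case: (leP 0 A) => A0; nra.
  by case: (leP 0 A) => A0; nra.
- rewrite !clamp_high ?subrr ?mulr0 //; nra.
Qed.

Lemma clamp_rotation_err a b c s e A B : 0 <= s <= e -> 1 - e <= c <= 1 ->
  -1 <= A <= 1 -> -1 <= B <= 1 ->
  `|A * (clamp a b (c * A + s * B) + clamp a b (c * A - s * B))
    - 2 * (A * clamp a b A)| <= 4 * e.
Proof.
move=> /andP[s0 se] /andP[ce c1] A1 B1.
have -> : A * (clamp a b (c * A + s * B) + clamp a b (c * A - s * B))
    - 2 * (A * clamp a b A) =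
  A * ((clamp a b (c * A + s * B) - clamp a b A) +
       (clamp a b (c * A - s * B) - clamp a b A)) by ring.
have nA : `|A| <= 1 by rewrite ler_norml; lra.
rewrite normrM.
have H : `|clamp a b (c * A + s * B) - clamp a b A| <= 2 * e.
  by apply: le_trans (clamp_dist _ _ _ _) _; rewrite ler_norml; apply/andP; split; nra.
have K : `|clamp a b (c * A - s * B) - clamp a b A| <= 2 * e.
  by apply: le_trans (clamp_dist _ _ _ _) _; rewrite ler_norml; apply/andP; split; nra.
have := ler_normD (clamp a b (c * A + s * B) - clamp a b A)
                  (clamp a b (c * A - s * B) - clamp a b A).
have := normr_ge0 (clamp a b (c * A + s * B) - clamp a b A +
         (clamp a b (c * A - s * B) - clamp a b A)).
by have := normr_ge0 A; nra.
Qed.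

Lemma bmeas_clamp {d} {S : measurableType d} a b (f : S -> R) :
  bmeas f -> bmeas (fun w => clamp a b (f w)).
Proof.
move=> [mf _]; split.
  apply: measurable_funB; last exact: measurable_cst.
  apply: measurable_maxr; last exact: measurable_cst.
  by apply: measurable_minr => //; exact: measurable_cst.
exists `|b - a| => w; rewrite ger0_norm ?clamp_ge0 //.
have [ab|/ltW ba] := leP a b.
  by apply: le_trans (clamp_le _ ab) (ler_norm _).
have -> : clamp a b (f w) = 0 by clamp_cases; lra.
exact: normr_ge0.
Qed.

End Clamp.

Lemma card_neq2 n (i j : 'I_n) : j != i -> #|[pred k | (k != i) && (k != j)]| = n.-2.
Proof.
move=> ji; rewrite -[n in RHS]card_ord -(cardC1 i) (cardD1 j (predC1 i)) inE /= ji add1n /=.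
by apply: eq_card => k; rewrite !inE andbC.
Qed.

(** * Coordinates of the direction after one axis is removed *)

Section Direction.
Context {R : realType} {n : nat}.
Variable i0 : 'I_n.
Implicit Types x : 'cV[R]_n.

(** The coordinate [i0] is set apart: after a change of basis it carries the direction of the
    all-ones vector, and dropping it is centring. [dir] is 0 where [rad2] vanishes. *)
Definition rad2 x : R := \sum_(i | i != i0) x i 0 ^+ 2.
Definition dir k x : R := x k 0 / Num.sqrt (rad2 x).

Lemma rad2_ge0 x : 0 <= rad2 x.
Proof. by apply: sumr_ge0 => i _; exact: sqr_ge0. Qed.

Lemma rad2E x : rad2 x = dot x x - x i0 0 ^+ 2.
Proof.
rewrite /dot (bigD1 i0) //= -expr2 addrAC subrr add0r.
by apply: eq_bigr => i _; rewrite expr2.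
Qed.

Lemma sqr_coord_le_rad2 k x : k != i0 -> x k 0 ^+ 2 <= rad2 x.
Proof.
move=> k0; rewrite /rad2 (bigD1 k) //= lerDl.
by apply: sumr_ge0 => i _; exact: sqr_ge0.
Qed.

Lemma dir_le1 k x : k != i0 -> -1 <= dir k x <= 1.
Proof.
move=> k0; rewrite -ler_norml /dir normrM normfV (ger0_norm (sqrtr_ge0 _)).
have [->|r0] := eqVneq (Num.sqrt (rad2 x)) 0; first by rewrite invr0 mulr0 ler01.
rewrite ler_pdivrMr ?mul1r; last by rewrite lt_def r0 sqrtr_ge0.
by rewrite -sqrtr_sqr ler_sqrt ?rad2_ge0 // sqr_coord_le_rad2.
Qed.

Lemma sum_sqr_dir x : rad2 x != 0 -> \sum_(k | k != i0) dir k x ^+ 2 = 1.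
Proof.
move=> r0; under eq_bigr => k _ do rewrite /dir exprMn exprVn sqr_sqrtr ?rad2_ge0 //.
by rewrite -mulr_suml divff.
Qed.

Lemma bmeas_dir k : k != i0 -> bmeas (fun x : vec R n => dir k x).
Proof.
move=> k0; split; last by exists 1 => x; rewrite ler_norml dir_le1.
apply: measurable_funM; first exact: measurable_coord.
apply/measurable_funV/measurable_fun_sqrt.
rewrite /rad2; under eq_fun => x do rewrite big_mkcond.
apply: measurable_sum => i; case: (i != i0); last exact: measurable_cst.
exact: measurable_funX (measurable_coord i).
Qed.

(** [al] is the tangent of the half-angle, so c and s are a cosine and a sine given by rational
    functions. The reflection is the rotation followed by a change of sign of the k-th coordinate;
    it fixes the coordinate [i0], hence [rad2]. *)
Lemma dir_reflection (al : R) i k x : i != i0 -> k != i0 -> k != i ->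
  let c := (1 - al ^+ 2) / (1 + al ^+ 2) in
  let s := 2 * al / (1 + al ^+ 2) in
  let O := reflection (al *: delta_mx i 0 + delta_mx k 0) in
  [/\ O^T *m O = 1%:M,
      dir i (O *m x) = c * dir i x - s * dir k x &
      dir k (O *m x) = - c * dir k x - s * dir i x].
Proof.
move=> i1 k1 ki c s; set v := _ + _ => O.
have vE y : dot v y = al * y i 0 + y k 0 by rewrite dotDl dotZl !dot_delta.
have vi : v i 0 = al by rewrite !mxE !eqxx eq_sym (negbTE ki) mulr1 addr0.
have vk : v k 0 = 1 by rewrite !mxE !eqxx (negbTE ki) mulr0 add0r.
have v0 : v i0 0 = 0.
  by rewrite !mxE !eqxx eq_sym (negbTE i1) eq_sym (negbTE k1) mulr0 addr0.
have vv : dot v v = 1 + al ^+ 2 by rewrite vE vi vk expr2 addrC.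
have vn0 : 1 + al ^+ 2 != 0 by rewrite gt_eqF // ltr_wpDr // sqr_ge0.
have oO : O^T *m O = 1%:M by apply: reflection_orth; rewrite vv.
have rO : rad2 (O *m x) = rad2 x.
  by rewrite !rad2E dot_orth // reflection_coord v0 mulr0 subr0.
split => //; rewrite /dir rO /O !reflection_coord ?vi ?vk vv vE /c /s.
  by set r := (Num.sqrt _)^-1; field.
by set r := (Num.sqrt _)^-1; field.
Qed.

End Direction.

Section SphericalDirection.
Context {d : measure_display} {T : measurableType d} {R : realType}.
Context (P : probability T R) {n : nat}.
Variables (X : {RV P >-> vec R n}) (i0 : 'I_n).
Hypothesis sX : spherical P X.
Local Notation dir := (dir i0).

Lemma bmeas_comp (f : vec R n -> R) : bmeas f -> bmeas (fun w => f (X w)).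
Proof. by move=> [mf [M fM]]; split; [exact: measurableT_comp|exists M => w]. Qed.

Lemma dir_rotation_Ex (F : R -> R -> R) (al : R) i k :
  i != i0 -> k != i0 -> k != i ->
  bmeas (fun x : vec R n => F (dir i x) (dir k x)) ->
  let c := (1 - al ^+ 2) / (1 + al ^+ 2) in
  let s := 2 * al / (1 + al ^+ 2) in
  Ex P (fun w => F (c * dir i (X w) - s * dir k (X w))
                   (- c * dir k (X w) - s * dir i (X w))) =
  Ex P (fun w => F (dir i (X w)) (dir k (X w))).
Proof.
move=> i1 k1 ki bF c s; have [oO _ _] := dir_reflection al 0 i1 k1 ki.
rewrite -(spherical_Ex sX oO bF); congr Ex; apply/funext => w.
by have [_ -> ->] := dir_reflection al (X w) i1 k1 ki.
Qed.

Lemma bmeas_dirT k : k != i0 -> bmeas (fun w => dir k (X w)).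
Proof. by move=> k0; apply: (bmeas_comp (bmeas_dir k0)). Qed.

Lemma Ex_sqr_dir_eq i k : i != i0 -> k != i0 ->
  Ex P (fun w => dir k (X w) ^+ 2) = Ex P (fun w => dir i (X w) ^+ 2).
Proof.
move=> i1 k1; have [->//|ki] := eqVneq k i.
(* [al] = 1 gives c = 0 and s = 1: the two coordinates are exchanged up to sign. *)
rewrite -(dir_rotation_Ex (F := fun a b => a ^+ 2) 1 i1 k1 ki); last first.
  exact/bmeasX/bmeas_dir.
congr Ex; apply/funext => w; by field.
Qed.

(** Invariance under a rotation gives e4 = (c^4 + s^4) e4 + 6 c^2 s^2 e22, the odd terms cancelling
    between opposite angles. As 1 - c^4 - s^4 = 2 c^2 s^2, the factor is 3. *)
Lemma Ex_dir4 i k : i != i0 -> k != i0 -> k != i ->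
  Ex P (fun w => dir i (X w) ^+ 4) =
  3 * Ex P (fun w => dir i (X w) ^+ 2 * dir k (X w) ^+ 2).
Proof.
move=> i1 k1 ki.
have bi := bmeas_dirT i1; have bk := bmeas_dirT k1.
have E4k : Ex P (fun w => dir k (X w) ^+ 4) = Ex P (fun w => dir i (X w) ^+ 4).
  rewrite -(dir_rotation_Ex (F := fun a b => a ^+ 4) 1 i1 k1 ki); last first.
    exact/bmeasX/bmeas_dir.
  by congr Ex; apply/funext => w; field.
have b22 : bmeas (fun w => dir i (X w) ^+ 2 * dir k (X w) ^+ 2).
  by apply: bmeasM; exact: bmeasX.
have rot (al : R) := dir_rotation_Ex (F := fun a b => a ^+ 4) al i1 k1 ki (bmeasX 4 (bmeas_dir i1)).
have bi4 := bmeasX 4 bi; have bk4 := bmeasX 4 bk.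
pose e4 := Ex P (fun w => dir i (X w) ^+ 4).
pose e22 := Ex P (fun w => dir i (X w) ^+ 2 * dir k (X w) ^+ 2).
(* The half-angle tangent 1/2 gives the 3-4-5 rotation. *)
set c := (1 - 2^-1 ^+ 2) / (1 + 2^-1 ^+ 2) : R.
set s := 2 * 2^-1 / (1 + 2^-1 ^+ 2) : R.
have cE : c = 3 / 5 by rewrite /c; field.
have sE : s = 4 / 5 by rewrite /s; field.
have : e4 + e4 = (2 * c ^+ 4) * e4 + ((2 * s ^+ 4) * e4 + (12 * (c ^+ 2 * s ^+ 2)) * e22).
  rewrite -[X in X + _](rot 2^-1) -[X in _ + X](rot (- 2^-1)) /= sqrrN mulrN mulNr -/c -/s.
  have bc r : bmeas (fun w => (c * dir i (X w) - r * dir k (X w)) ^+ 4).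
    by apply/bmeasX/bmeasB; apply: bmeasM => //; exact: bmeas_cst.
  rewrite -ExD //.
  have bZ (r : R) f : bmeas f -> bmeas (fun w : T => r * f w).
    by move=> bf; apply: bmeasM => //; exact: bmeas_cst.
  transitivity (Ex P (fun w => (2 * c ^+ 4) * dir i (X w) ^+ 4 +
     ((2 * s ^+ 4) * dir k (X w) ^+ 4 +
      (12 * (c ^+ 2 * s ^+ 2)) * (dir i (X w) ^+ 2 * dir k (X w) ^+ 2)))).
    by congr Ex; apply/funext => w; ring.
  rewrite ExD; [|exact: bZ|by apply: bmeasD; apply: bZ].
  by rewrite ExD; [|exact: bZ..]; rewrite !ExZ // E4k.
rewrite -/e4 -/e22 cE sE; lra.
Qed.

Hypothesis rX : Pr P [set w | rad2 i0 (X w) == 0] = 0.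

Lemma Ex_sum_dir (I : pred 'I_n) (f : 'I_n -> T -> R) (g : T -> R) :
  (forall k, I k -> bmeas (f k)) -> bmeas g ->
  (forall w, rad2 i0 (X w) != 0 -> \sum_(k | I k) f k w = g w) ->
  \sum_(k | I k) Ex P (f k) = Ex P g.
Proof.
move=> bf bg fg; rewrite -Ex_sum //.
have mA : measurable [set w | rad2 i0 (X w) == 0].
  apply: measurable_set_eqr; last exact: measurable_cst.
  rewrite /rad2; under eq_fun => x do rewrite big_mkcond.
  apply: measurable_sum => i; case: (i != i0); last exact: measurable_cst.
  exact/measurable_funX/measurable_coordT.
apply: (ae_eq_Ex _ bg mA); first exact: bmeas_sum.
  by rewrite -EFin_Pr // rX.
by move=> w /= /negP; exact: fg.
Qed.

Lemma Ex_sqr_dir i : i != i0 -> (1 < n)%N ->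
  Ex P (fun w => dir i (X w) ^+ 2) = (n.-1)%:R^-1.
Proof.
move=> i1 n1.
have : \sum_(k | k != i0) Ex P (fun w => dir k (X w) ^+ 2) = 1.
  rewrite (Ex_sum_dir (g := fun=> 1)) ?Ex_cst //; last 2 first.
  - exact: bmeas_cst.
  - by move=> w r0; exact: sum_sqr_dir.
  by move=> k k0; exact/bmeasX/bmeas_dirT.
under eq_bigr => k k0 do rewrite (Ex_sqr_dir_eq i1 k0).
rewrite sumr_const cardC1 card_ord -[_ *+ _]mulr_natr => H.
have n0 : n.-1%:R != 0 :> R by rewrite pnatr_eq0; case: n n1 => [|[]].
by apply: (mulIf n0); rewrite mulVf.
Qed.

(** Multiply the sum of the squared coordinates, which is 1, by the square of the i-th one and apply
    [Ex_dir4]. The fourth moment serves to bound E|A| from below. *)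
Lemma Ex_dir4E i : i != i0 -> (2 < n)%N ->
  Ex P (fun w => dir i (X w) ^+ 4) = 3 / (n.-1%:R * n.+1%:R).
Proof.
move=> i1 n2.
have n1 : n.-1%:R != 0 :> R by rewrite pnatr_eq0; case: n n2 => [|[]].
have n1' : n.+1%:R != 0 :> R by rewrite pnatr_eq0.
have bi := bmeas_dirT i1.
have b22 k : k != i0 -> bmeas (fun w => dir i (X w) ^+ 2 * dir k (X w) ^+ 2).
  by move=> k0; apply: bmeasM; apply: bmeasX => //; exact: bmeas_dirT.
have : \sum_(k | k != i0) Ex P (fun w => dir i (X w) ^+ 2 * dir k (X w) ^+ 2) = n.-1%:R^-1.
  rewrite -(Ex_sqr_dir i1) ?(ltnW n2) //.
  apply: Ex_sum_dir => //; first exact: bmeasX.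
  by move=> w r0; rewrite -mulr_sumr sum_sqr_dir ?mulr1.
rewrite (bigD1 i) //= (_ : (fun w => _ * _) = (fun w => dir i (X w) ^+ 4)); last first.
  by apply/funext => w; ring.
set e4 := Ex _ _.
have e22 k : (k != i0) && (k != i) ->
    Ex P (fun w => dir i (X w) ^+ 2 * dir k (X w) ^+ 2) = e4 / 3.
  by move=> /andP[k0 ki]; rewrite /e4 (Ex_dir4 i1 k0 ki); field.
rewrite (eq_bigr _ e22) sumr_const.
rewrite (card_neq2 i1).
rewrite -[_ *+ _]mulr_natr => H; apply: (mulIf n1'); rewrite invfM mulrA divfK //.
have -> : e4 * n.+1%:R = 3 * (e4 + e4 / 3 * n.-2%:R).
  case: n n2 {H n1 n1' e22} => [|[|[|m]]] // _; rewrite /=.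
  by rewrite -(addn3 m.+1) -addn1 !natrD; field.
by rewrite H.
Qed.

End SphericalDirection.

(** * Integration by parts for a coordinate of the direction *)

Section ClampStein.
Context {d : measure_display} {T : measurableType d} {R : realType}.
Context (P : probability T R) {n : nat}.
Variables (X : {RV P >-> vec R n}) (i0 i : 'I_n).
Hypotheses (sX : spherical P X) (i1 : i != i0).
Hypothesis rX : Pr P [set w | rad2 i0 (X w) == 0] = 0.
Local Notation dir := (dir i0).
Local Notation A := (fun w => dir i (X w)).

Let bA : bmeas A. Proof. exact: bmeas_dirT. Qed.
Let bB k (k0 : k != i0) : bmeas (fun w => dir k (X w)). Proof. exact: bmeas_dirT. Qed.

Let bZ (r : R) f : bmeas f -> bmeas (fun w : T => r * f w).
Proof. by move=> bf; apply: bmeasM => //; exact: bmeas_cst. Qed.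

Lemma bmeas_itv (a b : R) : bmeas (fun w => ((a <= A w) && (A w <= b))%:R : R).
Proof.
apply/bmeas_bool/measurable_set_andb; apply: measurable_set_ler;
  solve [exact: measurable_cst | exact: bA.1].
Qed.

Let bBitv k (k0 : k != i0) a b :
  bmeas (fun w => dir k (X w) ^+ 2 * ((a <= A w) && (A w <= b))%:R).
Proof. by apply: bmeasM; [exact/bmeasX/bB|exact: bmeas_itv]. Qed.

Let bAclamp a b : bmeas (fun w => A w * clamp a b (A w)).
Proof. by apply: bmeasM => //; exact: bmeas_clamp. Qed.

(* Rotations by opposite small angles in the (i, k)-plane: a discrete form of
   E[A_k^2; a <= A <= b] = E[A clamp a b A]. *)
Lemma clamp_stein_pair (k : 'I_n) (a b al : R) : k != i0 -> k != i ->
  0 < al -> 2 * al <= 1 -> 0 <= a -> a <= b ->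
  (1 - 2 * al) * Ex P (fun w => dir k (X w) ^+ 2 *
      ((a + 2 * (2 * al) <= A w) && (A w <= b - 2 * al))%:R) <=
    Ex P (fun w => A w * clamp a b (A w)) + 2 * (2 * al) /\
  (2 * al <= a -> Ex P (fun w => A w * clamp a b (A w)) - 2 * (2 * al) <=
    Ex P (fun w => dir k (X w) ^+ 2 *
      ((a - 2 * al <= A w) && (A w <= b + 2 * (2 * al)))%:R)).
Proof.
move=> k0 ki al0 al1 a0 ab; set e := 2 * al.
pose c : R := (1 - al ^+ 2) / (1 + al ^+ 2); pose s : R := 2 * al / (1 + al ^+ 2).
have al2 : 0 < 1 + al ^+ 2 by rewrite ltr_wpDr // sqr_ge0.
have s0 : 0 < s by rewrite divr_gt0 // mulr_gt0.
(* [e] = 2 al bounds both s and 1 - c; it is the only trace of the angle kept in the estimates. *)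
have se : 0 <= s <= e.
  by rewrite ltW //= ler_pdivrMr // /e; nra.
have c1 : 1 - e <= c <= 1.
  by rewrite ler_pdivlMr // ler_pdivrMr // /e; apply/andP; split; nra.
have c0 : 0 <= c by rewrite divr_ge0 // ?ltW //; nra.
have A1 w : -1 <= A w <= 1 by exact: dir_le1.
have B1 w : -1 <= dir k (X w) <= 1 by exact: dir_le1.
pose F x y : R := y * clamp a b x.
have bF : bmeas (fun x : vec R n => F (dir i x) (dir k x)).
  by apply: bmeasM; [exact: bmeas_dir|apply/bmeas_clamp/bmeas_dir].
pose g1 w := clamp a b (c * A w + s * dir k (X w)).
pose g2 w := clamp a b (c * A w - s * dir k (X w)).
have bg1 : bmeas g1 by apply/bmeas_clamp/bmeasD; apply: bZ => //; exact: bB.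
have bg2 : bmeas g2 by apply/bmeas_clamp/bmeasB; apply: bZ => //; exact: bB.
have bBg : bmeas (fun w => dir k (X w) * (g1 w - g2 w)).
  by apply: bmeasM; [exact: bB|exact: bmeasB].
have bAg : bmeas (fun w => A w * (g1 w + g2 w)).
  by apply: bmeasM => //; exact: bmeasD.
(* Both rotations, by [al] and by [- al], preserve E[B clamp(A)]. Equating the two values and
   separating the terms in c from those in s gives this exact identity; division by 2 s is the
   discrete derivative. *)
have key : c * Ex P (fun w => dir k (X w) * (g1 w - g2 w)) =
    s * Ex P (fun w => A w * (g1 w + g2 w)).
  have := dir_rotation_Ex sX al i1 k0 ki bF.
  rewrite -(dir_rotation_Ex sX (- al) i1 k0 ki bF) sqrrN mulrN mulNr /= -/c -/s /F => E.
  apply/eqP; rewrite -subr_eq0 -!ExZ // -ExB; [|exact: bZ..].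
  move/eqP: E; rewrite -subr_eq0 -ExB; last 2 first.
  - apply: bmeasM; last by apply/bmeas_clamp/bmeasB; apply: bZ => //; exact: bB.
    by apply: bmeasB; apply: bZ => //; exact: bB.
  - apply: bmeasM; last by apply/bmeas_clamp/bmeasB; apply: bZ => //; exact: bB.
    by apply: bmeasB; apply: bZ => //; exact: bB.
  move=> /eqP E; apply/eqP; rewrite -[RHS]E; congr Ex; apply/funext => w.
  by rewrite /g1 /g2 !mulNr !opprK; ring.
have err : `|Ex P (fun w => A w * (g1 w + g2 w)) -
    2 * Ex P (fun w => A w * clamp a b (A w))| <= 4 * e.
  rewrite -ExZ // -ExB //; last exact: bZ.
  have bD : bmeas (fun w => A w * (g1 w + g2 w) - 2 * (A w * clamp a b (A w))).
    by apply: bmeasB => //; exact: bZ.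
  rewrite ler_norml -(Ex_cst P (4 * e)) -(ExN _ (bmeas_cst _)); apply/andP; split;
    (apply: le_Ex => //; [exact: bmeas_cst|]) => w;
    by have := clamp_rotation_err a b se c1 (A1 w) (B1 w); rewrite ler_norml => /andP[].
split=> [|ea].
- have : 2 * s * Ex P (fun w => dir k (X w) ^+ 2 * ((a + 2 * e <= A w) && (A w <= b - e))%:R)
      <= Ex P (fun w => dir k (X w) * (g1 w - g2 w)).
    rewrite -ExZ; last exact: bBitv.
    apply: le_Ex => // [|w]; first exact/bZ/bBitv.
    exact: clamp_rotation_lb.
  have : 0 <= Ex P (fun w => dir k (X w) ^+ 2 * ((a + 2 * e <= A w) && (A w <= b - e))%:R).
    by apply: Ex_ge0 => w; rewrite mulr_ge0 ?sqr_ge0.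
  move: err key; rewrite ler_norml.
  set e1 := Ex _ _; set e2 := Ex _ _; set e3 := Ex _ _; set e4 := Ex _ _.
  move=> /andP[_ h1] h2 h3 h4; move: c1 => /andP[c1 _].
  have h5 : c * (2 * s * e4) <= s * (2 * e2 + 4 * e).
    by apply: (@le_trans _ _ (c * e3)); [exact: ler_wpM2l|rewrite h2 ler_pM2l //; lra].
  have h6 : c * e4 <= e2 + 2 * e.
    by rewrite -(ler_pM2l (mulr_gt0 (ltr0n _ 2) s0)); lra.
  by apply: le_trans h6; exact: ler_wpM2r.
- have : Ex P (fun w => dir k (X w) * (g1 w - g2 w)) <=
     2 * s * Ex P (fun w => dir k (X w) ^+ 2 * ((a - e <= A w) && (A w <= b + 2 * e))%:R).
    rewrite -ExZ; last exact: bBitv.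
    apply: le_Ex => // [|w]; first exact/bZ/bBitv.
    exact: clamp_rotation_ub.
  have : 0 <= Ex P (fun w => dir k (X w) ^+ 2 * ((a - e <= A w) && (A w <= b + 2 * e))%:R).
    by apply: Ex_ge0 => w; rewrite mulr_ge0 ?sqr_ge0.
  move: err key; rewrite ler_norml.
  set e1 := Ex _ _; set e2 := Ex _ _; set e3 := Ex _ _; set e4 := Ex _ _.
  move=> /andP[h1 _] h2 h3 h4; move: c1 => /andP[_ c1].
  have h5 : s * (2 * e2 - 4 * e) <= c * (2 * s * e4).
    by apply: (@le_trans _ _ (c * e3)); [rewrite h2 ler_pM2l //; lra|exact: ler_wpM2l].
  have h6 : e2 - 2 * e <= c * e4.
    by rewrite -(ler_pM2l (mulr_gt0 (ltr0n _ 2) s0)); lra.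
  by apply: le_trans h6 _; rewrite ler_piMl.
Qed.

Definition tail_mean (a : R) : R := Ex P (fun w => A w * (a < A w)%R%:R).
(** Almost surely 1 - A^2 is the sum of the squares of the coordinates other than [i0] and [i], so
    this is what the formulas for the n - 2 planes (i, k) add up to. *)
Definition itv_mean (a b : R) : R :=
  Ex P (fun w => (1 - A w ^+ 2) * ((a <= A w) && (A w <= b))%:R).

Let A1 w : -1 <= A w <= 1. Proof. exact: dir_le1. Qed.

Let b1A a b : bmeas (fun w => (1 - A w ^+ 2) * ((a <= A w) && (A w <= b))%:R).
Proof.
by apply: bmeasM; [apply: bmeasB; [exact: bmeas_cst|exact: bmeasX]|exact: bmeas_itv].
Qed.

Let sum_itv a b : \sum_(k | (k != i0) && (k != i)) Ex P (fun w => dir k (X w) ^+ 2 *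
      ((a <= A w) && (A w <= b))%:R) = itv_mean a b.
Proof.
apply: (Ex_sum_dir rX) => // [k /andP[k0 _]|w r0]; first exact: bBitv.
rewrite -mulr_suml; congr (_ * _).
by rewrite -(sum_sqr_dir r0) [in RHS](bigD1 i) //= addrAC subrr add0r.
Qed.

Let sum_cst (x : R) : \sum_(k | (k != i0) && (k != i)) x = (n.-2)%:R * x.
Proof.
rewrite sumr_const mulr_natl; congr (_ *+ _).
by rewrite -(card_neq2 i1); apply: eq_card.
Qed.

Let bAlt a : bmeas (fun w => A w * (a < A w)%R%:R).
Proof.
by apply/bmeasM/bmeas_bool/measurable_set_ltr; [|exact: measurable_cst|exact: bA.1].
Qed.

(** [clamp a b] vanishes up to a, never exceeds b - a, and equals b - a beyond b. Hence
    E[A clamp(A)] lies between (b - a) H(b) and (b - a) H(a), the source of this bound and of the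
    next one. *)
Lemma itv_mean_ub (a b e : R) : 0 < e <= 1 -> 0 <= a -> a <= b ->
  (1 - e) * itv_mean (a + 2 * e) (b - e) <=
    (n.-2)%:R * ((b - a) * tail_mean a + 2 * e).
Proof.
move=> /andP[e0 e1] a0 ab.
have -> : e = 2 * (e / 2) by field.
rewrite -sum_itv -sum_cst mulr_sumr; apply: ler_sum => k /andP[k0 ki].
have /(_ _ _ _ _)[||//|//|h _] := @clamp_stein_pair k a b (e / 2) k0 ki.
- by rewrite divr_gt0.
- by rewrite mulrC divfK.
apply: le_trans h _; rewrite lerD2r -ExZ //; apply: le_Ex => // [|w]; first exact: bZ.
case: (leP (A w) a) => aA /=; first by rewrite clamp_low // !mulr0.
rewrite mulr1 [leRHS]mulrC ler_pM2l ?(le_lt_trans a0) //; exact: clamp_le.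
Qed.

Lemma itv_mean_lb (a b e : R) : 0 < e <= 1 -> e <= a -> a <= b ->
  (n.-2)%:R * ((b - a) * tail_mean b - 2 * e) <= itv_mean (a - e) (b + 2 * e).
Proof.
move=> /andP[e0 e1] ea ab.
have -> : e = 2 * (e / 2) by field.
have a0 : 0 <= a by rewrite (le_trans _ ea) // ltW.
rewrite -sum_itv -sum_cst; apply: ler_sum => k /andP[k0 ki].
have /(_ _ _ _ _)[||//|//|_] := @clamp_stein_pair k a b (e / 2) k0 ki.
- by rewrite divr_gt0.
- by rewrite mulrC divfK.
rewrite {1}(mulrC 2) divfK // => /(_ ea); apply: le_trans.
rewrite lerD2r -ExZ //; apply: le_Ex => // [|w]; first exact: bZ.
case: (ltP b (A w)) => bw /=; rewrite ?mulr0 ?mulr1.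
  by rewrite clamp_high ?(ltW bw) // mulrC.
case: (leP 0 (A w)) => A0; first by rewrite mulr_ge0 // clamp_ge0.
by rewrite clamp_low ?mulr0 // (le_trans (ltW A0)).
Qed.

Lemma tail_mean_ge0 a : 0 <= a -> 0 <= tail_mean a.
Proof.
move=> a0; apply: Ex_ge0 => w; case: ltP => aA; rewrite ?mulr0 // mulr1.
by rewrite (le_trans a0) // ltW.
Qed.

Lemma tail_mean_le1 a : tail_mean a <= 1.
Proof.
rewrite -(Ex_cst P 1); apply: le_Ex => //; first exact: bmeas_cst.
by move=> w; have /andP[_] := A1 w; case: ltP => _; rewrite ?mulr1 ?mulr0 ?ler01.
Qed.

Lemma tail_mean_sub (a b : R) : a <= b ->
  tail_mean a - tail_mean b = Ex P (fun w => A w * ((a < A w) && (A w <= b))%:R).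
Proof.
move=> ab; rewrite -ExB //; congr Ex; apply/funext => w.
case: (ltP a (A w)) => aA; case: (ltP b (A w)) => bw //=; rewrite ?mulr0 ?mulr1 ?subrr ?subr0 //.
by move: (le_lt_trans ab bw); rewrite ltNge aA.
Qed.

Let bAab a b : bmeas (fun w => A w * ((a < A w) && (A w <= b))%:R).
Proof.
apply/bmeasM/bmeas_bool/measurable_set_andb => //.
  by apply/measurable_set_ltr; [exact: measurable_cst|exact: bA.1].
by apply/measurable_set_ler; [exact: bA.1|exact: measurable_cst].
Qed.

(** As x / (1 - x^2) increases on [0, 1[, A is at most b / (1 - b^2) times 1 - A^2 on ]a, b]. This
    turns [itv_mean] back into an increment of H and closes the equation. *)
Lemma tail_mean_sub_ub (a b : R) : 0 <= a -> a <= b -> b < 1 ->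
  tail_mean a - tail_mean b <= b / (1 - b ^+ 2) * itv_mean a b.
Proof.
move=> a0 ab b1; rewrite tail_mean_sub // -ExZ //.
have b2 : 0 < 1 - b ^+ 2 by nra.
apply: le_Ex => // [|w]; first exact: bZ.
case: (leP (A w) b) => Ab; rewrite ?andbF ?mulr0 // !andbT.
case: (ltP a (A w)) => aA; last first.
  have A2 : 0 <= 1 - A w ^+ 2 by have /andP[h1 h2] := A1 w; nra.
  by rewrite mulr0 mulr_ge0 ?divr_ge0 ?mulr_ge0 // ?(le_trans a0 ab) // ltW.
rewrite (ltW aA) !mulr1 mulrAC ler_pdivlMr //.
have A0 : 0 <= A w by rewrite (le_trans a0) // ltW.
have : 0 <= (b - A w) * (1 + A w * b) by rewrite mulr_ge0 ?subr_ge0 // addr_ge0 // mulr_ge0 // (le_trans A0).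
lra.
Qed.

(** The point a' > a reconciles the closed interval of [itv_mean] with the interval ]a, b] of the
    increment; it is later sent to a. *)
Lemma tail_mean_sub_lb (a a' b : R) : 0 <= a -> a < a' -> b < 1 -> a' <= b ->
  a / (1 - a ^+ 2) * itv_mean a' b <= tail_mean a - tail_mean b.
Proof.
move=> a0 aa' b1 ab; rewrite tail_mean_sub ?(le_trans (ltW aa')) // -ExZ //.
have a2 : 0 < 1 - a ^+ 2 by have := lt_le_trans aa' ab; nra.
apply: le_Ex => // [|w]; first exact: bZ.
case: (leP (A w) b) => Ab; rewrite ?andbF ?mulr0 // !andbT.
case: (leP a' (A w)) => aA; last first.
  rewrite !mulr0; case: ltP => h; rewrite ?mulr0 // mulr1.
  by rewrite (le_trans a0) // ltW.
rewrite (lt_le_trans aa' aA) !mulr1 mulrAC ler_pdivrMr //.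
have A0 : a <= A w by rewrite (le_trans (ltW aa')).
have : 0 <= (A w - a) * (1 + A w * a) by rewrite mulr_ge0 ?subr_ge0 // addr_ge0 // mulr_ge0 // (le_trans a0).
lra.
Qed.

Lemma tail_mean_near0 (x : R) : 0 <= x -> tail_mean 0 - tail_mean x <= x.
Proof.
move=> x0; rewrite tail_mean_sub // -[leRHS](Ex_cst P); apply: le_Ex => //.
  exact: bmeas_cst.
move=> w; case: (boolP (_ && _)) => [/andP[_ ?]|_]; by rewrite ?mulr1 ?mulr0.
Qed.

Lemma tail_prob_ub (x : R) : 0 <= x -> x * Pr P [set w | x < A w] <= tail_mean x.
Proof.
move=> x0; have mx : measurable [set w | x < A w].
  by apply/measurable_set_ltr; [exact: measurable_cst|exact: bA.1].
rewrite -Ex_bool // -ExZ; last exact: bmeas_bool.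
apply: le_Ex => // [|w]; first exact/bZ/bmeas_bool.
by case: ltP => h; rewrite ?mulr0 // !mulr1 ltW.
Qed.

(** Only the part x < A <= y is kept, where A is at most y. The choice of y is left free: it will be
    a slightly higher level at which H is already small. *)
Lemma tail_prob_lb (x y : R) : 0 <= x -> x <= y ->
  tail_mean x - tail_mean y <= y * Pr P [set w | x < A w].
Proof.
move=> x0 xy; have mx : measurable [set w | x < A w].
  by apply/measurable_set_ltr; [exact: measurable_cst|exact: bA.1].
rewrite tail_mean_sub // -Ex_bool // -ExZ; last exact: bmeas_bool.
apply: le_Ex => // [|w]; first exact/bZ/bmeas_bool.
case: (ltP x (A w)) => h /=; rewrite ?mulr0 // !mulr1.
by case: (leP (A w) y) => h'; rewrite ?mulr0 ?mulr1 // (le_trans x0 xy).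
Qed.

End ClampStein.

Lemma ler_lim0 {R : realType} (x y C dl : R) : 0 < dl ->
  (forall e, 0 < e -> e < dl -> x <= y + C * e) -> x <= y.
Proof.
move=> dl0 H; rewrite leNgt; apply/negP => yx.
have C1 : 0 < `|C| + 1 by rewrite ltr_wpDl.
pose e := Num.min (dl / 2) ((x - y) / (2 * (`|C| + 1))).
have e0 : 0 < e.
  by rewrite lt_min !divr_gt0 ?subr_gt0 // mulr_gt0.
have e1 : e < dl by rewrite gt_min; apply/orP; left; lra.
have : (`|C| + 1) * e <= (x - y) / 2.
  rewrite mulrC -ler_pdivlMr //; rewrite ge_min invfM mulrA lexx orbT //.
have := H e e0 e1; have : C * e <= `|C| * e by rewrite ler_pM2r // ler_norm.
lra.
Qed.

Lemma cvg_dist_squeeze {R : realType} {T : Type} {F : set_system T} {FF : Filter F}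
    (f b : T -> R) (l : R) :
  (\forall z \near F, `|f z - l| <= b z) -> b @ F --> (0 : R) -> f @ F --> l.
Proof.
move=> fb b0; apply/cvgrPdist_le => e e0.
move/cvgrPdist_le : b0 => /(_ e e0) b0.
near=> z; rewrite distrC; have h : `|f z - l| <= b z by near: z.
apply: le_trans h _; have : `|0 - b z| <= e by near: z.
by rewrite sub0r normrN => h; apply: le_trans (ler_norm _) h.
Unshelve. all: by end_near. Qed.

(** * From difference inequalities to the formula for H *)

Section TailODE.
Context {R : realType}.
Implicit Types a b e x z : R.
Variables (N : nat) (H : R -> R) (I : R -> R -> R).
Hypothesis I_ub : forall a b e : R, 0 < e <= 1 -> 0 <= a -> a <= b ->
  (1 - e) * I (a + 2 * e) (b - e) <= N%:R * ((b - a) * H a + 2 * e).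
Hypothesis I_lb : forall a b e : R, 0 < e <= 1 -> e <= a -> a <= b ->
  N%:R * ((b - a) * H b - 2 * e) <= I (a - e) (b + 2 * e).
Hypothesis HI_ub : forall a b : R, 0 <= a -> a <= b -> b < 1 ->
  H a - H b <= b / (1 - b ^+ 2) * I a b.
Hypothesis HI_lb : forall a a' b : R, 0 <= a -> a < a' -> b < 1 -> a' <= b ->
  a / (1 - a ^+ 2) * I a' b <= H a - H b.
Hypothesis H_ge0 : forall a : R, 0 <= a -> 0 <= H a.
Hypothesis H_le1 : forall a, H a <= 1.
Hypothesis H_nincr : forall a b : R, a <= b -> 0 <= a -> H b <= H a.
Hypothesis H_near0 : forall x : R, 0 <= x -> H 0 - H x <= x.

Let N0 : 0 <= N%:R :> R. Proof. exact: ler0n. Qed.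

(** Start of a bootstrap. With H <= 1 alone, I(a, b) is O(b - a), and [HI_ub] makes H locally
    Lipschitz; this allows e to tend to 0 in the sharp bound [I_le], where H is first evaluated at a
    - 2 e. For the opposite bound [I_ge] monotonicity of H is enough. *)
Let I_lip a b : 0 < a -> a <= b -> I a b <= N%:R * (b - a).
Proof.
move=> a0 ab; apply: (@ler_lim0 _ _ _ (5 * N%:R + I a b) (Num.min 1 (a / 2))).
  by rewrite lt_min ltr01 divr_gt0.
move=> e e0; rewrite lt_min => /andP[e1 ea].
have := @I_ub (a - 2 * e) (b + e) e; rewrite e0 ltW //= => /(_ isT).
rewrite subrK addrK.
move=> /(_ ltac:(lra) ltac:(lra)).
have h1 := H_le1 (a - 2 * e).
have : (b + e - (a - 2 * e)) * H (a - 2 * e) <= b - a + 3 * e by nra.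
move=> h2 h3; have : N%:R * ((b + e - (a - 2 * e)) * H (a - 2 * e) + 2 * e) <=
  N%:R * (b - a + 5 * e) by apply: ler_wpM2l => //; lra.
lra.
Qed.

Let w (x : R) := x / (1 - x ^+ 2).

Let w_ge0 x : 0 <= x < 1 -> 0 <= w x.
Proof. by move=> /andP[x0 x1]; rewrite divr_ge0 // subr_ge0 expr_le1 // ltW. Qed.

Let H_lip a b : 0 < a -> a <= b -> b < 1 -> H a - H b <= w b * N%:R * (b - a).
Proof.
move=> a0 ab b1; apply: le_trans (HI_ub (ltW a0) ab b1) _.
have -> : w b * N%:R * (b - a) = w b * (N%:R * (b - a)) by rewrite mulrA.
by apply: ler_wpM2l; [rewrite w_ge0 // b1 andbT ltW // (lt_le_trans a0)|exact: I_lip].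
Qed.

Let I_le a b : 0 < a -> a <= b -> b < 1 -> I a b <= N%:R * ((b - a) * H a).
Proof.
move=> a0 ab b1; set L := w a * N%:R.
have a1 : a < 1 by exact: le_lt_trans ab b1.
have L0 : 0 <= L by rewrite mulr_ge0 // w_ge0 // a1 ltW.
apply: (@ler_lim0 _ _ _ (I a b + N%:R * (2 * L * (b - a) + 3 * H a + 6 * L + 2)) (Num.min 1 (a / 2))).
  by rewrite lt_min ltr01 divr_gt0.
move=> e e0; rewrite lt_min => /andP[e1 ea].
have := @I_ub (a - 2 * e) (b + e) e; rewrite e0 ltW //= => /(_ isT).
rewrite subrK addrK.
move=> /(_ ltac:(lra) ltac:(lra)).
have h1 : H (a - 2 * e) <= H a + L * (2 * e).
  by have := @H_lip (a - 2 * e) a; rewrite -/L => /(_ ltac:(lra) ltac:(lra) a1); lra.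
have h2 : (b + e - (a - 2 * e)) * H (a - 2 * e) <= (b - a + 3 * e) * (H a + L * (2 * e)).
  have -> : b + e - (a - 2 * e) = b - a + 3 * e by ring.
  by apply: ler_wpM2l => //; lra.
have h4 : (b - a + 3 * e) * (H a + L * (2 * e)) <= (b - a) * H a + e * (2 * L * (b - a) + 3 * H a + 6 * L).
  have : 0 <= L * (e * (1 - e)).
    by apply: mulr_ge0 => //; apply: mulr_ge0; lra.
  lra.
move=> h3; have : N%:R * ((b + e - (a - 2 * e)) * H (a - 2 * e) + 2 * e) <=
  N%:R * ((b - a) * H a + e * (2 * L * (b - a) + 3 * H a + 6 * L) + 2 * e).
  by apply: ler_wpM2l => //; lra.
lra.
Qed.

Let I_ge a b : 0 < a -> a < b -> N%:R * ((b - a) * H b) <= I a b.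
Proof.
move=> a0 ab.
apply: (@ler_lim0 _ _ _ (N%:R * 5) (Num.min 1 ((b - a) / 3))).
  by rewrite lt_min ltr01 divr_gt0 ?subr_gt0.
move=> e e0; rewrite lt_min => /andP[e1 ea].
have := @I_lb (a + e) (b - 2 * e) e; rewrite e0 ltW //= => /(_ isT).
rewrite addrK subrK.
move=> /(_ ltac:(lra) ltac:(lra)).
have h1 : H b <= H (b - 2 * e) by apply: H_nincr; lra.
have h2 : (b - 2 * e - (a + e)) * H b <= (b - 2 * e - (a + e)) * H (b - 2 * e).
  by apply: ler_wpM2l => //; lra.
have h4 := H_le1 b.
have h5 : e * H b <= e by rewrite ler_piMr // ltW.
move=> h3; have : N%:R * ((b - a) * H b - 5 * e) <=
   N%:R * ((b - 2 * e - (a + e)) * H (b - 2 * e) - 2 * e) by apply: ler_wpM2l => //; lra.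
lra.
Qed.

Let dH_ub a b : 0 < a -> a <= b -> b < 1 ->
  H a - H b <= N%:R * w b * H a * (b - a).
Proof.
move=> a0 ab b1; apply: le_trans (HI_ub (ltW a0) ab b1) _.
have -> : N%:R * w b * H a * (b - a) = w b * (N%:R * ((b - a) * H a)) by ring.
by apply: ler_wpM2l; [rewrite w_ge0 // b1 andbT ltW // (lt_le_trans a0)|exact: I_le].
Qed.

Let dH_lb a b : 0 < a -> a < b -> b < 1 ->
  N%:R * w a * H b * (b - a) <= H a - H b.
Proof.
move=> a0 ab b1.
apply: (@ler_lim0 _ _ _ (N%:R * w a * H b) (b - a)); first by rewrite subr_gt0.
move=> e e0 eb.
have := @HI_lb a (a + e) b => /(_ ltac:(lra) ltac:(lra) ltac:(lra) ltac:(lra)).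
have h : N%:R * ((b - (a + e)) * H b) <= I (a + e) b by apply: I_ge; lra.
have wa : 0 <= w a by rewrite w_ge0 // ltW //=; lra.
have := ler_wpM2l wa h; rewrite -/(w a); lra.
Qed.

Let H_cont x z : 0 < x < 1 -> 0 < z < 1 ->
  `|H z - H x| <= (w x + w z) * N%:R * `|z - x|.
Proof.
move=> /andP[x0 x1] /andP[z0 z1].
have wx : 0 <= w x by rewrite w_ge0 // x1 ltW.
have wz : 0 <= w z by rewrite w_ge0 // z1 ltW.
have [xz|/ltW zx] := leP x z.
  have := H_lip x0 xz z1; have := H_nincr xz (ltW x0).
  rewrite distrC (ger0_norm (_ : 0 <= z - x)) ?subr_ge0 // => h1 h2.
  rewrite ger0_norm ?subr_ge0 //; apply: le_trans h2 _.
  have : 0 <= w x * (N%:R * (z - x)) by apply: mulr_ge0 => //; apply: mulr_ge0 => //; lra.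
  lra.
have := H_lip z0 zx x1; have := H_nincr zx (ltW z0).
rewrite (distrC z x) (ger0_norm (_ : 0 <= x - z)) ?subr_ge0 // => h1 h2.
rewrite ger0_norm ?subr_ge0 //; apply: le_trans h2 _.
have : 0 <= w z * (N%:R * (x - z)) by apply: mulr_ge0 => //; apply: mulr_ge0 => //; lra.
lra.
Qed.

(** [dH_ub] and [dH_lb] differ only in the points at which w and H are evaluated, so the error is
    controlled by the increments of H and w between x and z, on either side of x. *)
Let quotient_bound x z : 0 < x < 1 -> 0 < z < 1 -> z != x ->
  `|(H z - H x) / (z - x) + N%:R * w x * H x| <=
  N%:R * (w x * `|H z - H x| + `|w z - w x|).
Proof.
move=> /andP[x0 x1] /andP[z0 z1] zx.
have wx : 0 <= w x by rewrite w_ge0 // x1 ltW.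
have wz : 0 <= w z by rewrite w_ge0 // z1 ltW.
have Hx := H_ge0 (ltW x0); have Hx1 := H_le1 x.
have n1 := ler_norm (H z - H x); have n1' := ler_norm (- (H z - H x)); rewrite normrN in n1'.
have n2 := ler_norm (w z - w x); have n2' := ler_norm (- (w z - w x)); rewrite normrN in n2'.
set n := `|H z - H x| in n1 n1' *; set m := `|w z - w x| in n2 n2' *.
have m0 : 0 <= m by exact: normr_ge0.
have n0 : 0 <= n by exact: normr_ge0.
have E1 : w x * - n <= w x * (H z - H x) by apply: ler_wpM2l => //; lra.
have E2 : w x * (H z - H x) <= w x * n by apply: ler_wpM2l => //; lra.
have E3 : (w z - w x) * H x <= m.
  by apply: le_trans (ler_wpM2r Hx n2) _; rewrite ler_piMr.
have E4 : - m <= (w z - w x) * H x.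
  have : (w x - w z) * H x <= m; last by lra.
  apply: le_trans (ler_wpM2r Hx (_ : _ <= m)) _; first by lra.
  by rewrite ler_piMr.
have key q : N%:R * (w x * - n - m) <= q + N%:R * w x * H x <= N%:R * (w x * n + m) ->
    `|q + N%:R * w x * H x| <= N%:R * (w x * n + m).
  by move=> /andP[h1 h2]; rewrite ler_norml h2 andbT; apply: le_trans h1; lra.
apply: key.
have [xz|xz|/eqP] := ltgtP x z; last by rewrite eq_sym (negbTE zx).
- have d0 : 0 < z - x by rewrite subr_gt0.
  have h1 := dH_lb x0 xz z1; have h2 := dH_ub x0 (ltW xz) z1.
  have F1 : (H z - H x) / (z - x) <= - (N%:R * w x * H z).
    by rewrite ler_pdivrMr // mulNr; lra.
  have F2 : - (N%:R * w z * H x) <= (H z - H x) / (z - x).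
    by rewrite ler_pdivlMr // mulNr; lra.
  have G1 := ler_wpM2l N0 E1; have G4 := ler_wpM2l N0 E3.
  have Gm : 0 <= N%:R * m by rewrite mulr_ge0.
  have Gn : 0 <= N%:R * (w x * n) by apply: mulr_ge0 => //; exact: mulr_ge0.
  by apply/andP; split; lra.
- have d0 : z - x < 0 by rewrite subr_lt0.
  have h1 := dH_lb z0 xz x1; have h2 := dH_ub z0 (ltW xz) x1.
  have F1 : (H z - H x) / (z - x) <= - (N%:R * w z * H x).
    by rewrite ler_ndivrMr // mulNr; lra.
  have F2 : - (N%:R * w x * H z) <= (H z - H x) / (z - x).
    by rewrite ler_ndivlMr // mulNr; lra.
  have G1 := ler_wpM2l N0 E2; have G4 := ler_wpM2l N0 E4.
  have Gm : 0 <= N%:R * m by rewrite mulr_ge0.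
  have Gn : 0 <= N%:R * (w x * n) by apply: mulr_ge0 => //; exact: mulr_ge0.
  by apply/andP; split; lra.
Qed.

Let w_cont x : 0 < x < 1 -> {for x, continuous w}.
Proof.
move=> /andP[x0 x1]; apply: cvgM; first exact: cvg_id.
have x2 : 1 - x ^+ 2 != 0 by rewrite subr_eq0 eq_sym lt_eqF // expr_lt1 // ltW.
apply: cvgV => //; apply: cvgB; [exact: cvg_cst|exact: exprn_continuous].
Qed.

Let near01 x : 0 < x < 1 -> \forall z \near x, 0 < z < 1.
Proof.
move=> x01; near=> z; have : z \in `]0, 1[ by near: z; apply: near_in_itvoo; rewrite in_itv.
by rewrite in_itv.
Unshelve. all: by end_near. Qed.

Let H_continuous x : 0 < x < 1 -> {for x, continuous H}.
Proof.
move=> x01.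
apply: (cvg_dist_squeeze (b := fun z => (w x + w z) * N%:R * `|z - x|)).
  by near=> z; apply: H_cont => //; near: z; exact: near01.
rewrite [X in _ --> X](_ : _ = (w x + w x) * N%:R * `|x - x|); last first.
  by rewrite subrr normr0 mulr0.
apply: cvgM.
  by apply: cvgM; [apply: cvgD; [exact: cvg_cst|exact: w_cont]|exact: cvg_cst].
by apply: cvg_norm; apply: cvgB; [exact: cvg_id|exact: cvg_cst].
Unshelve. all: by end_near. Qed.

Let H_derive x : 0 < x < 1 -> is_derive x 1 H (- (N%:R * w x * H x)).
Proof.
move=> x01; have /andP[x0 x1] := x01.
apply/is_derive1_caratheodory.
exists (fun z => if z == x then - (N%:R * w x * H x) else (H z - H x) / (z - x)); split.
- move=> z; case: eqP => [->|/eqP zx]; first by rewrite !subrr mulr0.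
  by rewrite divfK // subr_eq0.
- rewrite /prop_for /continuous_at eqxx.
  apply: (cvg_dist_squeeze (b := fun z => N%:R * (w x * `|H z - H x| + `|w z - w x|))).
    near=> z; case: eqP => [->|/eqP zx]; first by rewrite !subrr !normr0 mulr0 addr0 mulr0.
    by rewrite opprK; apply: quotient_bound => //; near: z; exact: near01.
  rewrite [X in _ --> X](_ : _ = N%:R * (w x * `|H x - H x| + `|w x - w x|)); last first.
    by rewrite !subrr normr0 mulr0 addr0 mulr0.
  apply: cvgMl_tmp; apply: cvgD.
    apply: cvgMl_tmp; apply: cvg_norm; apply: cvgB; [exact: H_continuous|exact: cvg_cst].
  by apply: cvg_norm; apply: cvgB; [exact: w_cont|exact: cvg_cst].
- by rewrite eqxx.
Unshelve. all: by end_near. Qed.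

(** Squaring avoids the half-integer exponent: H^2 / (1 - x^2)^N has derivative 0 on ]0, 1[. *)
Let H_sqr_ratio a b : 0 < a -> a <= b -> b < 1 ->
  H b ^+ 2 * (1 - a ^+ 2) ^+ N = H a ^+ 2 * (1 - b ^+ 2) ^+ N.
Proof.
move=> a0 ab b1.
pose Q x := (1 - x ^+ 2) ^+ N.
have Qp x : 0 < x < 1 -> 0 < Q x.
  by move=> /andP[x0 x1]; rewrite exprn_gt0 // subr_gt0 expr_lt1 // ltW.
pose K x := H x ^+ 2 * (Q x)^-1.
have dK x : 0 < x < 1 -> is_derive x 1 K 0.
  move=> x01; have := H_derive x01; have /gt_eqF Qx := Qp x x01.
  have x2 : 1 - x ^+ 2 != 0.
    by have /andP[x0 x1] := x01; rewrite subr_eq0 eq_sym lt_eqF // expr_lt1 // ltW.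
  move=> dH.
  have dQ : is_derive x 1 (fun y => (Q y)^-1) (- (Q x) ^- 2 *: (- (N%:R * (2 * x) * (1 - x ^+ 2) ^+ N.-1))).
    apply: is_deriveV; first by rewrite Qx.
    have dq : is_derive x 1 (cst 1 - (id : R -> R) ^+ 2) (- (2 * x)).
      by apply: is_derive_eq; rewrite /GRing.scale /=; ring.
    have QE : Q = (cst 1 - (id : R -> R) ^+ 2) ^+ N.
      by apply/funext => y; rewrite /Q !fctE.
    rewrite QE; apply: (is_derive_eq (is_deriveX N dq)).
    by rewrite /GRing.scale /= !fctE; ring.
  have dHH : is_derive x 1 (fun y => H y ^+ 2) (2 * H x * (- (N%:R * w x * H x))).
    apply: (is_derive_eq (is_deriveX 2 dH)).
    by rewrite /GRing.scale /=; ring.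
  apply: (is_derive_eq (is_deriveM dHH dQ)).
  rewrite /GRing.scale /= /w /K /Q /=.
  case: N => [|m]; first by ring.
  have r0 : (1 - x ^+ 2) ^+ m != 0 by exact: expf_neq0.
  rewrite /= (exprS (1 - x ^+ 2) m).
  set q := 1 - x ^+ 2 in x2 r0 *; set r := q ^+ m in r0 *.
  by field; rewrite x2 r0.
have Kab : K b = K a.
  have itv01 y : y \in `[a, b] -> 0 < y < 1.
    by rewrite in_itv /= => /andP[ay yb]; rewrite (lt_le_trans a0 ay) (le_lt_trans yb b1).
  have [|c _ /eqP] := MVT_segment ab (fun y yab => dK y (itv01 y (subset_itv_oo_cc yab))).
    by apply: derivable_within_continuous => y yab; have [] := dK y (itv01 y yab).
  by rewrite mul0r subr_eq0 => /eqP.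
have Qa : Q a != 0 by rewrite gt_eqF // Qp // a0 (le_lt_trans ab).
have Qb : Q b != 0 by rewrite gt_eqF // Qp // b1 (lt_le_trans a0).
have -> : H b ^+ 2 = K b * Q b by rewrite /K divfK.
have -> : H a ^+ 2 = K a * Q a by rewrite /K divfK.
by rewrite Kab -/(Q a) -/(Q b) mulrAC.
Qed.

(* The hypotheses bound the difference quotients of H from both sides, so H is
   differentiable with H' = - N x / (1 - x^2) H. *)
Lemma tail_ode b : 0 < b < 1 -> H b ^+ 2 = H 0 ^+ 2 * (1 - b ^+ 2) ^+ N.
Proof.
move=> /andP[b0 b1].
have Q01 x : 0 <= x <= 1 -> 0 <= (1 - x ^+ 2) ^+ N <= 1.
  move=> /andP[x0 x1]; have x2 : 0 <= x ^+ 2 <= 1 by rewrite sqr_ge0 expr_le1.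
  by rewrite exprn_ge0 ?exprn_ile1 //; lra.
have /andP[Qb0 Qb1] := Q01 b (introT andP (conj (ltW b0) (ltW b1))).
have Hb0 := H_ge0 (ltW b0); have Hb1 := H_le1 b.
have H00 := H_ge0 (lexx 0); have H01 := H_le1 0.
have Hb2 : 0 <= H b ^+ 2 <= 1 by rewrite sqr_ge0 expr_le1.
(* [H_sqr_ratio] starts from a point e > 0. Letting e tend to 0 takes H(e) <= H(0) and Bernoulli's
   inequality for one side, and H(0) <= H(e) + e for the other. *)
apply/eqP; rewrite eq_le; apply/andP; split.
- apply: (@ler_lim0 _ _ _ N%:R b) => // e e0 eb.
  have /andP[Qe0 Qe1] := Q01 e (introT andP (conj (ltW e0) (ltW (lt_trans eb b1)))).
  have E := H_sqr_ratio e0 (ltW eb) b1.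
  have bern : 1 - N%:R * e ^+ 2 <= (1 - e ^+ 2) ^+ N.
    have e2 : 0 <= e ^+ 2 <= 1 by rewrite sqr_ge0 expr_le1 ?ltW // (lt_trans eb).
    elim: N => [|m IH]; first by rewrite mul0r subr0 expr0.
    rewrite [leRHS]exprS -natr1.
    have h : (1 - e ^+ 2) * (1 - m%:R * e ^+ 2) <= (1 - e ^+ 2) * (1 - e ^+ 2) ^+ m.
      by apply: ler_wpM2l => //; lra.
    apply: le_trans h; have m0 : 0 <= m%:R :> R by exact: ler0n.
    have : 0 <= m%:R * (e ^+ 2 * e ^+ 2) by rewrite mulr_ge0 // mulr_ge0 ?sqr_ge0.
    lra.
  have e2 : N%:R * e ^+ 2 <= N%:R * e.
    by apply: ler_wpM2l => //; rewrite expr2 ler_piMr ?ltW // (lt_trans eb).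
  have He : H e ^+ 2 <= H 0 ^+ 2.
    by rewrite ler_pXn2r ?nnegrE // ?H_ge0 ?H_nincr // ltW.
  have h1 : H b ^+ 2 * (1 - N%:R * e) <= H b ^+ 2 * (1 - e ^+ 2) ^+ N.
    by apply: ler_wpM2l; [exact: sqr_ge0|lra].
  have h2 : H e ^+ 2 * (1 - b ^+ 2) ^+ N <= H 0 ^+ 2 * (1 - b ^+ 2) ^+ N.
    exact: ler_wpM2r.
  have h3 : H b ^+ 2 * (N%:R * e) <= N%:R * e.
    by rewrite ler_piMl //; [rewrite mulr_ge0 // ltW|have /andP[] := Hb2].
  lra.
- apply: (@ler_lim0 _ _ _ 3 b) => // e e0 eb.
  have /andP[Qe0 Qe1] := Q01 e (introT andP (conj (ltW e0) (ltW (lt_trans eb b1)))).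
  have E := H_sqr_ratio e0 (ltW eb) b1.
  have h1 : H 0 <= H e + e by have := H_near0 (ltW e0); lra.
  have He1 := H_le1 e; have He0 := H_ge0 (ltW e0).
  have h2 : H 0 ^+ 2 <= H e ^+ 2 + 3 * e.
    have : H 0 ^+ 2 <= (H e + e) ^+ 2 by rewrite ler_pXn2r ?nnegrE // addr_ge0 // ltW.
    have : e * H e <= e by rewrite ler_piMr // ltW.
    have : e * e <= e by rewrite ler_piMr // ltW // (lt_trans eb).
    lra.
  have h3 := ler_wpM2r Qb0 h2.
  have h4 : 3 * e * (1 - b ^+ 2) ^+ N <= 3 * e by rewrite ler_piMr // mulr_ge0 // ltW.
  have h5 : H b ^+ 2 * (1 - e ^+ 2) ^+ N <= H b ^+ 2 by rewrite ler_piMr // sqr_ge0.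
  lra.
Qed.

End TailODE.

(** * The law of a sample correlation *)

Section CenteredReflection.
Context {R : realType} {n : nat}.
Implicit Types (a b v x y z : 'cV[R]_n).

Definition ones : 'cV[R]_n := const_mx 1.

Lemma dot_ones x : dot ones x = \sum_i x i 0.
Proof. by apply: eq_bigr => i _; rewrite mxE mul1r. Qed.

Lemma dot_centered x y : (0 < n)%N ->
  dot (centered x) (centered y) = dot x y - dot ones x * dot ones y / n%:R.
Proof.
move=> n0; have nn0 : n%:R != 0 :> R by rewrite pnatr_eq0 -lt0n.
have cE z : centered z = z - mean z *: ones.
  by apply/matrixP => i j; rewrite !mxE mulr1.
have mE z : mean z = dot ones z / n%:R by rewrite dot_ones.
have o1 : dot ones ones = n%:R.
  by rewrite dot_ones (eq_bigr (fun=> 1)) ?sumr_const ?card_ord // => i _; rewrite mxE.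
rewrite !cE !(dotDl, dotDr, dotNl, dotNr, dotZl, dotZr) o1 (dotC x ones) !mE.
by field.
Qed.

Lemma reflection_swap a b : dot a a = dot b b -> a != b ->
  reflection (a - b) *m a = b /\ reflection (a - b) *m b = a.
Proof.
move=> ab anb; rewrite !reflectionE.
have v0 : dot (a - b) (a - b) != 0.
  by apply: contra anb => /eqP/dot_eq0/eqP; rewrite subr_eq0.
have E : dot (a - b) (a - b) = 2 * (dot b b - dot a b).
  by rewrite !(dotDl, dotDr, dotNl, dotNr) (dotC b a) ab; ring.
have h1 : 2 * dot (a - b) a / dot (a - b) (a - b) = 1.
  rewrite -[RHS](divff v0); congr (_ / _).
  by rewrite E dotDl dotNl (dotC b a) ab.
have h2 : 2 * dot (a - b) b / dot (a - b) (a - b) = -1.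
  rewrite -[RHS]opprK opprK -[in RHS](divff v0) -mulNr; congr (_ / _).
  by rewrite E dotDl dotNl; ring.
rewrite h1 h2 scale1r scaleN1r opprK; split.
  by rewrite opprB addrC subrK.
by rewrite addrC subrK.
Qed.

Lemma reflection_fix a v : dot v a = 0 -> reflection v *m a = a.
Proof. by move=> va; rewrite reflectionE va mulr0 mul0r scale0r subr0. Qed.

Lemma sample_corrE x y : (0 < n)%N -> sample_corr x y =
  (dot x y - dot ones x * dot ones y / n%:R) /
  (Num.sqrt (dot x x - dot ones x * dot ones x / n%:R) *
   Num.sqrt (dot y y - dot ones y * dot ones y / n%:R)).
Proof. by move=> n0; rewrite /sample_corr /norm2 !dot_centered. Qed.

Lemma sample_corrC x y : sample_corr x y = sample_corr y x.
Proof. by rewrite /sample_corr dotC mulrC [in LHS]mulrC [_ * norm2 (centered y)]mulrC. Qed.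

Lemma sample_corr_orth (O : 'M[R]_n) x y z : (0 < n)%N -> O^T *m O = 1%:M ->
  O *m ones = ones -> O *m y = z -> sample_corr (O *m x) z = sample_corr x y.
Proof.
move=> n0 oO O1 <-; rewrite !sample_corrE // !dot_orth //.
by rewrite -{1 2 3 4 5 6}O1 !dot_orth.
Qed.

Lemma ones_centered y : (0 < n)%N -> dot ones (centered y) = 0.
Proof.
move=> n0; have nn0 : n%:R != 0 :> R by rewrite pnatr_eq0 -lt0n.
rewrite dot_ones /centered; under eq_bigr => i _ do rewrite !mxE.
rewrite big_split /= sumrN sumr_const card_ord -mulr_natr /mean divfK //.
by rewrite subrr.
Qed.

Lemma sample_corr_scale (c : R) x y : 0 < c -> (0 < n)%N ->
  sample_corr x (c *: centered y) = sample_corr x y.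
Proof.
move=> c0 n0; rewrite sample_corrE // [RHS]sample_corrE //.
rewrite !(dotZl, dotZr) ones_centered // !(mulr0, mul0r, subr0).
have E z : dot z (centered y) = dot z y - dot ones z * dot ones y / n%:R.
  have -> : centered y = y - mean y *: ones.
    by apply/matrixP => i j; rewrite !mxE mulr1.
  by rewrite dotDr dotNr dotZr /mean -dot_ones (dotC z ones); ring.
rewrite (E x) (dot_centered y y n0).
set a := dot y y - _; set b := dot x y - _.
rewrite mulrA -expr2.
rewrite sqrtrM ?sqr_ge0 // sqrtr_sqr gtr0_norm //.
by rewrite mulrCA -mulf_div divff ?gt_eqF // mul1r.
Qed.

End CenteredReflection.

(** * Correlation with a fixed vector *)

Section CorrelationLaw.
Context {d : measure_display} {T : measurableType d} {R : realType}.
Context (P : probability T R) {n : nat}.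
Variable X : {RV P >-> vec R n}.
Hypotheses (sX : spherical P X) (n2 : (2 < n)%N).
Hypothesis X0 : P [set w | X w = (0 : 'cV[R]_n)] = 0%E.

Let n0 : (0 < n)%N. Proof. by case: n n2. Qed.
Let i0 : 'I_n := Ordinal n0.
Let n1 : (1 < n)%N. Proof. exact: ltnW. Qed.
Let i1 : 'I_n := Ordinal n1.
Let i10 : i1 != i0. Proof. by []. Qed.
Let nn0 : n%:R != 0 :> R. Proof. by rewrite pnatr_eq0 -lt0n. Qed.
Let u : 'cV[R]_n := (Num.sqrt n%:R)^-1 *: ones.
Let e0 : 'cV[R]_n := delta_mx i0 0.
Let e1 : 'cV[R]_n := delta_mx i1 0.
(** [Q] exchanges the unit vector [u] along [ones] with [e0]. In the new basis centring drops the
    coordinate [i0], and the correlation with [Q *m e1] is the coordinate [dir i0 i1]. *)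
Let Q : 'M[R]_n := reflection (u - e0).

Let dot_ones_ones : dot (ones : 'cV[R]_n) ones = n%:R.
Proof. by rewrite dot_ones (eq_bigr (fun=> 1)) ?sumr_const ?card_ord // => i _; rewrite mxE. Qed.

Let sn0 : 0 < Num.sqrt (n%:R : R).
Proof. by rewrite sqrtr_gt0 ltr0n. Qed.

Let uu : dot u u = 1.
Proof.
rewrite dotZl dotZr dot_ones_ones mulrA -invfM -expr2 sqr_sqrtr ?ler0n //.
by rewrite mulVf.
Qed.

Let u_neq : u != e0.
Proof.
apply/eqP => /(congr1 (fun x : 'cV[R]_n => x i1 0)).
rewrite !mxE mulr1 (negbTE i10) /= => /eqP.
by rewrite invr_eq0 gt_eqF.
Qed.

Let QS : Q *m u = e0 /\ Q *m e0 = u.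
Proof. by apply: reflection_swap => //; rewrite uu dot_delta mxE !eqxx. Qed.

Let oQ : Q^T *m Q = 1%:M.
Proof.
apply: reflection_orth; apply/eqP => /dot_eq0/eqP.
by rewrite subr_eq0 (negbTE u_neq).
Qed.

Implicit Types x y : 'cV[R]_n.

Let dotQ x y : dot (Q *m x) y = dot x (Q *m y).
Proof. by rewrite dot_mulmx reflection_tr. Qed.

Let centeredQ x y : dot (Q *m x) (Q *m y) - dot ones (Q *m x) * dot ones (Q *m y) / n%:R =
  dot x y - x i0 0 * y i0 0.
Proof.
rewrite dot_orth //; congr (_ - _).
have E z : dot ones (Q *m z) = Num.sqrt n%:R * z i0 0.
  have -> : ones = Num.sqrt n%:R *: u by rewrite scalerA divff ?scale1r ?gt_eqF.
  by rewrite dotZl -dotQ QS.1 dot_delta.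
rewrite !E mulrACA -expr2 sqr_sqrtr ?ler0n // mulrAC divff // mul1r //.
Qed.

Let b := Q *m e1.

Let corr_b x : sample_corr (Q *m x) b = dir i0 i1 x.
Proof.
rewrite sample_corrE // !centeredQ /dir rad2E expr2.
have e10 : e1 i0 0 = 0 by rewrite mxE eq_sym (negbTE i10).
have e11 : e1 i1 0 = 1 by rewrite mxE !eqxx.
by rewrite (dotC x e1) !dot_delta e10 e11 !mulr0 !subr0 sqrtr1 mulr1.
Qed.

(** A vector with [rad2] = 0 either is 0 or lies on the axis [i0] with a nonzero coordinate there;
    [X0] excludes the first case and [spherical_coord_neq0] the second. *)
Let rX : Pr P [set w | rad2 i0 (X w) == 0] = 0.
Proof.
have mX : measurable_fun [set: T] X by [].
have mr : measurable [set w | rad2 i0 (X w) == 0].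
  apply: measurable_set_eqr; last exact: measurable_cst.
  rewrite /rad2; under eq_fun => x do rewrite big_mkcond.
  apply: measurable_sum => i; case: (i != i0); last exact: measurable_cst.
  exact/measurable_funX/measurable_coordT.
have m1 : measurable [set w | ((X w : 'cV[R]_n) i1 0 == 0) && ((X w : 'cV[R]_n) i0 0 != 0)].
  apply/measurable_set_andb; last apply/measurable_set_negb.
    by apply/measurable_set_eqr; [exact: measurable_coordT|exact: measurable_cst].
  by apply/measurable_set_eqr; [exact: measurable_coordT|exact: measurable_cst].
have E0 : [set w | X w = (0 : 'cV[R]_n)] = [set w | [forall i : 'I_n, (X w : 'cV[R]_n) i 0 == 0]].
  apply/seteqP; split => w /=.
    by move=> ->; apply/forallP => i; rewrite mxE.
  by move=> /forallP h; apply/matrixP => i j; rewrite ord1 mxE; apply/eqP.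
have m0 : measurable [set w | X w = (0 : 'cV[R]_n)].
  rewrite E0 (_ : [set w | _] = \bigcap_(i in [set: 'I_n]) [set w | (X w : 'cV[R]_n) i 0 == 0]).
    apply: fin_bigcap_measurable => // i _.
    by apply/measurable_set_eqr; [exact: measurable_coordT|exact: measurable_cst].
  apply/seteqP; split => w /=; first by move=> /forallP h i _ /=; exact: h.
  by move=> h; apply/forallP => i; exact: h.
apply/eqP; rewrite eq_le Pr_ge0 andbT.
apply: le_trans (le_Pr P mr (measurableU _ _ m1 m0) _) _.
  move=> w /= /eqP r0.
  have xi k : k != i0 -> (X w : 'cV[R]_n) k 0 = 0.
    move=> k0; apply/eqP; rewrite -sqrf_eq0 eq_le sqr_ge0 andbT.
    by rewrite -r0 sqr_coord_le_rad2.
  have [x0|x0] := eqVneq ((X w : 'cV[R]_n) i0 0) 0; last by left; rewrite xi // eqxx.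
  right; apply/matrixP => i j; rewrite ord1 mxE.
  by have [->|/xi] := eqVneq i i0.
apply: le_trans (Pr_setU_le P m1 m0) _.
by rewrite spherical_coord_neq0 // add0r /Pr X0.
Qed.

Definition corr_tail_prob (t : R) : R := Pr P [set w | t < `|dir i0 i1 (X w)|].

Let mdir : measurable_fun [set: T] (fun w => dir i0 i1 (X w)).
Proof. exact: (bmeas_dirT X i10).1. Qed.

(** After normalization [centered y] is, like [b], a unit vector orthogonal to [ones]. The
    reflection along their difference exchanges the two and fixes [ones], so it preserves
    correlations as well as the law of X. *)
Lemma corr_law (y : 'cV[R]_n) (t : R) : centered y != 0 ->
  Pr P [set w | t < `|sample_corr (X w) y|] = corr_tail_prob t.
Proof.
move=> cy0.
have mB z : measurable [set x : vec R n | t < `|sample_corr x z|].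
  apply/measurable_set_ltr; first exact: measurable_cst.
  apply: measurableT_comp => //.
  by apply: measurable_sample_corr => //; exact: measurable_cst.
have -> : corr_tail_prob t = Pr P [set w | t < `|sample_corr (X w) b|].
  rewrite /corr_tail_prob /Pr.
  under eq_set => w do rewrite -corr_b.
  by congr fine; exact: (spherical_Pr sX oQ (mB b)).
have yp : 0 < dot (centered y) (centered y).
  by rewrite lt_def dot_ge0 andbT; apply: contra cy0 => /eqP/dot_eq0 ->.
pose c := (norm2 (centered y))^-1; have c0 : 0 < c by rewrite invr_gt0 sqrtr_gt0.
pose a := c *: centered y.
have aa : dot a a = 1.
  rewrite dotZl dotZr mulrA -invfM -expr2 sqr_sqrtr ?dot_ge0 // mulVf //.
  by rewrite gt_eqF.
have oa : dot ones a = 0 by rewrite dotZr ones_centered // mulr0.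
have ob : dot ones b = 0.
  have -> : ones = Num.sqrt n%:R *: u by rewrite scalerA divff ?scale1r ?gt_eqF.
  by rewrite dotZl -dotQ QS.1 dot_delta mxE eq_sym (negbTE i10) mulr0.
have bb : dot b b = 1 by rewrite dot_orth // dot_delta mxE !eqxx.
have Ea w : sample_corr (X w) y = sample_corr (X w) a by rewrite sample_corr_scale.
under eq_set => w do rewrite Ea.
have [->//|ab] := eqVneq a b.
have [Oa Ob] : reflection (a - b) *m a = b /\ reflection (a - b) *m b = a.
  by apply: reflection_swap; rewrite // aa bb.
have oO : (reflection (a - b))^T *m reflection (a - b) = 1%:M.
  by apply: reflection_orth; apply: contra ab => /eqP/dot_eq0/eqP; rewrite subr_eq0.
have O1 : reflection (a - b) *m ones = ones.
  by apply: reflection_fix; rewrite dotC dotDr dotNr oa ob subrr.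
rewrite /Pr -(spherical_Pr sX oO (mB b)); congr (fine (P _)).
by apply/seteqP; split => w /=; rewrite (sample_corr_orth _ n0 oO O1 Oa).
Qed.

Lemma centered_neq0 : P [set w | centered (X w) = (0 : 'cV[R]_n)] = 0%E.
Proof.
have mX : measurable_fun [set: T] X by [].
have mr : measurable [set x : vec R n | dot (centered x) (centered x) == 0].
  by apply/measurable_set_eqr; [exact: measurable_dot_centered|exact: measurable_cst].
rewrite (_ : [set w | _] = [set w | dot (centered (X w)) (centered (X w)) == 0]).
  rewrite -(spherical_Pr sX oQ mr).
  transitivity ((Pr P [set w | rad2 i0 (X w) == 0])%:E); last by rewrite rX.
  rewrite EFin_Pr //; last first.
    apply: measurable_set_eqr; last exact: measurable_cst.
    rewrite /rad2; under eq_fun => x do rewrite big_mkcond.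
    apply: measurable_sum => i; case: (i != i0); last exact: measurable_cst.
    exact/measurable_funX/measurable_coordT.
  by congr (P _); apply/seteqP; split => w /=; rewrite dot_centered // centeredQ rad2E expr2.
apply/seteqP; split => w /=; last by move=> /eqP/dot_eq0.
by move=> ->; rewrite -(scale0r 0) dotZl mul0r.
Qed.

Let A w := dir i0 i1 (X w).
Let H := tail_mean X i0 i1.
Let bA : bmeas A. Proof. exact: bmeas_dirT. Qed.

Let sym (f : R -> R) : bmeas (fun x : vec R n => f (dir i0 i1 x)) ->
  Ex P (fun w => f (- A w)) = Ex P (fun w => f (A w)).
Proof.
move=> bf; have oN : (- 1%:M : 'M[R]_n)^T *m (- 1%:M) = 1%:M.
  have -> : (- 1%:M : 'M[R]_n)^T = - 1%:M by apply/matrixP => i j; rewrite !mxE eq_sym.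
  by rewrite mulNmx mulmxN opprK mulmx1.
rewrite -(spherical_Ex sX oN bf); congr Ex; apply/funext => w; congr f.
rewrite /A /dir mulNmx mul1mx mxE mulNr; congr (- (_ / Num.sqrt _)).
by apply: eq_bigr => i _; rewrite mxE sqrrN.
Qed.

Lemma corr_tail_probE t : 0 <= t ->
  corr_tail_prob t = 2 * Pr P [set w | t < dir i0 i1 (X w)].
Proof.
move=> t0.
have m1 : measurable [set w | t < A w].
  by apply/measurable_set_ltr => //; exact: measurable_cst.
have m2 : measurable [set w | t < - A w].
  by apply/measurable_set_ltr; [exact: measurable_cst|exact: measurableT_comp].
have m3 : measurable [set w | t < `|A w|].
  by apply/measurable_set_ltr; [exact: measurable_cst|exact: measurableT_comp].
have bt : bmeas (fun x : vec R n => (t < dir i0 i1 x)%R%:R : R).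
  by apply/bmeas_bool/measurable_set_ltr; [exact: measurable_cst|exact: (bmeas_dir i10).1].
rewrite /corr_tail_prob -!Ex_bool // mulr_natl mulr2n -{2}(sym (f := fun x : R => (t < x)%R%:R)) //.
rewrite -ExD; [|exact: bmeas_bool..]; congr Ex; apply/funext => w.
rewrite /A; set x := dir _ _ _.
have [x0|x0] := leP 0 x.
  rewrite ger0_norm // [t < - x]ltNge (_ : - x <= t) ?addr0 //.
  by rewrite (le_trans _ t0) // oppr_le0.
rewrite ltr0_norm // [t < x]ltNge (_ : x <= t) ?add0r //.
by rewrite (le_trans _ t0) // ltW.
Qed.

Let Ex_abs : Ex P (fun w => `|A w|) = 2 * H 0.
Proof.
have bp : bmeas (fun x : vec R n => dir i0 i1 x * (0 < dir i0 i1 x)%R%:R).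
  apply: bmeasM; first exact: bmeas_dir.
  by apply/bmeas_bool/measurable_set_ltr; [exact: measurable_cst|exact: (bmeas_dir i10).1].
have mX : measurable_fun [set: T] X by [].
rewrite mulr_natl mulr2n -{2}[H 0](sym (f := fun x : R => x * (0 < x)%R%:R)) // -ExD; last 2 first.
- exact: (bmeas_comp X bp).
- apply: bmeasM; first exact: bmeasN.
  apply/bmeas_bool/measurable_set_ltr; first exact: measurable_cst.
  exact: measurableT_comp.
congr Ex; apply/funext => w; rewrite -/(A w) oppr_gt0.
have [x0|x0|->] := ltgtP (A w) 0.
- by rewrite ltr0_norm // mulr0 mulr1 add0r.
- by rewrite gtr0_norm // mulr0 mulr1 addr0.
- by rewrite normr0 oppr0 !mul0r addr0.
Qed.

(** The constant in front of the tail: E|A| = 2 H(0), and the factor sqrt n makes it of order 1. Its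
    exact value is a quotient of Gamma functions; only the two-sided bound below is used. *)
Definition corr_scale : R := Num.sqrt n%:R * Ex P (fun w => `|dir i0 i1 (X w)|).

Lemma corr_scale_bounds : 2^-1 <= corr_scale <= 2.
Proof.
have E2 := Ex_sqr_dir sX rX i10 n1; have E4 := Ex_dir4E sX rX i10 n2.
have bA2 : bmeas (fun w => dir i0 i1 (X w) ^+ 2) by exact: bmeasX.
have bA4 : bmeas (fun w => dir i0 i1 (X w) ^+ 4) by exact: bmeasX.
have bN : bmeas (fun w => `|dir i0 i1 (X w)|) by exact: bmeas_norm.
have bZ (r : R) f : bmeas f -> bmeas (fun w : T => r * f w).
  by move=> bf; apply: bmeasM => //; exact: bmeas_cst.
pose s := Num.sqrt (n%:R : R); have s2 : s ^+ 2 = n%:R by rewrite sqr_sqrtr // ler0n.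
have n3 : 3 <= n%:R :> R by rewrite ler_nat.
have nE : n.-1%:R = n%:R - 1 :> R by rewrite -subn1 natrB.
have nE' : n.+1%:R = n%:R + 1 :> R by rewrite -natr1.
rewrite /corr_scale -/s -ExZ //; apply/andP; split.
(* With y = sqrt n |A|, y >= y^2 - 4/27 y^4 for y >= 0, with equality at y = 3/2; 4/27 is the least
   such constant. The second and fourth moments then give 1/2. *)
- apply: (@le_trans _ _ (Ex P (fun w => n%:R * dir i0 i1 (X w) ^+ 2 -
      4 / 27 * n%:R ^+ 2 * dir i0 i1 (X w) ^+ 4))).
    rewrite ExB; [|exact: bZ..]; rewrite !ExZ // E2 E4 nE nE'.
    set m := n%:R in n3 *.
    have -> : m * (m - 1)^-1 - 4 / 27 * m ^+ 2 * (3 / ((m - 1) * (m + 1))) =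
       (m * (m + 1) - 4 / 9 * m ^+ 2) / ((m - 1) * (m + 1)).
      by field; apply/andP; split; rewrite gt_eqF //; lra.
    rewrite ler_pdivlMr; last by rewrite mulr_gt0 //; lra.
    nra.
  apply: le_Ex => [||w]; [by apply: bmeasB; exact: bZ|exact: bZ|].
  move: (dir _ _ _) => x; set y := s * `|x|.
  have y0 : 0 <= y by rewrite mulr_ge0 // ltW.
  have y2 : n%:R * x ^+ 2 = y ^+ 2 by rewrite exprMn s2 real_normK ?num_real.
  have -> : n%:R * x ^+ 2 - 4 / 27 * n%:R ^+ 2 * x ^+ 4 =
      y - 4 / 27 * y * ((y - 3 / 2) ^+ 2 * (y + 3)).
    rewrite (_ : 4 / 27 * _ * _ = 4 / 27 * (n%:R * x ^+ 2) ^+ 2); last by ring.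
    by rewrite y2; field.
  have : 0 <= y * ((y - 3 / 2) ^+ 2 * (y + 3)).
    by apply: mulr_ge0 => //; apply: mulr_ge0; [exact: sqr_ge0|lra].
  lra.
(* Here y <= 1/2 + y^2 / 2, and the second moment suffices. *)
- apply: (@le_trans _ _ (Ex P (fun w => 2^-1 + n%:R / 2 * dir i0 i1 (X w) ^+ 2))).
    apply: le_Ex => [||w]; [exact: bZ|by apply: bmeasD; [exact: bmeas_cst|exact: bZ]|].
    move: (dir _ _ _) => x.
    have -> : n%:R / 2 * x ^+ 2 = (s * `|x|) ^+ 2 / 2.
      by rewrite exprMn s2 real_normK ?num_real // mulrAC.
    set y := s * `|x|; have := sqr_ge0 (y - 1); lra.
  rewrite ExD; [|exact: bmeas_cst|exact: bZ]; rewrite Ex_cst ExZ // E2 nE.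
  set m := n%:R in n3 *.
  have m1 : 0 < m - 1 by lra.
  rewrite -lerBrDl ler_pdivrMr //; lra.
Qed.

Let H_sqrt b' : 0 <= b' < 1 -> H b' = H 0 * Num.sqrt ((1 - b' ^+ 2) ^+ n.-2).
Proof.
move=> /andP[b0 b1].
have H00 : 0 <= H 0 by exact: tail_mean_ge0.
move: b0; rewrite le_eqVlt => /predU1P[<-|b0].
  by rewrite expr0n subr0 expr1n sqrtr1 mulr1.
have Hb0 : 0 <= H b' by apply: tail_mean_ge0; exact: ltW.
have Q0 : 0 <= (1 - b' ^+ 2) ^+ n.-2.
  by rewrite exprn_ge0 // subr_ge0 expr_le1 // ltW.
apply/eqP; rewrite -(eqrXn2 (n := 2)) // ?mulr_ge0 ?sqrtr_ge0 //.
rewrite exprMn sqr_sqrtr //; apply/eqP.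
apply: (tail_ode (I := itv_mean X i0 i1)) => //.
- by move=> *; exact: itv_mean_ub.
- by move=> *; exact: itv_mean_lb.
- by move=> *; exact: tail_mean_sub_ub.
- by move=> *; apply: tail_mean_sub_lb.
- by move=> *; exact: tail_mean_ge0.
- by move=> *; exact: tail_mean_le1.
- move=> a c ac a0; rewrite -subr_ge0 tail_mean_sub //; apply: Ex_ge0 => w.
  by case: (boolP (_ && _)) => [/andP[aA _]|_]; rewrite ?mulr0 // mulr1 (le_trans a0) // ltW.
- by move=> *; exact: tail_mean_near0.
- by rewrite b0.
Qed.

Lemma corr_tail_prob_bounds (x y : R) :
  let G (z : R) := corr_scale * Num.sqrt ((1 - z ^+ 2 / n%:R) ^+ n.-2) in
  0 < x -> x < y -> y < Num.sqrt n%:R ->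
  x * corr_tail_prob (x / Num.sqrt n%:R) <= G x /\
  G x - G y <= y * corr_tail_prob (x / Num.sqrt n%:R).
Proof.
move=> G x0 xy yn; pose s := Num.sqrt (n%:R : R).
have s0 : 0 < s by [].
have s2 : s ^+ 2 = n%:R by rewrite sqr_sqrtr // ler0n.
have GE z : 0 < z -> z < s -> G z = 2 * s * H (z / s).
  move=> z0 zs; rewrite H_sqrt; last by rewrite divr_ge0 ?ltW //= ltr_pdivrMr // mul1r.
  by rewrite /G /corr_scale -/s Ex_abs expr_div_n s2; ring.
have xs : 0 <= x / s by rewrite divr_ge0 ?ltW.
rewrite corr_tail_probE // -/s (GE x x0 (lt_trans xy yn)) (GE y (lt_trans x0 xy) yn).
have E z : z = s * (z / s) by rewrite mulrC divfK // gt_eqF.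
set q := Pr _ _; rewrite -mulrBr; split.
  have -> : x * (2 * q) = 2 * s * (x / s * q) by rewrite {1}(E x); ring.
  by rewrite ler_pM2l ?mulr_gt0 //; exact: tail_prob_ub.
have -> : y * (2 * q) = 2 * s * (y / s * q) by rewrite {1}(E y); ring.
rewrite ler_pM2l ?mulr_gt0 //; apply: tail_prob_lb => //.
by rewrite ler_pM2r ?invr_gt0 // ltW.
Qed.

End CorrelationLaw.

(** * Stein-Chen recurrence for the counts *)

Section PairwiseIndependence.
Context {d : measure_display} {T : measurableType d} {R : realType}.
Context (P : probability T R) {n p : nat}.
Variable Z : 'I_p -> {RV P >-> vec R n}.
Hypothesis indZ : mutually_independent Z.

(* A pi-system generating the sigma-algebra of the vectors Z k, k != j. *)
Definition others_rect (j : 'I_p) : set (set T) :=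
  [set E | exists B : 'I_p -> set (vec R n),
    [/\ forall i, measurable (B i), B j = setT & E = [set w | forall i, B i (Z i w)]]].

(** The carrier is still T and only the sigma-algebra is smaller, so that knowing all vectors but
    Z_j is encoded by the identity map from T to [others j]. *)
Definition others (j : 'I_p) := g_sigma_algebraType (others_rect j).

Lemma measurable_rect (B : 'I_p -> set (vec R n)) : (forall i, measurable (B i)) ->
  measurable [set w | forall i, B i (Z i w)].
Proof.
move=> mB; rewrite (_ : [set w | _] = \bigcap_(i in [set: 'I_p]) [set w | B i (Z i w)]).
  apply: fin_bigcap_measurable => // i _.
  exact: measurable_preimageT (mB i).
by apply/seteqP; split => w /= h i => [_|]; [exact: h|exact: (h i I)].
Qed.

(** Dynkin's argument: the sets E that factor with a fixed event of Z_j form a lambda-system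
    containing the rectangles. Measurability of E in T is carried along, since E is given only in
    the generated sigma-algebra. *)
Lemma others_indep (j : 'I_p) (E : set T) (D : set (vec R n)) :
  <<s others_rect j >> E -> measurable D ->
  measurable E /\ P (E `&` [set w | D (Z j w)]) = (P E * P [set w | D (Z j w)])%E.
Proof.
move=> sE mD; pose F := [set w | D (Z j w)].
have mF : measurable F by exact: measurable_preimageT.
pose H : set (set T) := [set E | measurable E /\ P (E `&` F) = (P E * P F)%E].
suff : <<s others_rect j >> `<=` H by move=> /(_ E sE).
apply: lambda_system_subset; last by move=> X _ x _.
- move=> _ _ [B [mB Bj ->]] [C [mC Cj ->]]; exists (fun i => B i `&` C i); split.
  + by move=> i; exact: measurableI.
  + by rewrite Bj Cj setIT.
  + apply/seteqP; split => w /=; first by move=> [b c] i; split; [exact: b|exact: c].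
    by move=> h; split => i; case: (h i).
- split.
  + by move=> A _ x _.
  + by split => //; rewrite setTI probability_setT mul1e.
  + move=> A B BA [mA hA] [mB hB]; split; first exact: measurableD.
    have E1 : (A `\` B) `&` F = (A `&` F) `\` (B `&` F).
      apply/seteqP; split => w /=; first by move=> [[a b] f]; split => // -[].
      by move=> [[a f] b]; split => //; split => // bB; apply: b.
    rewrite -!EFin_Pr //; [|exact: measurableD|by apply: measurableI => //; exact: measurableD].
    rewrite E1 !Pr_setD //; [|exact: measurableI..|by move=> w [b f]; split => //; exact: BA].
    rewrite -EFinM mulrBl; congr ((_ - _)%:E); apply: EFin_inj;
      by rewrite EFinM !EFin_Pr //; exact: measurableI.
  + move=> G ndG HG; have mG i : measurable (G i) by case: (HG i).
    split; first exact: bigcupT_measurable.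
    have c1 : P (G i) @[i --> \oo] --> P (\bigcup_i G i).
      by apply: nondecreasing_cvg_mu => //; exact: bigcupT_measurable.
    have c2 : P (G i `&` F) @[i --> \oo] --> P ((\bigcup_i G i) `&` F).
      rewrite setI_bigcupl; apply: nondecreasing_cvg_mu => //.
      - by move=> i; exact: measurableI.
      - by apply: bigcupT_measurable => i; exact: measurableI.
      - by move=> a b ab; apply/subsetPset; apply: setSI; apply/subsetPset; exact: ndG.
    have c3 : (P (G i) * P F)%E @[i --> \oo] --> (P (\bigcup_i G i) * P F)%E.
      by apply: cvgeZr => //; rewrite fin_num_measure.
    have EH : (fun i => P (G i `&` F)) = (fun i => (P (G i) * P F)%E).
      by apply/funext => i; exact: (HG i).2.
    by rewrite EH in c2; apply: cvg_unique c2 c3.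
- move=> _ [B [mB Bj ->]]; split; first exact: measurable_rect.
  pose B' i := if i == j then D else B i.
  have mB' i : measurable (B' i) by rewrite /B'; case: ifP.
  have -> : [set w | forall i, B i (Z i w)] `&` F = [set w | forall i, B' i (Z i w)].
    apply/seteqP; split => w /=.
      by move=> [b f] i; rewrite /B'; case: eqP => // ->.
    move=> h; split => [i|]; last by have := h j; rewrite /B' eqxx.
    have := h i; rewrite /B'; case: eqP => // -> _; by rewrite Bj.
  rewrite !indZ // (bigD1 j) //= [in RHS](bigD1 j) //= Bj preimage_setT probability_setT mul1e.
  rewrite muleC; congr (_ * _)%E; last by rewrite /B' eqxx.
  by apply: eq_bigr => i /negbTE ij; rewrite /B' ij.
Qed.

Lemma measurable_others (i j : 'I_p) : i != j ->
  measurable_fun [set: others j] (Z i : others j -> vec R n).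
Proof.
move=> ij _ B mB; rewrite setTI; apply: sub_sigma_algebra.
exists (fun k => if k == i then B else setT); split.
- by move=> k; case: ifP.
- by rewrite eq_sym (negbTE ij).
- apply/seteqP; split => w /=; first by move=> b k; case: eqP => // ->.
  by move=> /(_ i); rewrite eqxx.
Qed.

End PairwiseIndependence.

(** * Independence of a correlation from the other vectors *)

Section CorrelationIndependence.
Context {d : measure_display} {T : measurableType d} {R : realType}.
Context (P : probability T R) {n p : nat}.
Variable Z : 'I_p -> {RV P >-> vec R n}.
Hypotheses (sZ : iid_spherical Z) (n2 : (2 < n)%N).

(* Z_i is fixed by the conditioning, and corr_law gives the same probability
   for every value of it that is not constant. *)
Lemma corr_others_indep (i j : 'I_p) (E : set T) (t : R) : i != j ->
  <<s others_rect Z j >> E ->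
  P (E `&` [set w | t < `|sample_corr (Z i w) (Z j w)|]) =
  (P E * (corr_tail_prob (Z j) n2 t)%:E)%E.
Proof.
move=> ij sE; have [indZ _ sphZ zZ] := sZ.
have [mE _] := others_indep indZ sE measurableT.
have mid : isMeasurableFun _ _ T (others Z j) (idfun : T -> others Z j).
  by constructor => _ B mB; rewrite setTI; have [] := others_indep indZ mB measurableT.
(* The identity as a random variable in the coarser space. The law of (Y, Z_j) is the product of its
   marginals, and the event in question is the preimage of [M]. *)
pose Y : {mfun T >-> others Z j} := HB.pack (idfun : T -> others Z j) mid.
have mpair : isMeasurableFun _ _ T (others Z j * vec R n)%type (fun w => (Y w, Z j w)).
  by constructor; apply: measurable_fun_pair.
pose W : {mfun T >-> (others Z j * vec R n)%type} := HB.pack (fun w => (Y w, Z j w)) mpair.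
pose m1 := distribution P Y; pose m2 := distribution P (Z j).
pose M : set (others Z j * vec R n) :=
  [set wz | E wz.1 /\ t < `|sample_corr (Z i wz.1) wz.2|].
have mM : measurable M.
  apply: measurableI.
    apply: (measurable_preimageT (B := (E : set (others Z j)))) => //.
  apply: measurable_set_ltr; first exact: measurable_cst.
  apply: measurableT_comp => //; apply: measurable_sample_corr; last exact: measurable_snd.
  have mo := measurable_others (Z := Z) ij.
  by apply: (measurableT_comp (f := (Z i : others Z j -> vec R n)) mo); exact: measurable_fst.
have -> : P (E `&` [set w | t < `|sample_corr (Z i w) (Z j w)|]) = distribution P W M by [].
rewrite -(@product_measure_unique _ _ _ _ _ m1 m2) //; last first.
  move=> A B mA mB; have [_ <-] := others_indep indZ mA mB.
  by rewrite /distribution /pushforward; congr (P _).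
pose f := (m2 \o xsection M)%E.
have mf : measurable_fun [set: others Z j] f by exact: measurable_fun_xsection.
transitivity (\int[distribution P Y]_y f y)%E; first by [].
rewrite ge0_integral_distribution //.
(* Outside this null event the section of [M] at w has measure [corr_tail_prob] when w is in E, and
   0 otherwise. *)
pose N := [set w | centered (Z i w) = (0 : 'cV[R]_n)].
have mN : measurable N.
  have -> : N = [set w | dot (centered (Z i w)) (centered (Z i w)) == 0].
    apply/seteqP; split => w /=; last by move=> /eqP/dot_eq0.
    by move=> ->; rewrite -(scale0r 0) dotZl mul0r.
  by apply: measurable_set_eqr; [exact: measurable_dot_centered|exact: measurable_cst].
have N0 : P N = 0%E by exact: centered_neq0.
rewrite (@ae_eq_integral _ _ _ P setT (fun w => (corr_tail_prob (Z j) n2 t)%:E * (\1_E w)%:E)%E) //; last 3 first.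
- exact: measurableT_comp mf _.
- by apply: measurable_funeM; apply/measurable_EFinP; exact: measurable_indic.
- exists N; split => // w /= /not_implyP[_ h]; apply: contrapT => cw; apply: h.
  rewrite /f /=; have [wE|wE] := pselect (E w); last first.
    rewrite indicE memNset // mule0.
    by rewrite (_ : xsection M w = set0) ?measure0 //; apply/seteqP; split => z //; rewrite /xsection /= inE => -[].
  have cw0 : centered (Z i w) != 0 by apply/eqP.
  rewrite indicE mem_set // mule1 -(corr_law (sphZ j) n2 t cw0) EFin_Pr; last first.
    apply: measurable_set_ltr; first exact: measurable_cst.
    by apply: measurableT_comp => //; apply: measurable_sample_corr.
  rewrite /m2 /distribution /pushforward; congr (P _).
  apply/seteqP; split => v /=; rewrite /xsection /= inE /M /=.
    by move=> [_]; rewrite sample_corrC.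
  by rewrite sample_corrC => h; split.
rewrite ge0_integralZl //; last 2 first.
- by apply/measurable_EFinP; exact: measurable_indic.
- by rewrite lee_fin; exact: Pr_ge0.
by rewrite integral_indic // setIT muleC.
Qed.

End CorrelationIndependence.

(** * Abstract comparison of counts at two nested levels *)

Section SteinChen.
Context {d : measure_display} {T : measurableType d} {R : realType}.
Variables (P : probability T R) (E : finType) (S : pred E) (adj : rel E).
Variables (B C : E -> T -> bool) (b c : R) (D : nat).
Hypotheses (mB : forall e, measurable [set w | B e w])
           (mC : forall e, measurable [set w | C e w]).
Hypothesis BC : forall e w, B e w -> C e w.
Hypothesis adj_refl : forall e, adj e e.
Hypothesis adj_card : forall e, S e -> (#|[pred f | S f && adj e f]| <= D)%N.
Hypothesis PC : forall e, S e -> Pr P [set w | C e w] = c.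
Hypothesis PBC : forall e f, S e -> S f -> f != e ->
  Pr P [set w | B e w && C f w] <= b * c.
Hypothesis b0 : 0 <= b.

Definition far_count (A : E -> T -> bool) e w : nat := \sum_(f | S f && ~~ adj e f) A f w.
Definition hit_count (A : E -> T -> bool) w : nat := \sum_(f | S f) A f w.

Hypothesis indep : forall e i, S e ->
  Pr P [set w | B e w && ((far_count B e w == i) && (far_count C e w == i))] =
  b * Pr P [set w | (far_count B e w == i) && (far_count C e w == i)].

Lemma measurable_count (Q : pred E) (A : E -> T -> bool) i :
  (forall e, Q e -> measurable [set w | A e w]) ->
  measurable [set w | (\sum_(f | Q f) A f w == i)%N].
Proof.
move=> mA.
have -> : [set w | (\sum_(f | Q f) A f w == i)%N] =
    [set w | \sum_(f | Q f) (A f w)%:R == i%:R :> R].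
  by apply/seteqP; split => w /=; rewrite -natr_sum eqr_nat.
apply: measurable_set_eqr; last exact: measurable_cst.
under eq_fun => w do rewrite big_mkcond.
apply: measurable_sum => f; case: (boolP (Q f)) => Qf; last exact: measurable_cst.
exact: (bmeas_bool (mA f Qf)).1.
Qed.

Lemma measurable_count2 (Q : pred E) i :
  measurable [set w | (\sum_(f | Q f) B f w == i)%N && (\sum_(f | Q f) C f w == i)%N].
Proof. by apply: measurable_set_andb; apply: measurable_count. Qed.

Lemma hit_countE (A : E -> T -> bool) e w : hit_count A w =
  (\sum_(f | S f && adj e f) A f w + far_count A e w)%N.
Proof. by rewrite /hit_count (bigID (adj e)). Qed.

Let far_diff e i w : `|((far_count B e w == i) && (far_count C e w == i))%:R
    - ((hit_count B w == i) && (hit_count C w == i))%:R| <=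
  \sum_(f | S f && adj e f) (C f w)%:R :> R.
Proof.
rewrite -natr_sum !(hit_countE _ e).
case: (posnP (\sum_(f | S f && adj e f) C f w)) => [z|h].
  have zB : (\sum_(f | S f && adj e f) B f w = 0)%N.
    apply/eqP; rewrite -leqn0 -{2}z; apply: leq_sum => f _.
    by case: (boolP (B f w)) => // /BC ->.
  by rewrite z zB !add0n subrr normr0.
apply: (@le_trans _ _ 1); last by rewrite ler1n.
by do 2 case: (_ && _); rewrite ?subrr ?subr0 ?sub0r ?normrN ?normr0 ?normr1 ?ler01.
Qed.

(** On [B e] the index e adds one to both counts, since [B e] implies [C e]. The events can then
    differ only if another neighbour is hit in C, and a hit in B is also one in C. *)
Let hit_diff e i w : S e ->
  `|(B e w && ((hit_count B w == i.+1) && (hit_count C w == i.+1)))%:R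
    - (B e w && ((far_count B e w == i) && (far_count C e w == i)))%:R| <=
  \sum_(f | (S f && adj e f) && (f != e)) (B e w && C f w)%:R :> R.
Proof.
move=> Se; case: (boolP (B e w)) => Be /=; last first.
  by rewrite subrr normr0 sumr_ge0.
rewrite -natr_sum !(hit_countE _ e).
rewrite !(bigD1 (P := fun f => S f && adj e f) e) /= ?Se ?adj_refl // Be (BC Be).
case: (posnP (\sum_(f | S f && adj e f && (f != e)) C f w)) => [z|h].
  have zB : (\sum_(f | S f && adj e f && (f != e)) B f w = 0)%N.
    apply/eqP; rewrite -leqn0 -{2}z; apply: leq_sum => f _.
    by case: (boolP (B f w)) => // /BC ->.
  by rewrite z zB !addn0 !add1n !eqSS subrr normr0.
apply: (@le_trans _ _ 1); last by rewrite ler1n.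
by do 2 case: (_ && _); rewrite ?subrr ?subr0 ?sub0r ?normrN ?normr0 ?normr1 ?ler01.
Qed.

(** Counting the indices e with [B e], on the event that there are i + 1 of them, rewrites the left
    side of the recurrence as a sum over e. *)
Let count_eq i w : (i.+1)%:R * ((hit_count B w == i.+1) && (hit_count C w == i.+1))%:R =
  \sum_(e | S e) (B e w && ((hit_count B w == i.+1) && (hit_count C w == i.+1)))%:R :> R.
Proof.
case: (boolP (_ && _)) => [/andP[/eqP h _]|_] /=.
  by rewrite mulr1 -h /hit_count natr_sum; apply: eq_bigr => e _; rewrite andbT.
by rewrite mulr0 big1 // => e _; rewrite andbF.
Qed.

Let Pr_le_sum (p1 p2 : T -> bool) (Q : pred E) (F : E -> T -> bool) :
  measurable [set w | p1 w] -> measurable [set w | p2 w] ->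
  (forall f, Q f -> measurable [set w | F f w]) ->
  (forall w, `|(p1 w)%:R - (p2 w)%:R| <= \sum_(f | Q f) (F f w)%:R :> R) ->
  `|Pr P [set w | p1 w] - Pr P [set w | p2 w]| <= \sum_(f | Q f) Pr P [set w | F f w].
Proof.
move=> m1 m2 mF h.
have bF f : Q f -> bmeas (fun w => (F f w)%:R : R) by move=> /mF /bmeas_bool.
have -> : \sum_(f | Q f) Pr P [set w | F f w] = Ex P (fun w => \sum_(f | Q f) (F f w)%:R).
  by rewrite Ex_sum //; apply: eq_bigr => f Qf; rewrite Ex_bool //; exact: mF.
rewrite -!Ex_bool // -ExB; [|exact: bmeas_bool..].
have bd : bmeas (fun w => (p1 w)%:R - (p2 w)%:R : R) by apply: bmeasB; exact: bmeas_bool.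
have bS : bmeas (fun w => \sum_(f | Q f) (F f w)%:R : R) by exact: bmeas_sum.
rewrite ler_norml -ExN //; apply/andP; split; apply: le_Ex => //; try exact: bmeasN;
  by move=> w; have := h w; rewrite ler_norml => /andP[].
Qed.

(* Both counts are compared with the far counts, which omit the neighbours of e
   and are independent of B e. *)
Lemma stein_chen i :
  `|i.+1%:R * Pr P [set w | (hit_count B w == i.+1) && (hit_count C w == i.+1)]
    - #|S|%:R * b * Pr P [set w | (hit_count B w == i) && (hit_count C w == i)]|
  <= #|S|%:R * (2 * D%:R * (b * c)).
Proof.
pose h j w := (hit_count B w == j) && (hit_count C w == j).
pose g e j w := (far_count B e w == j) && (far_count C e w == j).
have mh j : measurable [set w | h j w] by exact: measurable_count2.
have mg e j : measurable [set w | g e j w] by exact: measurable_count2.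
have mBh e j : measurable [set w | B e w && h j w] by exact: measurable_set_andb.
have mBg e j : measurable [set w | B e w && g e j w] by exact: measurable_set_andb.
have -> : i.+1%:R * Pr P [set w | h i.+1 w] = \sum_(e | S e) Pr P [set w | B e w && h i.+1 w].
  rewrite -Ex_bool // -ExZ; last exact: bmeas_bool.
  under eq_fun => w do rewrite count_eq.
  rewrite Ex_sum => [|e _]; last exact: (bmeas_bool (mBh e i.+1)).
  by apply: eq_bigr => e _; rewrite (Ex_bool P (mBh e i.+1)).
rewrite -mulrA -[#|S|]sum1_card natr_sum !mulr_suml -sumrB.
apply: le_trans (ler_norm_sum _ _ _) _; apply: ler_sum => e Se; rewrite !mul1r.
have c0 : 0 <= c by rewrite -(PC Se) Pr_ge0.
have h1 : `|Pr P [set w | B e w && h i.+1 w] - Pr P [set w | B e w && g e i w]| <= D%:R * (b * c).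
  apply: le_trans (Pr_le_sum (mBh e _) (mBg e i) _ (fun w => hit_diff i w Se)) _.
    by move=> f _; apply: measurable_set_andb.
  apply: (@le_trans _ _ (\sum_(f | (S f && adj e f) && (f != e)) (b * c))).
    by apply: ler_sum => f /andP[/andP[Sf _] fe]; exact: PBC.
  apply: (@le_trans _ _ (\sum_(f | S f && adj e f) (b * c))).
    rewrite [leRHS](bigID (fun f => f != e)) /= lerDl.
    by apply: sumr_ge0 => *; exact: mulr_ge0.
  rewrite sumr_const -[(b * c) *+ _]mulr_natl ler_wpM2r ?mulr_ge0 // ler_nat.
  exact: adj_card.
have h2 : `|Pr P [set w | g e i w] - Pr P [set w | h i w]| <= D%:R * c.
  apply: le_trans (Pr_le_sum (mg e i) (mh i) (fun f _ => mC f) (far_diff e i)) _.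
  under eq_bigr => f /andP[Sf _] do rewrite PC //.
  rewrite sumr_const -[c *+ _]mulr_natl ler_wpM2r // ler_nat; exact: adj_card.
have h3 := ler_wpM2l b0 h2.
have bn x : b * `|x| = `|b * x| by rewrite normrM (ger0_norm b0).
rewrite bn mulrBr -(indep i Se) in h3.
apply: le_trans (ler_distD (Pr P [set w | B e w && g e i w]) _ _) _.
rewrite (_ : 2 * D%:R * (b * c) = D%:R * (b * c) + b * (D%:R * c)); last by ring.
exact: lerD.
Qed.

End SteinChen.

(** * Counts of large correlations *)

Section CorrelationCounts.
Context {d : measure_display} {T : measurableType d} {R : realType}.
Context (P : probability T R) {n p : nat}.
Variable Z : 'I_p -> {RV P >-> vec R n}.
Hypotheses (sZ : iid_spherical Z) (n2 : (2 < n)%N).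
Implicit Types (e f : 'I_p * 'I_p) (s t : R).

Definition edge : pred ('I_p * 'I_p) := fun ij => (ij.1 < ij.2)%N.

Definition abs_corr e w : R := `|sample_corr (Z e.1 w) (Z e.2 w)|.

Definition exceed t e w := t < abs_corr e w.

Definition corr_count t : T -> nat := hit_count edge (exceed t).

Definition share e f := [|| f.1 == e.1, f.1 == e.2, f.2 == e.1 | f.2 == e.2].

Lemma measurable_abs_corr e : measurable_fun [set: T] (abs_corr e).
Proof. by apply: measurableT_comp => //; exact: measurable_sample_corr. Qed.

Lemma measurable_exceed t e : measurable [set w | exceed t e w].
Proof.
by apply/measurable_set_ltr; [exact: measurable_cst|exact: measurable_abs_corr].
Qed.

Lemma measurable_exceed_others (j : 'I_p) t f : f.1 != j -> f.2 != j ->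
  <<s others_rect Z j >> [set w | exceed t f w].
Proof.
move=> f1 f2.
have : measurable ([set w | exceed t f w] : set (others Z j)); last by [].
apply: measurable_set_ltr; first exact: measurable_cst.
apply: measurableT_comp => //.
have m1 := measurable_others (Z := Z) f1; have m2 := measurable_others (Z := Z) f2.
exact: (measurable_sample_corr (T := others Z j) m1 m2).
Qed.

Lemma corr_tail_prob_eq (i j : 'I_p) t :
  corr_tail_prob (Z i) n2 t = corr_tail_prob (Z j) n2 t.
Proof.
have [_ same sph _] := sZ.
have n0 : (0 < n)%N by case: n n2.
pose y : 'cV[R]_n := delta_mx (Ordinal n0) 0.
have y0 : centered y != 0.
  apply/eqP => /(congr1 (fun x : 'cV[R]_n => x (Ordinal n0) 0)).
  rewrite !mxE !eqxx /mean (bigD1 (Ordinal n0)) //= big1 => [|k k0]; last first.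
    by rewrite mxE (negbTE k0).
  rewrite mxE !eqxx addr0 mul1r => /eqP; rewrite subr_eq0 eq_sym invr_eq1.
  by rewrite (eqr_nat _ n 1); case: n n2 => [|[]].
have mB : measurable [set x : vec R n | t < `|sample_corr x y|].
  apply/measurable_set_ltr; first exact: measurable_cst.
  apply: measurableT_comp => //.
  by apply: measurable_sample_corr => //; exact: measurable_cst.
rewrite -(corr_law (sph i) n2 t y0) -(corr_law (sph j) n2 t y0).
by congr fine; exact: (same i j _ mB).
Qed.

Variable j0 : 'I_p.
Definition exceed_prob t : R := corr_tail_prob (Z j0) n2 t.

Lemma exceed_indep (i j : 'I_p) (E : T -> bool) t : i != j ->
  <<s others_rect Z j >> [set w | E w] ->
  Pr P [set w | exceed t (i, j) w && E w] = exceed_prob t * Pr P [set w | E w].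
Proof.
move=> ij sE; have := corr_others_indep sZ n2 t ij sE.
rewrite (corr_tail_prob_eq j j0) -/(exceed_prob t) => h.
have [indZ _ _ _] := sZ; have [mE _] := others_indep indZ sE measurableT.
apply: EFin_inj; rewrite EFinM muleC (EFin_Pr P mE) -h EFin_Pr; last first.
  by apply: measurable_set_andb => //; exact: measurable_exceed.
congr (P _); apply/seteqP; split => w /=; first by move=> /andP[].
by move=> [-> h']; rewrite andbT.
Qed.

Lemma abs_corrC i j w : abs_corr (i, j) w = abs_corr (j, i) w.
Proof. by rewrite /abs_corr sample_corrC. Qed.

Lemma Pr_exceed e t : edge e -> Pr P [set w | exceed t e w] = exceed_prob t.
Proof.
case: e => i j ij; have inj : i != j by rewrite -val_eqE neq_ltn; apply/orP; left.
have sT : <<s others_rect Z j >> [set w | true].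
  rewrite (_ : [set w | true] = [set: T]); first exact: (@measurableT _ (others Z j)).
  by apply/seteqP; split.
have := exceed_indep (E := fun=> true) t inj sT.
rewrite (_ : [set _ | true] = [set: T]); last by apply/seteqP; split.
rewrite Pr_setT mulr1 => <-.
by congr Pr; apply/seteqP; split => w /=; rewrite andbT.
Qed.

(** Distinct pairs are independent even when they share an index: since both are increasing, some
    endpoint of e is not in f, and the vector there can be resampled without touching f. *)
Lemma Pr_exceed2 e f s t : edge e -> edge f -> f != e ->
  Pr P [set w | exceed s e w && exceed t f w] = exceed_prob s * exceed_prob t.
Proof.
case: e => i j ij ef fe.
have inj : i != j by rewrite -val_eqE neq_ltn; apply/orP; left.
have [/andP[f1 f2]|jf] := boolP ((f.1 != j) && (f.2 != j)).
  rewrite (exceed_indep (E := exceed t f) s inj) ?Pr_exceed //.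
  exact: measurable_exceed_others.
have jin : j != i by rewrite eq_sym.
have [/andP[f1 f2]|if_] := boolP ((f.1 != i) && (f.2 != i)).
  rewrite -(Pr_exceed t ef) -(exceed_indep (E := exceed t f) s jin) //.
    by congr Pr; apply/seteqP; split => w /=; rewrite /exceed abs_corrC.
  exact: measurable_exceed_others.
case/negP: fe; move: f ef jf if_ => [k l]; rewrite /edge /= in ij * => kl.
rewrite !negb_and !negbK => /orP[] /eqP E1 /orP[] /eqP E2; subst.
- by rewrite eqxx in inj.
- by move: ij; rewrite ltnNge ltnW.
- by [].
- by rewrite eqxx in inj.
Qed.

Lemma share_card e : (#|[pred f | edge f && share e f]| <= 4 * p)%N.
Proof.
rewrite -sum1_card.
apply: (@leq_trans (\sum_(f : 'I_p * 'I_p) ((f.1 == e.1) + (f.1 == e.2) + (f.2 == e.1) + (f.2 == e.2)))%N).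
  rewrite big_mkcond; apply: leq_sum => f _; rewrite inE.
  case: ifP => // /andP[_ /or4P[] ->]; rewrite ?addn1 ?add1n ?addnS ?addSn //.
have c1 (a : 'I_p) : (\sum_(f : 'I_p * 'I_p) (f.1 == a) = p)%N.
  rewrite -(pair_bigA _ (fun i j => nat_of_bool (i == a))) /= exchange_big /=.
  rewrite (eq_bigr (fun=> 1%N)) => [|j _]; first by rewrite sum1_card card_ord.
  by rewrite (bigD1 a) //= eqxx big1 // => k /negbTE ->.
have c2 (a : 'I_p) : (\sum_(f : 'I_p * 'I_p) (f.2 == a) = p)%N.
  rewrite -(pair_bigA _ (fun i j => nat_of_bool (j == a))) /=.
  rewrite (eq_bigr (fun=> 1%N)) => [|j _]; first by rewrite sum1_card card_ord.
  by rewrite (bigD1 a) //= eqxx big1 // => k /negbTE ->.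
by rewrite !big_split /= !c1 !c2 !mulSn mul0n addn0 !addnA.
Qed.

Lemma corr_count_stein_chen s t i : t <= s ->
  `|i.+1%:R * Pr P [set w | (corr_count s w == i.+1) && (corr_count t w == i.+1)]
    - #|edge|%:R * exceed_prob s * Pr P [set w | (corr_count s w == i) && (corr_count t w == i)]|
  <= #|edge|%:R * (2 * (4 * p)%:R * (exceed_prob s * exceed_prob t)).
Proof.
move=> ts.
apply: (stein_chen (adj := share)).
- exact: measurable_exceed.
- exact: measurable_exceed.
- by move=> e w; exact: le_lt_trans.
- by move=> e; rewrite /share eqxx.
- by move=> e _; exact: share_card.
- by move=> e ee; exact: Pr_exceed.
- by move=> e f ee ef fe; rewrite Pr_exceed2.
- exact: Pr_ge0.
- move=> [k l] j ee; have kl : k != l by rewrite -val_eqE neq_ltn; apply/orP; left.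
  apply: (exceed_indep (E := fun w => (far_count edge share (exceed s) (k, l) w == j) &&
    (far_count edge share (exceed t) (k, l) w == j)) s kl).
  have mf u : forall f, edge f && ~~ share (k, l) f -> <<s others_rect Z l >> [set w | exceed u f w].
    move=> f /andP[_]; rewrite /share /= !negb_or => /and4P[_ f1 _ f2].
    exact: measurable_exceed_others.
  have := @measurable_set_andb _ (others Z l)
    (fun w => far_count edge share (exceed s) (k, l) w == j)
    (fun w => far_count edge share (exceed t) (k, l) w == j).
  by apply; apply: (measurable_count (R := R)); exact: mf.
Qed.

Lemma Ex_corr_count t : Ex P (fun w => (corr_count t w)%:R) = #|edge|%:R * exceed_prob t.
Proof.
under eq_fun => w do rewrite /corr_count /hit_count natr_sum.
rewrite Ex_sum => [|e _]; last exact/bmeas_bool/measurable_exceed.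
rewrite (eq_bigr (fun=> exceed_prob t)) => [|e ee]; last first.
  by rewrite Ex_bool ?Pr_exceed //; exact: measurable_exceed.
by rewrite sumr_const -[_ *+ _]mulr_natl.
Qed.

Lemma measurable_corr_count t i : measurable [set w | corr_count t w == i].
Proof. by apply: (measurable_count (R := R)) => e _; exact: measurable_exceed. Qed.

End CorrelationCounts.

(** * Asymptotics of the levels *)

Section PowerLimits.
Context {R : realType}.
Implicit Types x : R.

Lemma expR_le_onem x : 0 <= x <= 2^-1 -> expR (- (2 * x)) <= 1 - x.
Proof.
move=> /andP[x0 x1].
have h : 1 + 2 * x <= expR (2 * x) by exact: expR_ge1Dx.
rewrite expRN -[leRHS]invrK lef_pV2 ?posrE ?expR_gt0 ?invr_gt0 //; last by lra.
apply: le_trans h; rewrite -[leLHS]mul1r ler_pdivrMr; last by lra.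
nra.
Qed.

Lemma onem_le_expR x : 1 - x <= expR (- x).
Proof. exact: expR_ge1Dx. Qed.

Lemma ln_bounds x : 0 < 1 + x -> x / (1 + x) <= ln (1 + x) <= x.
Proof.
move=> x1; apply/andP; split; last by apply: le_ln1Dx; lra.
have e : 1 + - (x / (1 + x)) = (1 + x)^-1 by field; rewrite gt_eqF.
have : ln (1 + - (x / (1 + x))) <= - (x / (1 + x)).
  apply: le_ln1Dx; have : 0 < 1 + - (x / (1 + x)) by rewrite e invr_gt0.
  lra.
by rewrite e lnV ?posrE // lerN2.
Qed.

Lemma cvg_exprn_expR (x : nat -> R) (N : nat -> nat) (L : R) :
  x n @[n --> \oo] --> 0 -> (N n)%:R * x n @[n --> \oo] --> L ->
  (1 + x n) ^+ N n @[n --> \oo] --> expR L.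
Proof.
move=> x0 xL.
have pos : \forall n \near \oo, 0 < 1 + x n.
  have : 1 + x n @[n --> \oo] --> (1 + 0 : R) by apply: cvgD => //; exact: cvg_cst.
  by rewrite addr0 => /cvgr_gt; apply; exact: ltr01.
have lnL : (N n)%:R * ln (1 + x n) @[n --> \oo] --> L.
  apply: (squeeze_cvgr (f := fun n => (N n)%:R * x n / (1 + x n)) (h := fun n => (N n)%:R * x n)) => //.
    near=> n; have p : 0 < 1 + x n by near: n.
    have /andP[h1 h2] := ln_bounds p.
    by rewrite -mulrA !ler_wpM2l.
  rewrite -[L in _ --> L]mulr1 -[1 in X in _ --> X]invr1.
  apply: cvgM => //; apply: cvgV; first exact: oner_neq0.
  by rewrite -[X in _ --> X]addr0; apply: cvgD => //; exact: cvg_cst.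
have : expR ((N n)%:R * ln (1 + x n)) @[n --> \oo] --> expR L.
  by apply: (cvg_comp _ _ lnL); exact: continuous_expR.
apply: cvg_trans; apply: near_eq_cvg; near=> n.
by rewrite expRM_natl lnK // posrE; near: n.
Unshelve. all: by end_near. Qed.

End PowerLimits.

(** * The implicit level v and the mean counts around it *)

Section LevelAsymptotics.
Context {R : realType}.
Variables (m h : nat -> R) (tau : nat -> R -> R).

(* The tail of sqrt n |S_ij| at u is equivalent to level_envelope n u / u. *)
Definition level_envelope n (u : R) : R := h n * Num.sqrt ((1 - u ^+ 2 / n%:R) ^+ n.-2).
Local Notation G := level_envelope.

(** The equation says that m G(v) / v, the approximate mean count at v, is 1. A root exists because
    m G(u) - u is positive at 0 and, as n - 2 > 0, equals - u at sqrt n. *)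
Lemma level_exists n : (2 < n)%N -> 0 < m n -> 0 < h n ->
  exists v, [/\ 0 < v, v < Num.sqrt n%:R & v = m n * G n v].
Proof.
move=> n2 m0 h0; pose s := Num.sqrt (n%:R : R).
have nn0 : 0 < n%:R :> R by rewrite ltr0n (leq_trans _ n2).
have s0 : 0 < s by rewrite sqrtr_gt0.
pose f u := m n * G n u - u.
have f0 : f 0 = m n * h n.
  by rewrite /f /level_envelope expr0n mul0r !subr0 expr1n sqrtr1 mulr1.
have fs : f s = - s.
  rewrite /f /level_envelope sqr_sqrtr ?ltW // divff ?gt_eqF // subrr.
  have /negbTE n20 : n.-2 != 0%N by rewrite -lt0n -subn2 subn_gt0.
  by rewrite expr0n n20 sqrtr0 !mulr0 add0r.
have cf : {within `[0, s], continuous f}.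
  apply: continuous_subspaceT => u; apply: cvgB; last exact: cvg_id.
  apply: cvgMl_tmp; apply: cvgMl_tmp.
  apply: (@cvg_comp _ _ _ (fun u : R => (1 - u ^+ 2 / n%:R) ^+ n.-2) Num.sqrt); last exact: sqrt_continuous.
  apply: (@cvg_comp _ _ _ (fun u : R => 1 - u ^+ 2 / n%:R) (fun y => y ^+ n.-2)); last exact: exprn_continuous.
  apply: cvgB; first exact: cvg_cst.
  by apply: cvgMr_tmp; exact: exprn_continuous.
have mh : 0 < m n * h n by exact: mulr_gt0.
have [|v] := IVT (ltW s0) cf (v := 0).
  rewrite f0 fs min_r; last by lra.
  by rewrite max_l; lra.
rewrite in_itv /= => /andP[v0 vs] fv; exists v; split.
- by rewrite lt_def v0 andbT; apply/eqP => vE; move: fv; rewrite vE f0; lra.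
- by rewrite lt_def vs andbT; apply/eqP => vE; move: fv; rewrite -vE fs; lra.
- by move: fv => /eqP; rewrite subr_eq0 => /eqP.
Qed.

Variable v : nat -> R.
Hypothesis v_level : \forall n \near \oo,
  [/\ 0 < v n, v n < Num.sqrt n%:R & v n = m n * G n (v n)].
Hypothesis h_bounds : \forall n \near \oo, 2^-1 <= h n <= 2.
Hypothesis m_infty : m n @[n --> \oo] --> +oo.
Hypothesis m_ln : ln (m n) / n%:R @[n --> \oo] --> 0.

Let Q n u : R := (1 - u ^+ 2 / n%:R) ^+ n.-2.

Let n_inv : (n%:R^-1 : R) @[n --> \oo] --> (0 : R).
Proof.
apply/gtr0_cvgV0; last exact: cvgr_idn.
by near=> n; rewrite ltr0n; near: n; exists 1%N.
Unshelve. all: by end_near. Qed.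

Let frac01 n : 0 < v n -> v n < Num.sqrt n%:R -> (0 < n)%N -> 0 < v n ^+ 2 / n%:R < 1.
Proof.
move=> v0 vn n0; have nn0 : 0 < n%:R :> R by rewrite ltr0n.
rewrite divr_gt0 ?exprn_gt0 //= ltr_pdivrMr // mul1r.
by rewrite -(sqr_sqrtr (ltW nn0)) ltr_pXn2r // nnegrE ?ltW // sqrtr_gt0.
Qed.

Let v_sqr n : 0 <= Q n (v n) -> v n = m n * G n (v n) ->
  v n ^+ 2 = m n ^+ 2 * h n ^+ 2 * Q n (v n).
Proof. by move=> Q0 E; rewrite {1}E !exprMn sqr_sqrtr // mulrA. Qed.

Let Q_ge0 n : 0 < v n ^+ 2 / n%:R < 1 -> 0 <= Q n (v n).
Proof. by move=> /andP[x0 x1]; rewrite exprn_ge0 // subr_ge0 ltW. Qed.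

Let le3 n : (2 < n)%N -> (n <= 3 * n.-2)%N.
Proof. by case: n => [|[|[|n]]] //= _; rewrite mulnS; apply: (@leq_add 3 n 3 (3 * n)%N) => //; exact: leq_pmull. Qed.

(** With x = v^2 / n and v > 1, the equation gives 1 <= (2 m)^2 exp(- (n - 2) x), hence x = O((1 +
    ln m) / n): here log p / n -> 0 enters. The constant 6 comes from n <= 3 (n - 2). If v <= 1,
    then x <= 1 / n. *)
Lemma level_small : v n ^+ 2 / n%:R @[n --> \oo] --> (0 : R).
Proof.
apply: (cvg_dist_squeeze (b := fun n => n%:R^-1 + 6 * (ln 2 * n%:R^-1 + ln (m n) / n%:R))); last first.
  rewrite -[X in _ --> X](_ : 0 + 6 * (ln 2 * 0 + 0) = 0); last by rewrite !(mulr0, addr0).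
  apply: cvgD => //; apply: cvgMl_tmp; apply: cvgD => //; exact: cvgMl_tmp.
near=> n.
have n3 : (3 <= n)%N by near: n; exists 3%N.
have [v0 vn vE] : [/\ 0 < v n, v n < Num.sqrt n%:R & v n = m n * G n (v n)] by near: n.
have m1 : 1 <= m n by near: n; move/cvgryPge : m_infty => /(_ 1).
have /andP[h1 h2] : 2^-1 <= h n <= 2 by near: n.
have n0 : 0 < n%:R :> R by rewrite ltr0n (leq_trans _ n3).
have x01 := frac01 v0 vn (leq_trans (isT : (0 < 3)%N) n3).
have vQ := v_sqr (Q_ge0 x01) vE.
have lnm : 0 <= ln (m n) by rewrite ln_ge0.
have ln2 : 0 <= ln (2 : R) by rewrite ln_ge0 // ler1n.
rewrite subr0 ger0_norm; last by have /andP[/ltW] := x01.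
have [v1|v1] := leP (v n) 1.
  apply: (@le_trans _ _ n%:R^-1).
    by rewrite ler_pdivrMr // mulVf ?gt_eqF // expr_le1 // ltW.
  rewrite lerDl mulr_ge0 // addr_ge0 // mulr_ge0 // ?invr_ge0 ?ltW //.
set x := v n ^+ 2 / n%:R in x01 *.
have QE : Q n (v n) <= expR (- (n.-2%:R * x)).
  rewrite -mulrN expRM_natl /Q -/x.
  by apply: lerXn2r; rewrite ?nnegrE ?expR_ge0 ?onem_le_expR // subr_ge0; have /andP[_ /ltW] := x01.
have e1 : 1 <= (2 * m n) ^+ 2 * expR (- (n.-2%:R * x)).
  apply: (@le_trans _ _ (v n ^+ 2)); first by rewrite exprn_ege1 // ltW.
  rewrite vQ; apply: ler_pM => //; rewrite ?Q_ge0 //.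
    by rewrite mulr_ge0 // sqr_ge0.
  rewrite exprMn mulrC ler_wpM2r ?sqr_ge0 //.
  by rewrite lerXn2r // nnegrE ?(le_trans _ h1) // invr_ge0.
have e2 : n.-2%:R * x <= 2 * (ln 2 + ln (m n)).
  rewrite -lnM ?posrE // ?(lt_le_trans _ m1) //.
  have -> : 2 * ln (2 * m n) = ln ((2 * m n) ^+ 2).
    have mm : 0 < 2 * m n by rewrite mulr_gt0 // (lt_le_trans _ m1).
    by rewrite lnXn // mulr_natl.
  rewrite -[leLHS]expRK ler_ln ?posrE ?expR_gt0 //; last first.
    by rewrite exprn_gt0 // mulr_gt0 // (lt_le_trans _ m1).
  by move: e1; rewrite expRN -/(_ / _) ler_pdivlMr ?expR_gt0 // mul1r.
have x0 : 0 <= x by have /andP[/ltW] := x01.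
have nE : n%:R <= 3 * n.-2%:R :> R.
  by rewrite -natrM ler_nat le3.
have e3 : n%:R * x <= 6 * (ln 2 + ln (m n)).
  by have := ler_wpM2r x0 nE; lra.
have : x <= 6 * (ln 2 + ln (m n)) / n%:R by rewrite ler_pdivlMr // mulrC.
have ni : 0 <= (n%:R : R)^-1 by rewrite invr_ge0 ltW.
lra.
Unshelve. all: by end_near. Qed.

(** If v < K, then (1 - v^2 / n)^(n - 2) >= exp(- 2 K^2) and v^2 >= (m / 2)^2 exp(- 2 K^2), which is
    at least K^2 as soon as m >= 2 K exp(K^2). *)
Lemma level_infty : v n @[n --> \oo] --> +oo.
Proof.
apply/cvgryPge => A; set K := `|A| + 1.
have K0 : 0 < K by rewrite ltr_wpDl.
have x_half : \forall n \near \oo, v n ^+ 2 / n%:R < 2^-1.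
  by move: level_small => /cvgr_lt; apply; rewrite invr_gt0.
near=> n.
have n3 : (3 <= n)%N by near: n; exists 3%N.
have [v0 vn vE] : [/\ 0 < v n, v n < Num.sqrt n%:R & v n = m n * G n (v n)] by near: n.
have mK : 2 * K * expR (K ^+ 2) <= m n.
  by near: n; move/cvgryPge : m_infty; exact.
have /andP[h1 h2] : 2^-1 <= h n <= 2 by near: n.
have n0 : 0 < n%:R :> R by rewrite ltr0n (leq_trans _ n3).
have x01 := frac01 v0 vn (leq_trans (isT : (0 < 3)%N) n3).
have vQ := v_sqr (Q_ge0 x01) vE.
have xh : v n ^+ 2 / n%:R <= 2^-1 by apply: ltW; near: n.
apply: (@le_trans _ _ K); first by rewrite (le_trans (ler_norm A)) // lerDl.
rewrite leNgt; apply/negP => vK.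
set x := v n ^+ 2 / n%:R in x01 xh.
have x0 : 0 <= x by have /andP[/ltW] := x01.
have QE : expR (- (2 * v n ^+ 2)) <= Q n (v n).
  apply: (@le_trans _ _ (expR (- (2 * x)) ^+ n.-2)).
    rewrite -expRM_natl ler_expR mulrN lerN2.
    have -> : v n ^+ 2 = n%:R * x by rewrite mulrC divfK // gt_eqF.
    have : n.-2%:R * x <= n%:R * x by rewrite ler_wpM2r // ler_nat (leq_trans (leq_pred _)) // leq_pred.
    lra.
  rewrite /Q -/x.
  by rewrite lerXn2r ?nnegrE ?expR_ge0 ?expR_le_onem ?x0 //; lra.
have m0 : 0 < m n by apply: lt_le_trans mK; rewrite !mulr_gt0 // expR_gt0.
have e1 : m n ^+ 2 / 4 * expR (- (2 * v n ^+ 2)) <= v n ^+ 2.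
  rewrite [leRHS]vQ; apply: ler_pM; rewrite ?expR_ge0 ?divr_ge0 ?sqr_ge0 //.
  rewrite ler_wpM2l ?sqr_ge0 //.
  have : (2^-1) ^+ 2 <= h n ^+ 2 by rewrite lerXn2r // nnegrE ?(le_trans _ h1) // invr_ge0.
  by move=> h'; apply: le_trans h'; rewrite exprVn -natrX.
have v2K : v n ^+ 2 < K ^+ 2 by rewrite ltr_pXn2r // nnegrE ltW.
have e2 : expR (- (2 * K ^+ 2)) <= expR (- (2 * v n ^+ 2)) by rewrite ler_expR; lra.
have e3 : m n ^+ 2 / 4 * expR (- (2 * K ^+ 2)) < K ^+ 2.
  apply: le_lt_trans v2K; apply: le_trans e1; rewrite ler_wpM2l // mulr_ge0 ?sqr_ge0 //.
have : (2 * K * expR (K ^+ 2)) ^+ 2 <= m n ^+ 2.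
  by rewrite lerXn2r // nnegrE ?ltW // !mulr_gt0 // expR_gt0.
have -> : (2 * K * expR (K ^+ 2)) ^+ 2 = 4 * K ^+ 2 * expR (2 * K ^+ 2).
  by rewrite !exprMn -expRM_natl -natrX.
rewrite -ler_pdivlMr ?expR_gt0 // -expRN; lra.
Unshelve. all: by end_near. Qed.

(** The inverse of W = exp(v (v - X)): for v > 0, W < a exactly when X > v - ln a / v. *)
Definition level n (a : R) : R := v n - ln a / v n.

Let vV : (v n)^-1 @[n --> \oo] --> 0.
Proof.
apply/gtr0_cvgV0; last exact: level_infty.
by near=> n; have [] : [/\ 0 < v n, v n < Num.sqrt n%:R & v n = m n * G n (v n)] by near: n.
Unshelve. all: by end_near. Qed.

Lemma level_ratio a : level n a / v n @[n --> \oo] --> (1 : R).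
Proof.
have : 1 - ln a * ((v n)^-1 * (v n)^-1) @[n --> \oo] --> (1 - ln a * (0 * 0) : R).
  by apply: cvgB; [exact: cvg_cst|apply: cvgMl_tmp; exact: cvgM].
rewrite mul0r mulr0 subr0; apply: cvg_trans; apply: near_eq_cvg; near=> n.
have [v0 _ _] : [/\ 0 < v n, v n < Num.sqrt n%:R & v n = m n * G n (v n)] by near: n.
by rewrite /level; field; rewrite gt_eqF.
Unshelve. all: by end_near. Qed.

(** 1 + xs is the ratio of 1 - (level n a)^2 / n to 1 - v^2 / n. Since n xs tends to 2 ln a, the
    ratio [rt] of the envelopes tends to a. *)
Let xs a n : R := (2 * ln a - (ln a) ^+ 2 * ((v n)^-1 * (v n)^-1)) * (n%:R^-1 / (1 - v n ^+ 2 / n%:R)).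

Let xs0 a : xs a n @[n --> \oo] --> 0.
Proof.
rewrite -[X in _ --> X](_ : (2 * ln a - ln a ^+ 2 * (0 * 0)) * (0 / (1 - 0)) = 0); last by rewrite !(mul0r, mulr0).
apply: cvgM.
  by apply: cvgB; [exact: cvg_cst|apply: cvgMl_tmp; exact: cvgM].
apply: cvgM => //; apply: cvgV; first by rewrite subr0 oner_neq0.
by apply: cvgB; [exact: cvg_cst|exact: level_small].
Qed.

Let xsN a : n.-2%:R * xs a n @[n --> \oo] --> 2 * ln a.
Proof.
have : (2 * ln a - (ln a) ^+ 2 * ((v n)^-1 * (v n)^-1)) *
   ((1 - 2 * n%:R^-1) / (1 - v n ^+ 2 / n%:R)) @[n --> \oo] -->
   ((2 * ln a - ln a ^+ 2 * (0 * 0)) * ((1 - 2 * 0) / (1 - 0))).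
  apply: cvgM.
    by apply: cvgB; [exact: cvg_cst|apply: cvgMl_tmp; exact: cvgM].
  apply: cvgM; first by apply: cvgB; [exact: cvg_cst|exact: cvgMl_tmp].
  apply: cvgV; first by rewrite subr0 oner_neq0.
  by apply: cvgB; [exact: cvg_cst|exact: level_small].
rewrite !mulr0 !subr0 divr1 mulr1; apply: cvg_trans; apply: near_eq_cvg; near=> n.
have n3 : (3 <= n)%N by near: n; exists 3%N.
have n0 : n%:R != 0 :> R by rewrite pnatr_eq0 -lt0n (leq_trans _ n3).
rewrite /xs; have -> : n.-2%:R = n%:R - 2 :> R.
  by rewrite -subn2 natrB // (leq_trans _ n3).
set y := 2 * ln a - _; set z := (1 - _ / _)^-1.
by field.
Unshelve. all: by end_near. Qed.

Let rt a n : R := Num.sqrt ((1 + xs a n) ^+ n.-2).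

Let rt_cvg a : 0 < a -> rt a n @[n --> \oo] --> a.
Proof.
move=> a0; have E : a = Num.sqrt (expR (2 * ln a)).
  by rewrite expRM_natl lnK ?posrE // sqrtr_sqr gtr0_norm.
rewrite {2}E; apply: (@cvg_comp _ _ _ (fun n => (1 + xs a n) ^+ n.-2) Num.sqrt); last exact: sqrt_continuous.
apply: cvg_exprn_expR; [exact: xs0|exact: xsN].
Qed.

Let rt_spec a : \forall n \near \oo, G n (level n a) = G n (v n) * rt a n.
Proof.
near=> n.
have n3 : (3 <= n)%N by near: n; exists 3%N.
have [v0 vn vE] : [/\ 0 < v n, v n < Num.sqrt n%:R & v n = m n * G n (v n)] by near: n.
have n0 : n%:R != 0 :> R by rewrite pnatr_eq0 -lt0n (leq_trans _ n3).
have /andP[_ x1] := frac01 v0 vn (leq_trans (isT : (0 < 3)%N) n3).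
have x1' : 1 - v n ^+ 2 / n%:R != 0 by rewrite gt_eqF // subr_gt0.
rewrite /level_envelope /rt -mulrA -sqrtrM; last by rewrite exprn_ge0 // subr_ge0 ltW.
rewrite -exprMn; congr (_ * Num.sqrt (_ ^+ _)).
have x1'' : n%:R - v n ^+ 2 != 0.
  by apply: contraNN x1' => /eqP e; rewrite -[X in _ == X](mul0r n%:R^-1) -e mulrBl divff.
by rewrite /xs /level; field; rewrite n0 x1'' gt_eqF.
Unshelve. all: by end_near. Qed.

Hypothesis tau_bounds : \forall n \near \oo, forall x y,
  0 < x -> x < y -> y < Num.sqrt n%:R ->
  x * tau n x <= G n x /\ G n x - G n y <= y * tau n x.

Let level_pos a : \forall n \near \oo, 0 < level n a.
Proof.
have := level_ratio a => /cvgr_gt /(_ 0 ltr01) pos.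
near=> n.
have [v0 _ _] : [/\ 0 < v n, v n < Num.sqrt n%:R & v n = m n * G n (v n)] by near: n.
have : 0 < level n a / v n by near: n.
by rewrite pmulr_lgt0 // invr_gt0.
Unshelve. all: by end_near. Qed.

Let level_lt a : \forall n \near \oo, level n a < Num.sqrt n%:R.
Proof.
have h1 : \forall n \near \oo, level n a / v n < 2.
  by have := level_ratio a => /cvgr_lt; apply; exact: ltr1n.
have h2 : \forall n \near \oo, v n ^+ 2 / n%:R < 4^-1.
  by move: level_small => /cvgr_lt; apply; rewrite invr_gt0.
near=> n.
have n3 : (3 <= n)%N by near: n; exists 3%N.
have n0 : 0 < n%:R :> R by rewrite ltr0n (leq_trans _ n3).
have [v0 _ _] : [/\ 0 < v n, v n < Num.sqrt n%:R & v n = m n * G n (v n)] by near: n.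
have : level n a / v n < 2 by near: n.
rewrite ltr_pdivrMr // => e1; apply: lt_le_trans e1 _.
have : v n ^+ 2 / n%:R < 4^-1 by near: n.
rewrite ltr_pdivrMr // => e2.
rewrite -(@ler_pXn2r _ 2) ?nnegrE ?sqrtr_ge0 ?mulr_ge0 ?ltW //.
by rewrite exprMn sqr_sqrtr ?ltW // -natrX; lra.
Unshelve. all: by end_near. Qed.

(** All levels are equivalent to v, so the upper tail bound at level a tends to a, and the lower
    one, with its second point at level b < a, tends to a - b. As b is arbitrary, the two meet. *)
Lemma level_tail a : 0 < a -> m n * tau n (level n a) @[n --> \oo] --> a.
Proof.
move=> a0.
have vl c : v n / level n c @[n --> \oo] --> (1 : R).
  have : (level n c / v n)^-1 @[n --> \oo] --> (1^-1 : R).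
    by apply: cvgV; [exact: oner_neq0|exact: level_ratio].
  by rewrite invr1; under eq_fun => n do rewrite invfM invrK mulrC.
have up : rt a n * (v n / level n a) @[n --> \oo] --> a.
  by rewrite -[X in _ --> X]mulr1; apply: cvgM => //; exact: rt_cvg.
have lo b : 0 < b -> (rt a n - rt b n) * (v n / level n b) @[n --> \oo] --> a - b.
  by move=> b0; rewrite -[X in _ --> X]mulr1; apply: cvgM => //; apply: cvgB; exact: rt_cvg.
apply/cvgrPdist_le => e e0.
pose b := Num.min (a / 2) (e / 2).
have b0 : 0 < b by rewrite lt_min !divr_gt0.
have ba : b < a by rewrite gt_min; apply/orP; left; lra.
have be : b <= e / 2 by rewrite ge_min lexx orbT.
move/cvgrPdist_le : up => /(_ e e0) up.
move/cvgrPdist_le : (lo b b0) => /(_ (e / 2)) lo'.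
have e2 : 0 < e / 2 by rewrite divr_gt0.
move: (lo' e2) => {}lo'.
near=> n.
have [v0 vn vE] : [/\ 0 < v n, v n < Num.sqrt n%:R & v n = m n * G n (v n)] by near: n.
have la : 0 < level n a by near: n; exact: level_pos.
have lb : level n b < Num.sqrt n%:R by near: n; exact: level_lt.
have lab : level n a < level n b.
  by rewrite /level ltrD2l ltrN2 ltr_pM2r ?invr_gt0 // ltr_ln.
have Ga : G n (level n a) = G n (v n) * rt a n by near: n; exact: rt_spec.
have Gb : G n (level n b) = G n (v n) * rt b n by near: n; exact: rt_spec.
have m0 : 0 < m n by near: n; move/cvgryPgt : m_infty => /(_ 0).
have [t1 t2] : level n a * tau n (level n a) <= G n (level n a) /\
    G n (level n a) - G n (level n b) <= level n b * tau n (level n a).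
  have H : forall x y, 0 < x -> x < y -> y < Num.sqrt n%:R ->
    x * tau n x <= G n x /\ G n x - G n y <= y * tau n x by near: n.
  exact: H.
have lb0 : 0 < level n b by exact: lt_trans lab.
have u1 : m n * tau n (level n a) <= rt a n * (v n / level n a).
  rewrite mulrA ler_pdivlMr // mulrAC -mulrA (mulrC _ (v n)) {1}vE -mulrA.
  by rewrite ler_pM2l // -Ga.
have u2 : (rt a n - rt b n) * (v n / level n b) <= m n * tau n (level n a).
  rewrite mulrA ler_pdivrMr // (mulrC _ (v n)) {1}vE -mulrA -[leRHS]mulrA.
  by rewrite ler_pM2l // mulrBr -Ga -Gb [leRHS]mulrC.
have u3 : `|a - rt a n * (v n / level n a)| <= e by near: n.
have u4 : `|a - b - (rt a n - rt b n) * (v n / level n b)| <= e / 2 by near: n.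
move: u3 u4; rewrite !ler_norml => /andP[u3 _] /andP[_ u4].
by apply/andP; split; lra.
Unshelve. all: by end_near. Qed.

End LevelAsymptotics.

(** * Poisson limit of the counts *)

Section PoissonRecurrence.
Context {R : realType}.
Variables (x : nat -> nat -> R) (mu : nat -> R) (b : R).
Hypothesis x01 : forall i n, 0 <= x i n <= 1.
Hypothesis mu_b : mu n @[n --> \oo] --> b.
Hypothesis x_rec : forall i,
  i.+1%:R * x i.+1 n - mu n * x i n @[n --> \oo] --> (0 : R).

Let cvg_mul01 (u : nat -> R) i : u n @[n --> \oo] --> (0 : R) ->
  u n * x i n @[n --> \oo] --> (0 : R).
Proof.
move=> u0; apply: (cvg_dist_squeeze (b := fun n => `|u n|)).
  near=> n; have /andP[h0 h1] := x01 i n.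
  by rewrite subr0 normrM ler_piMr // ger0_norm.
by rewrite -(normr0 R); exact: cvg_norm.
Unshelve. all: by end_near. Qed.

Lemma poisson_recurrence i :
  x i n - x 0 n * (b ^+ i / i`!%:R) @[n --> \oo] --> (0 : R).
Proof.
elim: i => [|i IH].
  under eq_fun => n do rewrite expr0 fact0 divr1 mulr1 subrr.
  exact: cvg_cst.
have mub : mu n - b @[n --> \oo] --> (0 : R).
  by rewrite -[X in _ --> X](subrr b); apply: cvgB => //; exact: cvg_cst.
have h : i.+1%:R^-1 * (i.+1%:R * x i.+1 n - mu n * x i n + (mu n - b) * x i n +
    b * (x i n - x 0 n * (b ^+ i / i`!%:R))) @[n --> \oo] --> (0 : R).
  rewrite -[X in _ --> X](_ : i.+1%:R^-1 * (0 + 0 + b * 0) = 0); last by rewrite !(mulr0, addr0).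
  apply: cvgMl_tmp; apply: cvgD; last exact: cvgMl_tmp.
  by apply: cvgD => //; exact: cvg_mul01.
apply: cvg_trans h; apply: near_eq_cvg; near=> n.
have i0 : i.+1%:R != 0 :> R by rewrite pnatr_eq0.
have f0 : i`!%:R != 0 :> R by rewrite pnatr_eq0 -lt0n fact_gt0.
rewrite factS natrM exprS; field.
by rewrite f0 addrC natr1 i0.
Unshelve. all: by end_near. Qed.

Hypothesis x_sum : forall n J, (0 < J)%N -> 1 - mu n / J%:R <= \sum_(i < J) x i n <= 1.

(** The recurrence fixes the x i only up to the factor x 0. The bound [x_sum], to be supplied by
    Markov's inequality, prevents loss of mass, so that exp(b) x 0 tends to 1. *)
Lemma poisson_recurrence0 : x 0 n @[n --> \oo] --> expR (- b).
Proof.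
pose S J : R := \sum_(i < J) (b ^+ i / i`!%:R).
have SE : S J @[J --> \oo] --> expR b.
  have := is_cvg_series_exp_coeff b; rewrite /expR.
  have -> : S = series (exp_coeff b).
    by apply/funext => J; rewrite /S /series /= big_mkord; apply: eq_bigr => i _.
  by [].
have h : expR b * x 0 n @[n --> \oo] --> (1 : R).
  apply/cvgrPdist_le => e e0.
  have e4 : 0 < e / 4 by rewrite divr_gt0.
  have [J [J0 JS Jb]] : exists J, [/\ (0 < J)%N, `|expR b - S J| <= e / 4 & (`|b| + 1) / J%:R <= e / 4].
    near \oo => J; exists J; split; first by near: J; exists 1%N.
      by near: J; move/cvgrPdist_le : SE; exact.
    have J0 : 0 < J%:R :> R by rewrite ltr0n; near: J; exists 1%N.
    rewrite ler_pdivrMr // mulrC -ler_pdivrMr //; near: J.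
    by move/cvgryPge : (@cvgr_idn R); exact.
  have d : S J * x 0 n - \sum_(i < J) x i n @[n --> \oo] --> (0 : R).
    rewrite -[X in _ --> X](_ : \sum_(i < J) (- 0) = 0 :> R); last by rewrite oppr0 big1.
    under eq_fun => n do rewrite /S mulr_suml -sumrB.
    apply: (cvg_sum (FF := eventually_filter)) => i.
    under eq_fun => n do rewrite mulrC -opprB.
    by apply: cvgN; exact: poisson_recurrence.
  move/cvgrPdist_le : d => /(_ _ e4) d.
  have mub : \forall n \near \oo, mu n <= `|b| + 1.
    move/cvgrPdist_le : mu_b => /(_ 1 ltr01); apply: filterS => n.
    by rewrite ler_norml => /andP[h _]; have := ler_norm b; lra.
  near=> n.
  have /andP[x0 x1] := x01 0 n; have /andP[s0 s1] := x_sum n J0.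
  have d1 : `|0 - (S J * x 0 n - \sum_(i < J) x i n)| <= e / 4 by near: n.
  have m1 : mu n / J%:R <= e / 4.
    by apply: le_trans Jb; rewrite ler_wpM2r ?invr_ge0 //; near: n.
  have d2 : `|(expR b - S J) * x 0 n| <= e / 4.
    by rewrite normrM (ger0_norm x0); apply: le_trans JS; rewrite ler_piMr.
  move: d1 d2; rewrite !ler_norml => /andP[? ?] /andP[? ?].
  by apply/andP; split; lra.
have : expR (- b) * (expR b * x 0 n) @[n --> \oo] --> expR (- b) * 1 by exact: cvgMl_tmp.
rewrite mulr1; under eq_fun => n do rewrite mulrA -expRD addrC subrr expR0 mul1r.
by [].
Unshelve. all: by end_near. Qed.

End PoissonRecurrence.

Lemma card_edge p : (2 * #|@edge p| + p = p * p)%N.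
Proof.
have E1 : #|@edge p| = (\sum_(i < p) \sum_(j < p) (i < j))%N.
  by rewrite -sum1_card big_mkcond pair_bigA; apply: eq_bigr => -[i j] _ /=; rewrite unfold_in /edge /=; case: ltnP.
have E2 : #|@edge p| = (\sum_(i < p) \sum_(j < p) (j < i))%N by rewrite E1 exchange_big.
rewrite mul2n -addnn {1}E1 E2 -big_split /=.
rewrite -[X in (_ + X)%N]card_ord -sum1_card -big_split /=.
rewrite -[X in _ = (X * _)%N]card_ord -sum_nat_const; apply: eq_bigr => i _.
rewrite -big_split /= -[RHS]card_ord -sum1_card (bigD1 i) //= ltnn [RHS](bigD1 i) //= addnC; congr addn.
by apply: eq_bigr => j ji; rewrite -val_eqE /= in ji; case: ltngtP ji.
Qed.

Section CountMoments.
Context {d : measure_display} {T : measurableType d} {R : realType}.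
Context (P : probability T R) {n p : nat}.
Variable Z : 'I_p -> {RV P >-> vec R n}.
Implicit Types s t : R.
Local Notation N := (corr_count Z).

Definition mean_count t : R := Ex P (fun w => (N t w)%:R).

Lemma corr_count_nincr s t w : t <= s -> (N s w <= N t w)%N.
Proof.
move=> ts; apply: leq_sum => e _; rewrite /exceed.
by case: ltP => // h; rewrite (le_lt_trans ts h).
Qed.

Lemma bmeas_corr_count t : bmeas (fun w => (N t w)%:R : R).
Proof.
under eq_fun => w do rewrite /corr_count /hit_count natr_sum.
by apply: bmeas_sum => e _; exact/bmeas_bool/measurable_exceed.
Qed.

Lemma measurable_corr_count_lt t k : measurable [set w | (N t w < k)%N].
Proof.
have -> : [set w | (N t w < k)%N] = [set w | (N t w)%:R < k%:R :> R].
  by apply/seteqP; split => w /=; rewrite ltr_nat.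
by apply: measurable_set_ltr; [exact: (bmeas_corr_count t).1|exact: measurable_cst].
Qed.

Lemma Pr_corr_count_lt t k :
  Pr P [set w | (N t w < k)%N] = \sum_(i < k) Pr P [set w | N t w == i].
Proof.
rewrite -Ex_bool; last exact: measurable_corr_count_lt.
under [RHS]eq_bigr => i _ do rewrite -(Ex_bool P (measurable_corr_count Z t i)).
rewrite -Ex_sum; last by move=> i _; exact/bmeas_bool/measurable_corr_count.
congr (Ex P _); apply/funext => w; case: ltnP => h.
  rewrite (bigD1 (Ordinal h)) //= eqxx big1 ?addr0 // => i ih.
  by case: eqP => // E; move: ih; rewrite -val_eqE /= -E eqxx.
by rewrite big1 // => i _; case: eqP => // E; move: h; rewrite E leqNgt ltn_ord.
Qed.

Lemma mean_count_markov t J : (0 < J)%N ->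
  1 - mean_count t / J%:R <= \sum_(i < J) Pr P [set w | N t w == i] <= 1.
Proof.
move=> J0; rewrite -Pr_corr_count_lt Pr_le1 ?andbT; last exact: measurable_corr_count_lt.
have J1 : 0 < J%:R :> R by rewrite ltr0n.
have bN : bmeas (fun w => J%:R^-1 * (N t w)%:R : R).
  by apply: bmeasM; [exact: bmeas_cst|exact: bmeas_corr_count].
have -> : 1 - mean_count t / J%:R = Ex P (fun w => 1 - J%:R^-1 * (N t w)%:R).
  by rewrite ExB ?Ex_cst ?ExZ //; [rewrite mulrC|exact: bmeas_corr_count|exact: bmeas_cst].
rewrite -Ex_bool; last exact: measurable_corr_count_lt.
apply: le_Ex; [by apply: bmeasB => //; exact: bmeas_cst|exact/bmeas_bool/measurable_corr_count_lt|].
move=> w; case: ltnP => h /=.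
  by rewrite lerBlDr lerDl mulr_ge0 // invr_ge0.
by rewrite subr_le0 mulrC ler_pdivlMr // mul1r ler_nat.
Qed.

End CountMoments.

Lemma choose_near {U : Type} (A : set nat) (Q : nat -> U -> Prop) (u0 : U) :
  (forall n, A n -> exists u, Q n u) ->
  {f : nat -> U & forall n, A n -> Q n (f n)}.
Proof.
move=> h; apply: (@choice _ _ (fun n u => A n -> Q n u)) => n; have [An|nAn] := pselect (A n).
  by have [u Qu] := h n An; exists u.
by exists u0.
Qed.

(** * Limits of the counts at one and at two levels *)

Section PoissonLimit.
Context {R : realType}.
Variables (p : nat -> nat) (disp : nat -> measure_display).
Variables (T : forall n, measurableType (disp n)) (P : forall n, probability (T n) R).
Variable Z : forall n, 'I_(p n) -> {RV (P n) >-> vec R n}.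
Hypotheses (adm : admissible R p) (sZ : forall n, (3 <= n)%N -> iid_spherical (@Z n)).
Arguments Z : clear implicits.

Let m n : R := #|@edge (p n)|%:R.

Let p_ge M : \forall n \near \oo, (M <= p n)%N.
Proof. by have [h _] := adm; exact: (h _ (nbhs_infty_ge M)). Qed.

Let m_bounds n : (2 <= p n)%N -> (p n)%:R ^+ 2 <= 4 * m n /\ m n <= (p n)%:R ^+ 2.
Proof.
move=> p2; have := card_edge (p n) => /(congr1 (fun k => k%:R : R)).
rewrite natrD !natrM -/(m n) => E; have P2 : 2 <= (p n)%:R :> R by rewrite (ler_nat _ 2).
have m0 : 0 <= m n by exact: ler0n.
by split; rewrite expr2; nra.
Qed.

Lemma card_edge_infty : #|@edge (p n)|%:R @[n --> \oo] --> (+oo : set_system R).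
Proof.
apply/cvgryPge => A; near=> n.
have p4 : (4 <= p n)%N by near: n; exact: p_ge.
have [h _] := m_bounds (ltnW (ltnW p4)).
have pA : (Num.truncn `|A|).+1%:R <= (p n)%:R :> R by rewrite ler_nat; near: n; exact: p_ge.
have p4' : 4 <= (p n)%:R :> R by rewrite (ler_nat _ 4).
have : A <= (p n)%:R.
  by apply: le_trans pA; apply: le_trans (ler_norm A) _; apply: ltW; exact: truncnS_gt.
rewrite -/(m n); nra.
Unshelve. all: by end_near. Qed.

Let m_ln : ln (m n) / n%:R @[n --> \oo] --> (0 : R).
Proof.
have [_ h] := adm.
apply: (cvg_dist_squeeze (b := fun n => 2 * (ln (p n)%:R / n%:R))); last first.
  by rewrite -[X in _ --> X](mulr0 2); exact: cvgMl_tmp.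
near=> n; have p4 : (4 <= p n)%N by near: n; exact: p_ge.
have [h1 h2] := m_bounds (ltnW (ltnW p4)).
have p4' : 4 <= (p n)%:R :> R by rewrite (ler_nat _ 4).
have m1 : 1 <= m n by nra.
rewrite subr0 ger0_norm; last by rewrite divr_ge0 // ln_ge0.
rewrite mulrA ler_wpM2r ?invr_ge0 // mulr_natl -lnXn; last by lra.
by rewrite ler_ln // posrE ?exprn_gt0; lra.
Unshelve. all: by end_near. Qed.

Let good : set nat := [set n | (3 <= n)%N /\ (2 <= p n)%N].

Let near_good : \forall n \near \oo, good n.
Proof. by near=> n; split; near: n; [exists 3%N|exact: p_ge]. Unshelve. all: by end_near. Qed.

Let mu n t : R := mean_count (Z n) t.

Lemma exists_level : exists v : nat -> R,
  v n @[n --> \oo] --> +oo /\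
  forall a, 0 < a -> mu n (level v n a / Num.sqrt n%:R) @[n --> \oo] --> a.
Proof.
(* Dividing the mean count by the number of pairs makes sense for every n; for good n it is the
   common exceedance probability, whose definition needs an index and n >= 3. *)
pose tau n x := mu n (x / Num.sqrt n%:R) / m n.
have m_gt0 n : good n -> 0 < m n.
  by move=> [_ p2]; have [h _] := m_bounds p2; have : 2 <= (p n)%:R :> R; [rewrite (ler_nat _ 2)|nra].
have [|h hP] := @choose_near R good (fun n h => 2^-1 <= h <= 2 /\ forall x y : R,
    0 < x -> x < y -> y < Num.sqrt n%:R ->
    x * tau n x <= level_envelope (fun=> h) n x /\
    level_envelope (fun=> h) n x - level_envelope (fun=> h) n y <= y * tau n x) (0 : R).
  move=> n gn; have [n3 p2] := gn.
  pose j0 : 'I_(p n) := Ordinal (ltnW p2).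
  have [_ _ sph nul] := sZ n3; exists (corr_scale (Z n j0) n3); split.
    exact: corr_scale_bounds.
  move=> x y x0 xy yn; have := corr_tail_prob_bounds (sph j0) n3 (nul j0) x0 xy yn.
  suff -> : tau n x = corr_tail_prob (Z n j0) n3 (x / Num.sqrt n%:R) by [].
  rewrite /tau /mu /mean_count (Ex_corr_count (sZ n3) n3 j0) mulrC mulKf //.
  by rewrite gt_eqF // m_gt0.
have [|v vP] := @choose_near R good (fun n v => [/\ 0 < v, v < Num.sqrt n%:R & v = m n * level_envelope h n v]) (0 : R).
  move=> n gn; have [n3 _] := gn; have [/andP[h1 _] _] := hP n gn.
  by apply: level_exists => //; [exact: m_gt0|rewrite (lt_le_trans _ h1) // invr_gt0].
have vN : \forall n \near \oo, [/\ 0 < v n, v n < Num.sqrt n%:R & v n = m n * level_envelope h n (v n)].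
  by apply: filterS near_good; exact: vP.
have hN : \forall n \near \oo, 2^-1 <= h n <= 2.
  by apply: filterS near_good => n /hP[].
have mN := card_edge_infty.
exists v; split.
- exact: (level_infty vN hN mN m_ln).
- move=> a a0.
  have tN : \forall n \near \oo, forall x y, 0 < x -> x < y -> y < Num.sqrt n%:R ->
      x * tau n x <= level_envelope h n x /\ level_envelope h n x - level_envelope h n y <= y * tau n x.
    by apply: filterS near_good => n /hP[].
  have := level_tail vN hN mN m_ln tN a0; apply: cvg_trans; apply: near_eq_cvg.
  by apply: filterS near_good => n gn; rewrite /tau mulrC divfK // gt_eqF // m_gt0.
Qed.

Variable s : R -> nat -> R.
Hypothesis s_mono : forall a b, 0 < a -> a <= b -> \forall n \near \oo, s b n <= s a n.
Hypothesis s_mean : forall a, 0 < a -> mu n (s a n) @[n --> \oo] --> a.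

Local Notation N n a := (corr_count (Z n) (s a n)).

(** The Stein-Chen error is 8 p m q q' with m q and m q' the two mean counts; p^2 <= 4 m turns it
    into 32 times their product over p. *)
Let rec b c i : 0 < b -> b <= c ->
  i.+1%:R * Pr (P n) [set w | (N n b w == i.+1) && (N n c w == i.+1)] -
    mu n (s b n) * Pr (P n) [set w | (N n b w == i) && (N n c w == i)] @[n --> \oo] --> (0 : R).
Proof.
move=> b0 bc; have c0 : 0 < c by exact: lt_le_trans bc.
apply: (cvg_dist_squeeze (b := fun n => 32 * (mu n (s b n) * mu n (s c n)) * (p n)%:R^-1)).
  near=> n; have [n3 p2] : good n by near: n; exact: near_good.
  pose j0 : 'I_(p n) := Ordinal (ltnW p2).
  have sbc : s c n <= s b n by near: n; exact: s_mono.
  have E t : mu n t = m n * exceed_prob (Z n) n3 j0 t.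
    by rewrite /mu /mean_count (Ex_corr_count (sZ n3) n3 j0).
  rewrite subr0 E; apply: le_trans (corr_count_stein_chen (sZ n3) n3 j0 i sbc) _.
  rewrite -/(m n) E; set q := exceed_prob _ _ _ _; set q' := exceed_prob _ _ _ _.
  have q0 : 0 <= q by exact: Pr_ge0.
  have q0' : 0 <= q' by exact: Pr_ge0.
  have [h _] := m_bounds p2; have P2 : 0 < (p n)%:R :> R by rewrite ltr0n (leq_trans _ p2).
  rewrite ler_pdivlMr // natrM.
  have -> : m n * (2 * (4 * (p n)%:R) * (q * q')) * (p n)%:R = 8 * (m n * (q * q')) * (p n)%:R ^+ 2 by ring.
  have -> : 32 * (m n * q * (m n * q')) = 8 * (m n * (q * q')) * (4 * m n) by ring.
  by apply: ler_wpM2l => //; rewrite mulr_ge0 // mulr_ge0 ?mulr_ge0 // ler0n.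
rewrite -[X in _ --> X](mulr0 (32 * (b * c))); apply: cvgM.
  by apply: cvgMl_tmp; apply: cvgM; exact: s_mean.
apply/gtr0_cvgV0; first by near=> n; rewrite ltr0n; near: n; exact: p_ge.
apply/cvgryPge => A; near=> n.
have pA : (Num.truncn `|A|).+1%:R <= (p n)%:R :> R by rewrite ler_nat; near: n; exact: p_ge.
by apply: le_trans pA; apply: le_trans (ler_norm A) _; apply: ltW; exact: truncnS_gt.
Unshelve. all: by end_near. Qed.

Let mN n a i : measurable [set w | N n a w == i].
Proof. exact: measurable_corr_count. Qed.

Let mNN n a b i : measurable [set w | (N n a w == i) && (N n b w == i)].
Proof. by apply: measurable_set_andb. Qed.

Let Pr01 n a b i : 0 <= Pr (P n) [set w | (N n a w == i) && (N n b w == i)] <= 1.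
Proof. by rewrite Pr_ge0 Pr_le1. Qed.

Let Pr_count0 a : 0 < a -> Pr (P n) [set w | N n a w == 0%N] @[n --> \oo] --> expR (- a).
Proof.
move=> a0.
apply: (@poisson_recurrence0 _ (fun i n => Pr (P n) [set w | N n a w == i]) (fun n => mu n (s a n))).
- by move=> i n; rewrite Pr_ge0 Pr_le1.
- exact: s_mean.
- move=> i; have := rec i a0 (lexx a).
  by under eq_fun => n do (under eq_set => w do rewrite andbb; under [X in _ - _ * Pr _ X]eq_set => w do rewrite andbb).
- by move=> n J J0; exact: mean_count_markov.
Qed.

(** For two levels the probabilities do not add up to 1, so the term i = 0 is found differently: the
    count at c dominates the count at b, hence both vanish exactly when the former does. *)
Lemma count_joint_limit (k : nat) b c : 0 < b -> b <= c ->
  Pr (P n) [set w | (N n b w == k) && (N n c w == k)] @[n --> \oo] -->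
  expR (- c) * (b ^+ k / k`!%:R).
Proof.
move=> b0 bc; have c0 : 0 < c by exact: lt_le_trans bc.
have := @poisson_recurrence _ (fun i n => Pr (P n) [set w | (N n b w == i) && (N n c w == i)])
  (fun n => mu n (s b n)) b (fun i n => Pr01 n b c i) (s_mean b0) (fun i => rec i b0 bc) k.
pose x i n := Pr (P n) [set w | (N n b w == i) && (N n c w == i)].
move=> h.
have x0 : x 0%N n @[n --> \oo] --> expR (- c).
  have := Pr_count0 c0; apply: cvg_trans; apply: near_eq_cvg; near=> n.
  have sbc : s c n <= s b n by near: n; exact: s_mono.
  congr (Pr _ _); apply/seteqP; split => w /=; last by move=> /andP[].
  move=> Nc; rewrite Nc andbT -leqn0 -(eqP Nc); exact: corr_count_nincr.
have : x k n - x 0%N n * (b ^+ k / k`!%:R) + x 0%N n * (b ^+ k / k`!%:R) @[n --> \oo] -->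
    0 + expR (- c) * (b ^+ k / k`!%:R) by apply: cvgD => //; exact: cvgMr_tmp.
by rewrite add0r; under eq_fun => n do rewrite subrK.
Unshelve. all: by end_near. Qed.

(** P(Poisson(a) < k), which is the probability that the k-th point of a rate 1 Poisson process on
    ]0, +oo[ is at least a. *)
Definition poisson_lt k (a : R) := \sum_(i < k) expR (- a) * (a ^+ i / i`!%:R).

Lemma count_lt_limit a k : 0 < a ->
  Pr (P n) [set w | (N n a w < k)%N] @[n --> \oo] --> poisson_lt k a.
Proof.
move=> a0; under eq_fun => n do rewrite Pr_corr_count_lt.
apply: (cvg_sum (FF := eventually_filter)) => i.
have := @count_joint_limit i a a a0 (lexx a).
by under eq_fun => n do under eq_set => w do rewrite andbb.
Qed.

End PoissonLimit.

(** * Ratios of consecutive points *)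

Section PoissonDistribution.
Context {R : realType}.
Implicit Types a b x : R.

Let is_derive_power_fact k x :
  is_derive x 1 (fun y : R => y ^+ k.+1 / k.+1`!%:R) (x ^+ k / k`!%:R).
Proof.
have -> : (fun y : R => y ^+ k.+1 / k.+1`!%:R) = k.+1`!%:R^-1 *: (id : R -> R) ^+ k.+1.
  by apply/funext => y; rewrite !fctE /GRing.scale /= mulrC.
apply: (is_derive_eq (is_deriveZ _ (is_deriveX k.+1 (is_derive_id x 1)))).
rewrite /GRing.scale /= factS natrM mulr1 invfM mulrA -mulrA mulrC.
by rewrite -mulrA mulrCA !mulrA mulfK // mulrC.
Qed.

Lemma is_derive_poisson_lt k x :
  is_derive x 1 (poisson_lt k.+1) (- (expR (- x) * (x ^+ k / k`!%:R))).
Proof.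
have dE : is_derive x 1 (fun y : R => expR (- y)) (- expR (- x)).
  have dN : is_derive x 1 (-%R : R -> R) (-1) by exact: is_deriveNid.
  by apply: (is_derive_eq (is_derive1_comp (is_derive_expR (- x)) dN)); rewrite mulrN1.
elim: k => [|k IH].
  have -> : poisson_lt 1 = (fun y : R => expR (- y)).
    by apply/funext => y; rewrite /poisson_lt big_ord1 expr0 fact0 divr1 mulr1.
  by rewrite expr0 fact0 divr1 mulr1.
have -> : poisson_lt k.+2 = poisson_lt k.+1 +
    (fun y : R => expR (- y)) * (fun y : R => y ^+ k.+1 / k.+1`!%:R) :> (R -> R).
  by apply/funext => y; rewrite /poisson_lt big_ord_recr.
apply: (is_derive_eq (is_deriveD IH (is_deriveM dE (is_derive_power_fact k x)))).
by rewrite /GRing.scale /= factS natrM; ring.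
Qed.

(** The derivative of - poisson_lt k is exp(- x) times that of x^k / k!. Hence r x^k / k! +
    poisson_lt k is monotone on [a, b] for r = exp(- a) and for r = exp(- b). *)
Lemma poisson_lt_bounds k a b : 0 <= a -> a <= b ->
  expR (- b) * ((b ^+ k - a ^+ k) / k`!%:R) <= poisson_lt k a - poisson_lt k b <=
  expR (- a) * ((b ^+ k - a ^+ k) / k`!%:R).
Proof.
case: k => [|k] a0 ab.
  by rewrite /poisson_lt !big_ord0 !expr0 !subrr mul0r !mulr0 lexx.
have b0 : 0 <= b by exact: le_trans ab.
have cmp r : exists2 c, c \in `[a, b] &
    (r * (b ^+ k.+1 / k.+1`!%:R) + poisson_lt k.+1 b) -
    (r * (a ^+ k.+1 / k.+1`!%:R) + poisson_lt k.+1 a) =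
    ((r - expR (- c)) * (c ^+ k / k`!%:R)) * (b - a).
  pose f x := r *: (x ^+ k.+1 / k.+1`!%:R) + poisson_lt k.+1 x.
  have df (c : R) : is_derive c 1 f ((r - expR (- c)) * (c ^+ k / k`!%:R)).
    apply: (is_derive_eq (is_deriveD (is_deriveZ r (is_derive_power_fact k c)) (is_derive_poisson_lt k c))).
    by rewrite /GRing.scale /=; ring.
  have [|c cab E] := MVT_segment ab (fun x _ => df x).
    by apply: derivable_within_continuous => y yab; have [] := df y.
  by exists c.
have pos c : c \in `[a, b] -> 0 <= c ^+ k / k`!%:R * (b - a) /\ (expR (- b) <= expR (- c) <= expR (- a)).
  rewrite in_itv /= => /andP[ac cb]; rewrite !ler_expR !lerN2 ac cb; split => //.
  by rewrite mulr_ge0 ?subr_ge0 // divr_ge0 // exprn_ge0 // (le_trans a0).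
rewrite mulrBl; apply/andP; split.
- have [c /pos[p0 /andP[p1 _]] E] := cmp (expR (- b)).
  have : 0 <= (expR (- c) - expR (- b)) * (c ^+ k / k`!%:R * (b - a)) by rewrite mulr_ge0 // subr_ge0.
  lra.
- have [c /pos[p0 /andP[_ p1]] E] := cmp (expR (- a)).
  have : 0 <= (expR (- a) - expR (- c)) * (c ^+ k / k`!%:R * (b - a)) by rewrite mulr_ge0 // subr_ge0.
  lra.
Qed.

Lemma poisson_lt_nincr k a b : 0 <= a -> a <= b -> poisson_lt k b <= poisson_lt k a.
Proof.
move=> a0 ab; rewrite -subr_ge0; have /andP[h _] := poisson_lt_bounds k a0 ab.
apply: le_trans h; rewrite mulr_ge0 ?expR_ge0 // divr_ge0 // subr_ge0.
by rewrite lerXn2r // nnegrE // (le_trans a0).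
Qed.

Lemma poisson_lt_ge0 k a : 0 <= a -> 0 <= poisson_lt k a.
Proof.
move=> a0; apply: sumr_ge0 => i _.
by rewrite mulr_ge0 ?expR_ge0 // divr_ge0 // exprn_ge0.
Qed.

Lemma poisson_lt_near0 k a : (0 < k)%N -> 0 <= a -> a <= 1 -> 1 - a <= poisson_lt k a.
Proof.
move=> k0 a0 a1; apply: le_trans (onem_le_expR a) _.
case: k k0 => // k _; rewrite /poisson_lt big_ord_recl expr0 fact0 divr1 mulr1 lerDl.
by apply: sumr_ge0 => i _; rewrite mulr_ge0 ?expR_ge0 // divr_ge0 // exprn_ge0.
Qed.

Lemma poisson_lt_cvg0 k : poisson_lt k a @[a --> +oo] --> (0 : R).
Proof.
(* From a / (j + 1) <= exp(a / (j + 1)) one gets exp(- a) a^j <= (j + 1)^(j + 1) / a. *)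
pose C j : R := j.+1%:R ^+ j.+1 / j`!%:R.
apply: (cvg_dist_squeeze (b := fun a => (\sum_(j < k) C j) * a^-1)).
  near=> a; have a0 : 0 < a by near: a; exact: nbhs_pinfty_gt.
  rewrite subr0 ger0_norm ?poisson_lt_ge0 ?(ltW a0) // mulr_suml.
  apply: ler_sum => j _; rewrite /C mulrA [leRHS]mulrAC ler_wpM2r ?invr_ge0 //.
  rewrite expRN mulrC ler_pdivrMr ?expR_gt0 // mulrAC ler_pdivlMr // -exprSr.
  have j0 : 0 < j.+1%:R :> R by rewrite ltr0n.
  have -> : a ^+ j.+1 = j.+1%:R ^+ j.+1 * (a / j.+1%:R) ^+ j.+1.
    by rewrite -exprMn mulrC divfK // gt_eqF.
  rewrite ler_wpM2l ?exprn_ge0 //.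
  have {2}-> : a = j.+1%:R * (a / j.+1%:R) by rewrite mulrC divfK // gt_eqF.
  rewrite expRM_natl; apply: lerXn2r; rewrite ?nnegrE ?expR_ge0 ?divr_ge0 ?ltW //.
  by apply: lt_le_trans (expR_ge1Dx _); rewrite ltrDr.
rewrite -[X in _ --> X](mulr0 (\sum_(j < k) C j)); apply: cvgMl_tmp.
apply/gtr0_cvgV0; last exact: cvg_id.
by near=> a; near: a; exact: nbhs_pinfty_gt.
Unshelve. all: by end_near. Qed.

End PoissonDistribution.

(** * Discretization of the ratio of two points *)

Section Grid.
Context {d : measure_display} {T : measurableType d} {R : realType}.
Variables (P : probability T R) (V W : T -> R) (l : R) (s : nat -> R).
Hypotheses (mV : measurable_fun [set: T] V) (mW : measurable_fun [set: T] W).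
Hypotheses (l0 : 0 < l) (s_mono : forall i, s i <= s i.+1).

(* For V and W the points of rank k and k.+1, this is the probability that both
   counts, at the levels b and c, equal k. *)
Definition joint_prob b c := Pr P [set w | (V w < b) && (c <= W w)].

Let A : T -> R := fun w => (l * V w < W w)%R%:R.
Let B b : T -> R := fun w => (V w < b)%R%:R.
Let C b c : T -> R := fun w => ((V w < b) && (c <= W w))%R%:R.

Let mA : measurable [set w | l * V w < W w].
Proof. by apply: measurable_set_ltr => //; apply: measurable_funM => //; exact: measurable_cst. Qed.
Let mB b : measurable [set w | V w < b].
Proof. by apply: measurable_set_ltr => //; exact: measurable_cst. Qed.
Let mC b c : measurable [set w | (V w < b) && (c <= W w)].
Proof. by apply: measurable_set_andb => //; apply: measurable_set_ler => //; exact: measurable_cst. Qed.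

Let ExC b c : Ex P (C b c) = joint_prob b c.
Proof. exact: Ex_bool. Qed.

Let cell i w : B (s i.+1) w - B (s i) w = ((s i <= V w) && (V w < s i.+1))%R%:R.
Proof.
rewrite /B; have := s_mono i.
by case: (ltP (V w) (s i)) => h1; case: (ltP (V w) (s i.+1)) => h2 h3 /=; rewrite ?subrr ?subr0 //;
  have := lt_le_trans h1 (le_trans h3 h2); rewrite ltxx.
Qed.

Let cell01 L w : 0 <= B (s L) w - B (s 0%N) w <= 1.
Proof.
have sL : s 0%N <= s L by elim: L => // L IH; exact: le_trans (s_mono L).
rewrite /B; case: (ltP (V w) (s 0%N)) => h1; case: (ltP (V w) (s L)) => h2;
  rewrite ?subrr ?subr0 ?lexx ?ler01 //.
by have := lt_le_trans h1 (le_trans sL h2); rewrite ltxx.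
Qed.

(** On the cell s_i <= V < s_(i+1), l s_(i+1) <= W implies l V < W, which implies l s_i <= W. The
    first implication gives this bound and the second [grid_upper], which also pays for V outside
    the grid. *)
Lemma grid_lower L :
  \sum_(i < L) (joint_prob (s i.+1) (l * s i.+1) - joint_prob (s i) (l * s i.+1)) <=
  Pr P [set w | l * V w < W w].
Proof.
rewrite -(Ex_bool P mA).
have bC b c : bmeas (C b c) by exact: bmeas_bool.
under eq_bigr => i _ do rewrite -!ExC -ExB //.
rewrite -Ex_sum => [|i _]; last exact: bmeasB.
apply: le_Ex; [by apply: bmeas_sum => i _; exact: bmeasB|exact: bmeas_bool|] => w.
apply: (@le_trans _ _ (\sum_(i < L) (B (s i.+1) w - B (s i) w) * A w)).
  apply: ler_sum => i _; rewrite cell /C /A; have := s_mono i.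
  case: (leP (l * s i.+1) (W w)) => h; rewrite ?(andbT, andbF) ?subrr ?mulr_ge0 // => h3.
  case: (ltP (V w) (s i.+1)) => h2; last first.
    by rewrite ltNge (le_trans h3 h2) subrr andbF mul0r.
  rewrite andbT (lt_le_trans _ h) ?ltr_pM2l // mulr1.
  by case: ltP => _ /=; rewrite ?subrr ?subr0.
rewrite -mulr_suml -(big_mkord xpredT (fun i => B (s i.+1) w - B (s i) w)) telescope_sumr //.
by rewrite ler_piMl // ?/A; have /andP[] := cell01 L w.
Qed.

Lemma grid_upper L : Pr P [set w | l * V w < W w] <=
  1 - Pr P [set w | s 0%N <= V w] + Pr P [set w | s L <= V w] +
  \sum_(i < L) (joint_prob (s i.+1) (l * s i) - joint_prob (s i) (l * s i)).
Proof.
have PB b : Pr P [set w | b <= V w] = 1 - Pr P [set w | V w < b].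
  rewrite -Pr_setC //; congr Pr; apply/seteqP; split => w /=.
    by move=> h; apply/negP; rewrite -leNgt.
  by move=> /negP; rewrite -leNgt.
rewrite !PB subKr.
have ExBE b : Pr P [set w | V w < b] = Ex P (B b) by rewrite -Ex_bool.
rewrite !ExBE -(Ex_bool P mA).
have bC b c : bmeas (C b c) by exact: bmeas_bool.
have bB b : bmeas (B b) by exact: bmeas_bool.
under eq_bigr => i _ do rewrite -!ExC -ExB //.
rewrite -Ex_sum => [|i _]; last exact: bmeasB.
have b1 : bmeas (fun w => \sum_(i < L) (C (s i.+1) (l * s i) w - C (s i) (l * s i) w)).
  by apply: bmeas_sum => i _; exact: bmeasB.
have b2 : bmeas (fun w => 1 - B (s L) w) by apply: bmeasB => //; exact: bmeas_cst.
have -> : 1 - Ex P (B (s L)) = Ex P (fun w => 1 - B (s L) w).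
  by rewrite ExB ?Ex_cst //; exact: bmeas_cst.
rewrite -ExD // -ExD //; last exact: bmeasD.
apply: le_Ex; [exact: bmeas_bool|by apply: bmeasD => //; exact: bmeasD|] => w.
apply: (@le_trans _ _ (B (s 0%N) w + (1 - B (s L) w) + \sum_(i < L) (B (s i.+1) w - B (s i) w) * A w)).
  rewrite -mulr_suml -(big_mkord xpredT (fun i => B (s i.+1) w - B (s i) w)) telescope_sumr //.
  have /andP[h0 h1] := cell01 L w; rewrite -/(A w).
  have : 0 <= A w <= 1 by rewrite /A; case: (_ < _); rewrite lexx ler01.
  by move=> /andP[a0 a1]; nra.
rewrite lerD2l; apply: ler_sum => i _; rewrite cell /C /A; have := s_mono i => h3.
case: (ltP (V w) (s i)) => h1.
  by rewrite mul0r (lt_le_trans h1 h3) subrr.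
case: (ltP (V w) (s i.+1)) => h2 /=; last by rewrite mul0r subrr.
rewrite mul1r subr0; case: ltP => // h; rewrite ?ler0n //.
by rewrite (le_trans _ (ltW h)) // ler_pM2l.
Qed.

End Grid.

Section RatioLimit.
Context {R : realType}.
Variables (disp : nat -> measure_display) (T : forall n, measurableType (disp n)).
Variables (P : forall n, probability (T n) R) (V W : forall n, T n -> R) (k : nat).
Arguments V : clear implicits.
Arguments W : clear implicits.
Hypotheses (k0 : (0 < k)%N).
Hypotheses (mV : forall n, measurable_fun [set: T n] (V n))
           (mW : forall n, measurable_fun [set: T n] (W n)).
Hypothesis V_lim : forall a, 0 < a ->
  Pr (P n) [set w | a <= V n w] @[n --> \oo] --> poisson_lt k a.
Hypothesis VW_lim : forall b c, 0 < b -> b <= c ->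
  joint_prob (P n) (V n) (W n) b c @[n --> \oo] --> expR (- c) * (b ^+ k / k`!%:R).

(* Both grid bounds are Riemann-Stieltjes sums for the integral of exp (- l s)
   against d(s^k / k!) over ]0, +oo[, which is l^-k; the substitution u = l s turns
   them into telescoping sums of poisson_lt k. *)
Lemma ratio_limit l : 1 < l ->
  Pr (P n) [set w | l * V n w < W n w] @[n --> \oo] --> (l ^+ k)^-1.
Proof.
move=> l1; have l0 : 0 < l by lra.
have lk0 : 0 < l ^+ k by exact: exprn_gt0.
have lk1 : (l ^+ k)^-1 <= 1 by rewrite invf_le1 // exprn_ege1 // ltW.
apply/cvgrPdist_le => e e0.
(* The upper bound collects five errors of size e1: one at each end of the grid, two from the
   Riemann sum and one from the limit in n. *)
pose e1 := Num.min (e / 5) 2^-1.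
have e10 : 0 < e1 by rewrite lt_min; apply/andP; split; lra.
have e1e : e1 <= e / 5 by rewrite ge_min lexx.
have e1h : e1 <= 2^-1 by rewrite ge_min lexx orbT.
(* The grid starts at e1 / l so that even l s_0 = e1 leaves a mass of at most e1 below it. *)
pose dl := e1 / l.
have dl0 : 0 < dl by exact: divr_gt0.
have dll : l * dl = e1 by rewrite mulrC divfK // gt_eqF.
have dle : dl <= e1 by rewrite ler_pdivrMr // ler_peMr // ltW.
(* The first bound on the mesh gives s_(i+1) <= l s_i, required by [VW_lim] in the upper sum; the
   second makes exp(l eta) at most 1 + 2 e1. *)
pose eta := Num.min ((l - 1) * dl) (e1 / (2 * l)).
have eta0 : 0 < eta by rewrite lt_min mulr_gt0 ?subr_gt0 // divr_gt0 // mulr_gt0.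
have eta1 : eta <= (l - 1) * dl by rewrite ge_min lexx.
have eta2 : l * eta <= e1 / 2.
  have h : eta <= e1 / (2 * l) by rewrite ge_min lexx orbT.
  have := ler_wpM2l (ltW l0) h; suff -> : l * (e1 / (2 * l)) = e1 / 2 by [].
  by field; rewrite gt_eqF.
have Elow : 1 - e1 <= expR (- (l * eta)).
  by apply: le_trans (onem_le_expR _); lra.
have Eup : expR (l * eta) <= 1 + 2 * e1.
  have : 1 - l * eta <= expR (- (l * eta)) by exact: onem_le_expR.
  have p0 : 0 < 1 - l * eta by lra.
  rewrite expRN => h; have : expR (l * eta) <= (1 - l * eta)^-1.
    by rewrite -[leLHS]invrK lef_pV2 // posrE ?invr_gt0 ?expR_gt0.
  move=> h2; apply: le_trans h2 _; rewrite -[leLHS]mul1r ler_pdivrMr //; nra.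
pose s i : R := dl + i%:R * eta.
have sS i : s i.+1 = s i + eta by rewrite /s -natr1; ring.
have s_mono i : s i <= s i.+1 by rewrite sS lerDl ltW.
have s_ge i : dl <= s i by rewrite lerDl mulr_ge0 // ltW.
have s_gt0 i : 0 < s i by exact: lt_le_trans (s_ge i).
have sSl i : s i.+1 <= l * s i.
  rewrite sS; have l1' : 0 <= l - 1 by lra.
  by have := ler_wpM2l l1' (s_ge i); lra.
have [L TL] : exists L, poisson_lt k (s L) <= e1.
  have [M [_ MP]] : exists M, M \is Num.real /\ forall x, M < x -> `|0 - poisson_lt k x| <= e1.
    by have /cvgrPdist_le /(_ _ e10) := @poisson_lt_cvg0 R k.
  exists (Num.truncn (`|M| / eta)).+1; set j := _.+1.
  have : M < s j.
    have : `|M| / eta < j%:R by exact: truncnS_gt.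
    by rewrite ltr_pdivrMr // /s => h; have := ler_norm M; lra.
  by move/MP; rewrite sub0r normrN; apply: le_trans; exact: ler_norm.
have TlL : poisson_lt k (l * s L) <= e1.
  apply: le_trans TL; apply: poisson_lt_nincr; first exact: ltW.
  by rewrite ler_peMl // ltW.
have TlL0 : 0 <= poisson_lt k (l * s L) by rewrite poisson_lt_ge0 // mulr_ge0 // ltW.
have T0 : 1 - e1 <= poisson_lt k (s 0%N).
  have -> : s 0%N = dl by rewrite /s mul0r addr0.
  apply: le_trans (poisson_lt_near0 k0 (ltW dl0) _); lra.
have Tl0 : 1 - e1 <= poisson_lt k (l * s 0%N).
  have -> : l * s 0%N = e1 by rewrite /s mul0r addr0.
  apply: (poisson_lt_near0 k0); lra.
have Tl01 : poisson_lt k (l * s 0%N) <= 1.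
  have := @poisson_lt_nincr R k 0 (l * s 0%N) (lexx 0) (mulr_ge0 (ltW l0) (ltW (s_gt0 _))).
  move=> h; apply: le_trans h _; case: (k) k0 => // j _.
  rewrite /poisson_lt big_ord_recl oppr0 expR0 expr0 fact0 divr1 mulr1 big1 ?addr0 // => i _.
  by rewrite expr0n /= mul0r mulr0.
have E i : s i.+1 ^+ k - s i ^+ k = (l ^+ k)^-1 * ((l * s i.+1) ^+ k - (l * s i) ^+ k).
  by rewrite !exprMn; field; rewrite gt_eqF.
have lsE i : l * s i.+1 = l * s i + l * eta by rewrite sS mulrDr.
have bd i := @poisson_lt_bounds R k (l * s i) (l * s i.+1) (mulr_ge0 (ltW l0) (ltW (s_gt0 i)))
  (ler_wpM2l (ltW l0) (s_mono i)).
pose D i := poisson_lt k (l * s i) - poisson_lt k (l * s i.+1).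
have DE : \sum_(i < L) D i = poisson_lt k (l * s 0%N) - poisson_lt k (l * s L).
  elim: (L) => [|j IH]; first by rewrite big_ord0 subrr.
  by rewrite big_ord_recr /= IH /D addrA subrK.
have low i : (l ^+ k)^-1 * expR (- (l * eta)) * D i <=
    expR (- (l * s i.+1)) * (s i.+1 ^+ k / k`!%:R) - expR (- (l * s i.+1)) * (s i ^+ k / k`!%:R).
  rewrite -mulrBr -mulrBl E.
  have -> : expR (- (l * s i.+1)) = expR (- (l * s i)) * expR (- (l * eta)).
    by rewrite lsE opprD expRD.
  have /andP[_ h] := bd i; rewrite -/(D i) in h.
  have h2 : 0 <= (l ^+ k)^-1 * expR (- (l * eta)) by rewrite mulr_ge0 ?expR_ge0 // invr_ge0 ltW.
  have := ler_wpM2l h2 h; lra.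
have up i : expR (- (l * s i)) * (s i.+1 ^+ k / k`!%:R) - expR (- (l * s i)) * (s i ^+ k / k`!%:R) <=
    (l ^+ k)^-1 * expR (l * eta) * D i.
  rewrite -mulrBr -mulrBl E.
  have -> : - (l * s i) = - (l * s i.+1) + l * eta by rewrite lsE; ring.
  rewrite expRD.
  have /andP[h _] := bd i; rewrite -/(D i) in h.
  have h2 : 0 <= (l ^+ k)^-1 * expR (l * eta) by rewrite mulr_ge0 ?expR_ge0 // invr_ge0 ltW.
  have := ler_wpM2l h2 h; lra.
pose lo n := \sum_(i < L) (joint_prob (P n) (V n) (W n) (s i.+1) (l * s i.+1) -
  joint_prob (P n) (V n) (W n) (s i) (l * s i.+1)).
pose hi n := 1 - Pr (P n) [set w | s 0%N <= V n w] + Pr (P n) [set w | s L <= V n w] +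
  \sum_(i < L) (joint_prob (P n) (V n) (W n) (s i.+1) (l * s i) -
     joint_prob (P n) (V n) (W n) (s i) (l * s i)).
have sl i : s i <= l * s i by rewrite ler_peMl // ltW.
have lo_lim : lo n @[n --> \oo] --> \sum_(i < L) (expR (- (l * s i.+1)) * (s i.+1 ^+ k / k`!%:R) -
    expR (- (l * s i.+1)) * (s i ^+ k / k`!%:R)).
  apply: (cvg_sum (FF := eventually_filter)) => i; apply: cvgB; apply: VW_lim => //.
  exact: le_trans (s_mono _) _.
have hi_lim : hi n @[n --> \oo] --> 1 - poisson_lt k (s 0%N) + poisson_lt k (s L) +
   \sum_(i < L) (expR (- (l * s i)) * (s i.+1 ^+ k / k`!%:R) -
    expR (- (l * s i)) * (s i ^+ k / k`!%:R)).
  apply: cvgD.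
    by apply: cvgD; [apply: cvgB; [exact: cvg_cst|exact: V_lim]|exact: V_lim].
  by apply: (cvg_sum (FF := eventually_filter)) => i; apply: cvgB; exact: VW_lim.
move/cvgrPdist_le : lo_lim => /(_ _ e10); move/cvgrPdist_le : hi_lim => /(_ _ e10).
set LO := \sum_(i < L) (expR (- (l * s i.+1)) * _ - _).
set HI := \sum_(i < L) (expR (- (l * s i)) * _ - _).
have LO_ge : (l ^+ k)^-1 * expR (- (l * eta)) * (poisson_lt k (l * s 0%N) - poisson_lt k (l * s L)) <= LO.
  by rewrite -DE mulr_sumr; apply: ler_sum => i _; exact: low.
have HI_le : HI <= (l ^+ k)^-1 * expR (l * eta) * (poisson_lt k (l * s 0%N) - poisson_lt k (l * s L)).
  by rewrite -DE mulr_sumr; apply: ler_sum => i _; exact: up.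
have r0 : 0 <= (l ^+ k)^-1 by rewrite invr_ge0 ltW.
have LO3 : (l ^+ k)^-1 - 3 * e1 <= LO.
  apply: le_trans LO_ge; rewrite -mulrA.
  have : 1 - 3 * e1 <= expR (- (l * eta)) * (poisson_lt k (l * s 0%N) - poisson_lt k (l * s L)) by nra.
  move/(ler_wpM2l r0); nra.
have HI3 : HI <= (l ^+ k)^-1 + 2 * e1.
  apply: le_trans HI_le _; rewrite -mulrA.
  have h0 := expR_ge0 (l * eta).
  have : expR (l * eta) * (poisson_lt k (l * s 0%N) - poisson_lt k (l * s L)) <= 1 + 2 * e1 by nra.
  move/(ler_wpM2l r0); nra.
move=> hiN loN; near=> n.
have h1 : lo n <= Pr (P n) [set w | l * V n w < W n w] by exact: grid_lower.
have h2 : Pr (P n) [set w | l * V n w < W n w] <= hi n by exact: grid_upper.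
have h3 : `|LO - lo n| <= e1 by near: n.
have h4 : `|1 - poisson_lt k (s 0%N) + poisson_lt k (s L) + HI - hi n| <= e1 by near: n.
move: h3 h4; rewrite !ler_norml => /andP[? ?] /andP[? ?].
by apply/andP; split; lra.
Unshelve. all: by end_near. Qed.

End RatioLimit.

Lemma exponential_cdf {R : realType} (rate x : R) :
  exponential_prob rate `]-oo, x]%classic =
  (if x <= 0 then 0 else 1 - expR (- rate * x))%:E.
Proof.
have E : exponential_prob rate `]-oo, x]%classic = exponential_prob rate `[0, x]%classic.
  rewrite /exponential_prob integral_mkcond [RHS]integral_mkcond.
  apply: eq_integral => y _; rewrite !patchE; case: (ltP y 0) => y0.
    by rewrite lt0_exponential_pdf //; case: ifP; case: ifP.
  by congr (if _ then _ else _); apply/idP/idP; rewrite !inE /= !in_itv /= y0.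
rewrite E; case: ltgtP => x0.
- by rewrite set_itv_ge ?bnd_simp -?ltNge // /exponential_prob integral_set0.
- by rewrite exponential_prob_itv0c.
- by rewrite x0 set_itv1 /exponential_prob integral_set1.
Qed.

(** * Order statistics and spacings *)

Section OrderStatistics.
Context {R : realType}.
Implicit Types (u : R) (s : seq R).

(** The condition 0 <= u takes care of j beyond the size, where [nth] returns 0 and both sides are
    false. *)
Lemma sorted_nth_count s u j : 0 <= u -> sorted (fun a b : R => b <= a) s ->
  (u < nth 0 s j) = (j < count (fun x => (u < x)%R) s)%N.
Proof.
move=> u0; have trans : transitive (fun a b : R => b <= a).
  by move=> y x z xy yz; exact: le_trans yz xy.
elim: s j => [|x s IH] j sx; first by rewrite nth_nil ltNge u0.
have ss := subseq_sorted trans (subseq_cons s x) sx.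
have xs : x <= u -> count (fun y => (u < y)%R) s = 0%N.
  move=> xu; apply/eqP; rewrite -leqn0 leqNgt -has_count; apply/hasPn => y ys.
  by rewrite -leNgt (le_trans _ xu) //; move: sx; rewrite /= (path_sortedE trans) => /andP[/allP/(_ y ys)].
have [ux|xu] := ltP u x; first by case: j => [|j] /=; rewrite ux // IH.
have ux : (u < x) = false by rewrite ltNge xu.
by case: j => [|j] /=; rewrite ?IH // xs // ux.
Qed.

Context {n p : nat}.

Lemma order_stat_gt (z : 'I_p -> 'cV[R]_n) u k : 0 <= u -> (0 < k)%N ->
  (u < order_stat k z) =
  (k <= \sum_(e | @edge p e) (u < `|sample_corr (z e.1) (z e.2)|)%R)%N.
Proof.
move=> u0 k0; rewrite /order_stat sorted_nth_count //; last first.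
  by apply: sort_sorted => a b; exact: le_total.
rewrite prednK // (permP (permEl (perm_sort _ _))) /abs_corrs count_map; congr (_ <= _)%N.
by rewrite -sum1_count big_enum_cond /= big_mkcondr.
Qed.

Lemma order_stat_ge0 (z : 'I_p -> 'cV[R]_n) k : 0 <= order_stat k z.
Proof.
rewrite /order_stat; have [h|h] := ltnP k.-1 (size (sort (fun a b : R => b <= a) (abs_corrs z))).
  have := mem_nth 0 h; rewrite mem_sort => /mapP[e _ ->]; exact: normr_ge0.
by rewrite nth_default.
Qed.

End OrderStatistics.

Section MeasurableOrderStatistics.
Context {d : measure_display} {T : measurableType d} {R : realType}.
Context (P : probability T R) {n p : nat}.
Variable Z : 'I_p -> {RV P >-> vec R n}.

Lemma order_stat_corr_count u k w : 0 <= u -> (0 < k)%N ->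
  (u < order_stat k (fun i => Z i w)) = (k <= corr_count Z u w)%N.
Proof. exact: order_stat_gt. Qed.

Lemma measurable_order_stat k : (0 < k)%N ->
  measurable_fun [set: T] (fun w => order_stat k (fun i => Z i w)).
Proof.
move=> k0; apply: (measurability _ (RGenOInfty.measurableE R)) => // A [_ [u ->] <-].
rewrite setTI; have [u0|u0] := leP 0 u.
  have -> : (fun w => order_stat k (fun i => Z i w)) @^-1` `]u, +oo[ =
      ~` [set w | (corr_count Z u w < k)%N].
    apply/seteqP; split => w /=; rewrite in_itv /= andbT order_stat_corr_count //.
      by move=> h; apply/negP; rewrite -leqNgt.
    by move=> /negP; rewrite -leqNgt.
  by apply: measurableC; exact: measurable_corr_count_lt.
have -> : (fun w => order_stat k (fun i => Z i w)) @^-1` `]u, +oo[ = [set: T] => //.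
by apply/seteqP; split => w //= _; rewrite in_itv /= andbT (lt_le_trans u0) // order_stat_ge0.
Qed.

End MeasurableOrderStatistics.

Section RealBounds.
Context {R : realType}.
Implicit Types a b v x q r : R.

Lemma slope_near1 v X a b eta : 0 < v -> 0 < a -> 0 < b ->
  `|ln a| + `|ln b| <= eta * v ^+ 2 ->
  a <= expR (v * (v - X)) -> expR (v * (v - X)) < b -> 1 - eta <= X / v <= 1 + eta.
Proof.
move=> v0 a0 b0 lab h1 h2.
have l1 : ln a <= v * (v - X) by rewrite -ler_expR lnK.
have l2 : v * (v - X) <= ln b by rewrite -ler_expR lnK // ltW.
have := ler_norm (ln b); have := ler_norm (- ln a); rewrite normrN => n3 n4.
have n1 := normr_ge0 (ln a); have n2 := normr_ge0 (ln b).
rewrite ler_pdivlMr // ler_pdivrMr //.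
by apply/andP; split; rewrite -(ler_pM2r v0); lra.
Qed.

(** The tolerance eta = dx / (x + dx) is chosen so that (1 - eta) (x + dx) = x, and then (1 + eta)
    (x - dx) <= x. *)
Lemma slope_sandwich x dx q r : 0 < dx -> dx < x ->
  1 - dx / (x + dx) <= q <= 1 + dx / (x + dx) ->
  (x < q * r -> x - dx < r) /\ (x + dx < r -> x < q * r).
Proof.
move=> dx0 dxx; set eta := dx / (x + dx) => /andP[q1 q2].
have xd0 : 0 < x + dx by lra.
have eta0 : 0 < eta by exact: divr_gt0.
have eta1 : eta < 1 by rewrite ltr_pdivrMr // mul1r; lra.
have etaE : eta * (x + dx) = dx by rewrite divfK // gt_eqF.
split=> [xr|xr].
  rewrite ltNge; apply/negP => rx.
  have q0 : 0 <= q by lra.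
  have h1 : q * r <= q * (x - dx) by rewrite ler_wpM2l.
  have h2 : q * (x - dx) <= (1 + eta) * (x - dx) by rewrite ler_wpM2r // subr_ge0 ltW.
  have : 0 <= eta * dx by rewrite mulr_ge0 ?ltW.
  lra.
have h1 : (1 - eta) * (x + dx) < (1 - eta) * r by rewrite ltr_pM2l // subr_gt0.
have h2 : (1 - eta) * r <= q * r by rewrite ler_wpM2r //; lra.
lra.
Qed.

Lemma dist_le_sum8 (e l l1 l2 p p1 p2 ta tb ua ub : R) :
  `|l - l1| <= e / 8 -> `|l - l2| <= e / 8 -> 1 - e / 8 <= ta -> tb <= e / 8 ->
  `|ta - ua| <= e / 8 -> `|tb - ub| <= e / 8 -> `|l1 - p1| <= e / 8 ->
  `|l2 - p2| <= e / 8 -> p <= p1 + (1 - ua + ub) -> p2 <= p + (1 - ua + ub) ->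
  `|l - p| <= e.
Proof.
rewrite !ler_norml => /andP[? _] /andP[_ ?] ? ? /andP[_ ?] /andP[? _] /andP[? _] /andP[_ ?] ? ?.
by apply/andP; split; lra.
Qed.

End RealBounds.

(** * The limit law of the spacing *)

Section SpacingLimit.
Context {R : realType}.
Variables (p : nat -> nat) (disp : nat -> measure_display).
Variables (T : forall n, measurableType (disp n)) (P : forall n, probability (T n) R).
Variable Z : forall n, 'I_(p n) -> {RV (P n) >-> vec R n}.
Hypotheses (adm : admissible R p) (sZ : forall n, (3 <= n)%N -> iid_spherical (@Z n)).
Arguments Z : clear implicits.
Variable k : nat.
Hypothesis k0 : (0 < k)%N.

Local Notation V j n w := (order_stat j (fun i : 'I_(p n) => Z n i w)).
Local Notation spacing n w := (n%:R * V k n w * (V k n w - V k.+1 n w)).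

Let mV j n : (0 < j)%N -> measurable_fun [set: T n] (fun w => V j n w).
Proof. exact: measurable_order_stat. Qed.

Let mspacing n : measurable_fun [set: T n] (fun w => spacing n w).
Proof.
apply: measurable_funM; last by apply: measurable_funB; exact: mV.
by apply: measurable_funM; [exact: measurable_cst|exact: mV].
Qed.

Let level_lt (v a X : R) : 0 < v -> 0 < a -> (v - ln a / v < X) = (expR (v * (v - X)) < a).
Proof.
move=> v0 a0; rewrite -{2}(lnK a0) ltr_expR ltrBlDr -ltrBlDl.
by rewrite ltr_pdivlMr // mulrC.
Qed.

Section LevelVariable.
Variable v : nat -> R.
Hypotheses (v_infty : v n @[n --> \oo] --> +oo).
Hypothesis v_mean : forall a, 0 < a ->
  mean_count (Z n) (level v n a / Num.sqrt n%:R) @[n --> \oo] --> a.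

Let s a n := level v n a / Num.sqrt n%:R.
(** The point W_(j): for v > 0 the map from X to W is decreasing, so the j-th largest correlation
    gives the j-th smallest point. *)
Let U j n w := expR (v n * (v n - Num.sqrt n%:R * V j n w)).
Arguments U : clear implicits.

Let v_pos : \forall n \near \oo, 0 < v n.
Proof. by move/cvgryPgt : v_infty; exact. Qed.

Let s_mono a b : 0 < a -> a <= b -> \forall n \near \oo, s b n <= s a n.
Proof.
move=> a0 ab; apply: filterS v_pos => n v0.
rewrite ler_wpM2r ?invr_ge0 // lerD2l lerN2 ler_wpM2r ?invr_ge0 ?(ltW v0) //.
by rewrite ler_ln // posrE (lt_le_trans a0).
Qed.

Let U_lt a j : 0 < a -> (0 < j)%N ->
  \forall n \near \oo, forall w, (U j n w < a) = (j <= corr_count (Z n) (s a n) w)%N.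
Proof.
move=> a0 j0; near=> n => w.
have v0 : 0 < v n by near: n; exact: v_pos.
have n0 : 0 < Num.sqrt n%:R :> R by rewrite sqrtr_gt0 ltr0n; near: n; exists 1%N.
(* This makes the level nonnegative, as the passage from order statistics to counts requires. *)
have va : 1 + `|ln a| <= v n by near: n; move/cvgryPge : v_infty; exact.
have l0 : 0 <= level v n a.
  rewrite subr_ge0 ler_pdivrMr //; apply: le_trans (ler_norm _) _.
  have := normr_ge0 (ln a); nra.
rewrite -order_stat_corr_count ?divr_ge0 ?(ltW n0) // ltr_pdivrMr //.
by rewrite [in RHS]mulrC; symmetry; exact: level_lt.
Unshelve. all: by end_near. Qed.

Let mU j n : (0 < j)%N -> measurable_fun [set: T n] (U j n).
Proof.
move=> j0; apply: measurableT_comp => //; apply: measurable_funM; first exact: measurable_cst.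
apply: measurable_funB; first exact: measurable_cst.
by apply: measurable_funM; [exact: measurable_cst|exact: mV].
Qed.

Let U_lim a : 0 < a ->
  Pr (P n) [set w | a <= U k n w] @[n --> \oo] --> poisson_lt k a.
Proof.
move=> a0; have := count_lt_limit adm sZ s_mono v_mean (k := k) a0.
apply: cvg_trans; apply: near_eq_cvg; near=> n; congr (Pr _ _).
have h : forall w, (U k n w < a) = (k <= corr_count (Z n) (s a n) w)%N.
  by near: n; exact: U_lt.
by apply/seteqP; split => w /=; rewrite leNgt h -ltnNge.
Unshelve. all: by end_near. Qed.

(** U_k < b means k <= N_b, and c <= U_(k+1) means N_c <= k; since N_b <= N_c, both counts are then
    k. *)
Let UU_lim b c : 0 < b -> b <= c ->
  joint_prob (P n) (U k n) (U k.+1 n) b c @[n --> \oo] --> expR (- c) * (b ^+ k / k`!%:R).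
Proof.
move=> b0 bc; have c0 : 0 < c by exact: lt_le_trans bc.
have := count_joint_limit adm sZ s_mono v_mean (k := k) b0 bc.
apply: cvg_trans; apply: near_eq_cvg; near=> n; congr (Pr _ _).
have hb : forall w, (U k n w < b) = (k <= corr_count (Z n) (s b n) w)%N.
  by near: n; exact: U_lt.
have hc : forall w, (U k.+1 n w < c) = (k.+1 <= corr_count (Z n) (s c n) w)%N.
  by near: n; exact: U_lt.
have sbc : s c n <= s b n by near: n; exact: s_mono.
apply/seteqP; split => w /=; rewrite hb leNgt hc -leqNgt.
  by move=> /andP[/eqP -> /eqP ->]; rewrite !leqnn.
have := corr_count_nincr (Z n) w sbc => h1 /andP[h2 h3].
by rewrite !eqn_leq h2 h3 (leq_trans h1 h3) (leq_trans h2 h1).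
Unshelve. all: by end_near. Qed.

Let ratio_lim y : 0 < y ->
  Pr (P n) [set w | expR y * U k n w < U k.+1 n w] @[n --> \oo] --> expR (- (k%:R * y)).
Proof.
move=> y0; have -> : expR (- (k%:R * y)) = (expR y ^+ k)^-1 by rewrite expRN expRM_natl.
apply: ratio_limit => //; first by move=> n; exact: mU.
- by move=> n; exact: mU.
- by rewrite expR_gt1.
Qed.

(** Outside the events U_k < a and b <= U_k, each of probability at most e / 4 eventually, the
    factor X_(k) / v is within eta of 1. The spacing exceeding x is then compared with the logarithm
    of the ratio exceeding x - dx and x + dx. *)
Lemma spacing_tail x : 0 < x ->
  Pr (P n) [set w | x < spacing n w] @[n --> \oo] --> expR (- (k%:R * x)).
Proof.
move=> x0; apply/cvgrPdist_le => e e0.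
have e8 : 0 < e / 8 by rewrite divr_gt0.
have cont : expR (- (k%:R * y)) @[y --> x] --> expR (- (k%:R * x)).
  apply: (@cvg_comp _ _ _ (fun y : R => - (k%:R * y)) expR); last exact: continuous_expR.
  by apply: cvgN; apply: cvgMl_tmp; exact: cvg_id.
have [dl dl0 dlP] : exists2 dl, 0 < dl & forall y, `|x - y| <= dl ->
    `|expR (- (k%:R * x)) - expR (- (k%:R * y))| <= e / 8.
  move/cvgrPdist_le : cont => /(_ _ e8) /nbhs_ballP[r /= r0 rP].
  exists (r / 2); first by rewrite divr_gt0.
  by move=> y yr; apply: rP; rewrite /ball /=; apply: le_lt_trans yr _; lra.
pose dx := Num.min dl (x / 2).
have dx0 : 0 < dx by rewrite lt_min dl0 divr_gt0.
have dxl : dx <= dl by rewrite ge_min lexx.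
have dx_lt : dx < x by rewrite gt_min; apply/orP; right; lra.
have lo0 : 0 < x - dx by lra.
have hi0 : 0 < x + dx by lra.
have E1 : `|expR (- (k%:R * x)) - expR (- (k%:R * (x - dx)))| <= e / 8.
  by apply: dlP; rewrite opprB addrCA subrr addr0 gtr0_norm.
have E2 : `|expR (- (k%:R * x)) - expR (- (k%:R * (x + dx)))| <= e / 8.
  by apply: dlP; rewrite opprD addrA subrr sub0r normrN gtr0_norm.
pose eta := dx / (x + dx).
have eta0 : 0 < eta by rewrite divr_gt0.
pose a := Num.min (e / 8) 1.
have a0 : 0 < a by rewrite lt_min e8 ltr01.
have a1 : a <= 1 by rewrite ge_min lexx orbT.
have ae : a <= e / 8 by rewrite ge_min lexx.
have Ta := poisson_lt_near0 k0 (ltW a0) a1.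
have [b b0 Tb] : exists2 b, 0 < b & poisson_lt k b <= e / 8.
  near (pinfty_nbhs R) => b; exists b; first by near: b; exact: nbhs_pinfty_gt.
  have : `|0 - poisson_lt k b| <= e / 8.
    by near: b; have /cvgrPdist_le := @poisson_lt_cvg0 R k; exact.
  by rewrite sub0r normrN; apply: le_trans; exact: ler_norm.
move/cvgrPdist_le : (U_lim a0) => /(_ _ e8) Na.
move/cvgrPdist_le : (U_lim b0) => /(_ _ e8) Nb.
move/cvgrPdist_le : (ratio_lim lo0) => /(_ _ e8) Nlo.
move/cvgrPdist_le : (ratio_lim hi0) => /(_ _ e8) Nhi.
near=> n.
have v0 : 0 < v n by near: n; exact: v_pos.
have v1 : 1 + (`|ln a| + `|ln b|) / eta <= v n by near: n; move/cvgryPge : v_infty; exact.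
have lab : `|ln a| + `|ln b| <= eta * v n ^+ 2.
  have h0 : 0 <= `|ln a| + `|ln b| by rewrite addr_ge0.
  have h1 : 1 <= v n by apply: le_trans v1; rewrite lerDl divr_ge0 // ltW.
  apply: (@le_trans _ _ (eta * v n)).
    by rewrite mulrC -ler_pdivrMr //; apply: le_trans v1; rewrite lerDr.
  by rewrite expr2 ler_pM2l // ler_peMr // ltW.
have bound w : ~~ (U k n w < a) -> ~~ (b <= U k n w) ->
    1 - eta <= Num.sqrt n%:R * V k n w / v n <= 1 + eta.
  by rewrite -leNgt -ltNge; exact: slope_near1.
have spE w : spacing n w = Num.sqrt n%:R * V k n w / v n *
    (v n * (Num.sqrt n%:R * V k n w - Num.sqrt n%:R * V k.+1 n w)).
  rewrite -{1}(@sqr_sqrtr R n%:R) //; set q := Num.sqrt _; by field; rewrite gt_eqF.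
have rE y w : (expR y * U k n w < U k.+1 n w) =
    (y < v n * (Num.sqrt n%:R * V k n w - Num.sqrt n%:R * V k.+1 n w)).
  rewrite /U -expRD ltr_expR -ltrBrDr; congr (_ < _); ring.
have ma : measurable [set w | U k n w < a].
  by apply: measurable_set_ltr; [exact: mU|exact: measurable_cst].
have mb : measurable [set w | b <= U k n w].
  by apply: measurable_set_ler; [exact: measurable_cst|exact: mU].
have mr y : measurable [set w | expR y * U k n w < U k.+1 n w].
  apply: measurable_set_ltr; last exact: mU.
  by apply: measurable_funM; [exact: measurable_cst|exact: mU].
have ms : measurable [set w | x < spacing n w].
  by apply: measurable_set_ltr; [exact: measurable_cst|exact: mspacing].
have split_le A B : measurable A -> measurable B ->
    A `<=` B `|` ([set w | U k n w < a] `|` [set w | b <= U k n w]) ->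
    Pr (P n) A <= Pr (P n) B + (Pr (P n) [set w | U k n w < a] + Pr (P n) [set w | b <= U k n w]).
  move=> mA mB AB; apply: (@le_trans _ _ _ _ _ (le_Pr (P n) mA _ AB)).
    by apply: measurableU => //; exact: measurableU.
  apply: le_trans (Pr_setU_le _ _ _) _ => //; first exact: measurableU.
  by rewrite lerD2l; exact: Pr_setU_le.
have Ua : Pr (P n) [set w | U k n w < a] = 1 - Pr (P n) [set w | a <= U k n w].
  rewrite -Pr_setC; last by apply: measurable_set_ler; [exact: measurable_cst|exact: mU].
  congr Pr; apply/seteqP; split => w /=; first by move=> h; apply/negP; rewrite -ltNge.
  by move=> /negP; rewrite -ltNge.
have up : Pr (P n) [set w | x < spacing n w] <=
    Pr (P n) [set w | expR (x - dx) * U k n w < U k.+1 n w] +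
    (Pr (P n) [set w | U k n w < a] + Pr (P n) [set w | b <= U k n w]).
  apply: split_le => // w /= xw.
  have [h1|/bound h1] := boolP (U k n w < a); first by right; left.
  have [h2|/h1 {}h1] := boolP (b <= U k n w); first by right; right.
  by left; rewrite rE; move: xw; rewrite spE; exact: (slope_sandwich _ dx0 dx_lt h1).1.
have lo : Pr (P n) [set w | expR (x + dx) * U k n w < U k.+1 n w] <=
    Pr (P n) [set w | x < spacing n w] +
    (Pr (P n) [set w | U k n w < a] + Pr (P n) [set w | b <= U k n w]).
  apply: split_le => // w /=; rewrite rE.
  have [h1|/bound h1] := boolP (U k n w < a); first by right; left.
  have [h2|/h1 {}h1] := boolP (b <= U k n w); first by right; right.
  by move=> xr; left; rewrite spE; exact: (slope_sandwich _ dx0 dx_lt h1).2.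
have h1 : `|poisson_lt k a - Pr (P n) [set w | a <= U k n w]| <= e / 8 by near: n.
have h2 : `|poisson_lt k b - Pr (P n) [set w | b <= U k n w]| <= e / 8 by near: n.
have h3 : `|expR (- (k%:R * (x - dx))) - Pr (P n) [set w | expR (x - dx) * U k n w < U k.+1 n w]| <= e / 8 by near: n.
have h4 : `|expR (- (k%:R * (x + dx))) - Pr (P n) [set w | expR (x + dx) * U k n w < U k.+1 n w]| <= e / 8 by near: n.
rewrite Ua in up lo.
apply: dist_le_sum8 E1 E2 _ Tb h1 h2 h3 h4 up lo; exact: le_trans (lerB (lexx _) ae) Ta.
Unshelve. all: by end_near. Qed.

End LevelVariable.

Lemma spacing_cdf x :
  Pr (P n) [set w | spacing n w <= x] @[n --> \oo] -->
  (if x <= 0 then 0 else 1 - expR (- k%:R * x) : R).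
Proof.
have [v [vi vm]] := exists_level adm sZ.
have tail := spacing_tail vi vm.
have ms y n : measurable [set w : T n | y < spacing n w].
  by apply: measurable_set_ltr; [exact: measurable_cst|exact: mspacing].
have PE n : Pr (P n) [set w | spacing n w <= x] = 1 - Pr (P n) [set w | x < spacing n w].
  rewrite -Pr_setC //; congr Pr; apply/seteqP; split => w /=.
    by move=> h; apply/negP; rewrite -leNgt.
  by move=> /negP; rewrite -leNgt.
under eq_fun => n do rewrite PE.
have [x0|x0] := leP x 0; last by rewrite mulNr; apply: cvgB; [exact: cvg_cst|exact: tail].
(* For x <= 0 the tail at x dominates the tail at a small y > 0, whose limit exp(- k y) is at least
   1 - k y = 1 - e / 2. *)
apply/cvgrPdist_le => e e0.
have k1 : 0 < k%:R :> R by rewrite ltr0n.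
pose y := e / 2 / k%:R; have y0 : 0 < y by rewrite !divr_gt0.
have e2 : 0 < e / 2 by rewrite divr_gt0.
move/cvgrPdist_le : (tail y y0) => /(_ _ e2) tl; near=> n.
have : `|expR (- (k%:R * y)) - Pr (P n) [set w | y < spacing n w]| <= e / 2 by near: n.
have : 1 - k%:R * y <= expR (- (k%:R * y)) by exact: onem_le_expR.
have -> : k%:R * y = e / 2 by rewrite mulrC divfK // gt_eqF.
have : Pr (P n) [set w | y < spacing n w] <= Pr (P n) [set w | x < spacing n w].
  by apply: le_Pr => // w /=; apply: lt_trans; exact: le_lt_trans y0.
have : Pr (P n) [set w | x < spacing n w] <= 1 by exact: Pr_le1.
rewrite sub0r normrN !ler_norml => ? ? ? /andP[? ?].
by apply/andP; split; lra.
Unshelve. all: by end_near. Qed.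

End SpacingLimit.

Theorem theorem2 (R : realType) (conj : max_corr_conjecture R)
  (p : nat -> nat) (hp : admissible R p)
  (disp : nat -> measure_display) (T : forall n : nat, measurableType (disp n))
  (P : forall n : nat, probability (T n) R)
  (Z : forall n : nat, 'I_(p n) -> {RV (P n) >-> vec R n})
  (hZ : forall n : nat, (3 <= n)%N -> iid_spherical (Z n))
  (d k : nat) (hk : (1 <= k <= d)%N) :
  let V (j n : nat) (w : T n) : R := order_stat j (fun i : 'I_(p n) => Z n i w) in
  cvg_in_distribution P
    (fun (n : nat) (w : T n) => n%:R * V k n w * (V k n w - V k.+1 n w))
    (Exp k%:R^-1).
Proof.
have /andP[k0 _] := hk; move=> V x _.
rewrite /Exp invrK exponential_cdf.
have mV j n : (0 < j)%N -> measurable_fun [set: T n] (V j n) by exact: measurable_order_stat.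
apply: cvg_EFin; last exact: (spacing_cdf hp hZ k0).
apply: nearW => n; rewrite -EFin_Pr //.
apply: measurable_set_ler; last exact: measurable_cst.
apply: measurable_funM; last by apply: measurable_funB; exact: mV.
by apply: measurable_funM; [exact: measurable_cst|exact: mV].
Qed.
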